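(* Suppose $F$ is a meromorphic function on $\mathbb{D}_e=\{z\in\mathbb{C}:|z|>1\}$ which solves the nonlinear differential equation $F''-6F^2=0$. Then one of the following occurs: (a) $F(z)\equiv0$. (b) $F(z)=(z+\gamma_0)^{-2}$ for some point $\gamma_0\in\mathbb{C}$. (c) $F(z)=\wp(z+\gamma_0,\Lambda)$ for some point $\gamma_0\in\mathbb{C}$, where $\wp(z,\Lambda)$ is the Weierstrass elliptic function associated with a hexagonal lattice $\Lambda$.
   Context: For a lattice $\Lambda\subset\mathbb{C}$, $\wp(z,\Lambda)=\frac1{z^2}+\sum_{\lambda\in\Lambda\setminus\{0\}}\Big(\frac1{(z-\lambda)^2}-\frac1{\lambda^2}\Big)$. A hexagonal lattice is one of the form $\Lambda=c(\mathbb{Z}+e^{i\pi/3}\mathbb{Z})$ with $c\in\mathbb{C}\setminus\{0\}$. *)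

(* Defs.v *)
From Stdlib Require Import Reals List ClassicalEpsilon.
From Coquelicot Require Import Coquelicot.

Open Scope C_scope.

(** The Riemann sphere: [None] is the point at infinity.  A meromorphic
    function takes the value [None] exactly at its poles. *)
Definition sphere : Type := option C.

(** The value in [C]; the value [0] at a pole is a dummy, and [finval F] is only
    meaningful where [F] is finite. *)
Definition finval (F : C -> sphere) (z : C) : C :=
  match F z with Some w => w | None => 0 end.

Definition Cdifferentiable (f : C -> C) (z : C) : Prop :=
  @ex_derive C_AbsRing C_NormedModule f z.

Definition finite_diff (F : C -> sphere) (z : C) : Prop :=
  F z <> None /\ Cdifferentiable (finval F) z.

(** Either [F] is holomorphic in a neighbourhood of [z0], or [z0] is an isolated
    singularity at which [|F|] tends to infinity, i.e. a pole. *)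
Definition meromorphic_at (F : C -> sphere) (z0 : C) : Prop :=
  match F z0 with
  | Some _ => locally z0 (finite_diff F)
  | None =>
      locally' z0 (finite_diff F) /\
      filterlim (fun z => Cmod (finval F z)) (locally' z0) (Rbar_locally p_infty)
  end.

Definition meromorphic_on (D : C -> Prop) (F : C -> sphere) : Prop :=
  forall z, D z -> meromorphic_at F z.

(** [F'' = 6 F^2] as an identity of meromorphic functions: it is required at
    every point of [D] that is not a pole. *)
Definition solves_ode (D : C -> Prop) (F : C -> sphere) : Prop :=
  forall z, D z -> F z <> None ->
    @is_derive C_AbsRing C_NormedModule
      (C_derive (finval F)) z (6 * finval F z ^ 2).

Definition De (z : C) : Prop := (Cmod z > 1)%R.

(** Unordered (unconditional) summation over a set of complex numbers: the limit
    of the sums over finite subsets, directed by inclusion. *)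
Definition finite_subset (A : C -> Prop) (l : list C) : Prop :=
  NoDup l /\ forall x, In x l -> A x.

Definition finite_subsets (A : C -> Prop) (P : list C -> Prop) : Prop :=
  exists l0, finite_subset A l0 /\
    forall l, finite_subset A l -> incl l0 l -> P l.

Definition sum_list (f : C -> C) (l : list C) : C :=
  fold_right (fun x s => f x + s) 0 l.

Definition is_sum_over (A : C -> Prop) (f : C -> C) (s : C) : Prop :=
  filterlim (sum_list f) (finite_subsets A) (@locally C_UniformSpace s).

Definition sum_over (A : C -> Prop) (f : C -> C) : C :=
  iota (T := C_CompleteNormedModule) (is_sum_over A f).

Global Instance finite_subsets_proper (A : C -> Prop) :
  ProperFilter (finite_subsets A).
Proof.
constructor.
- intros P (l0 & H0 & H). exists l0. apply H; [exact H0 | apply incl_refl].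
- constructor.
  + exists nil. split; [|easy]. split; [constructor | easy].
  + intros P Q (l & (Hl & Al) & HP) (m & (Hm & Am) & HQ).
    exists (nodup Ceq_dec (l ++ m)). split.
    * split; [apply NoDup_nodup|].
      intros x Hx. apply nodup_In, in_app_or in Hx. destruct Hx; auto.
    * intros k Hk Hi. split; [apply HP | apply HQ]; try exact Hk;
        intros x Hx; apply Hi, nodup_In, in_or_app; auto.
  + intros P Q HPQ (l0 & H0 & H). exists l0. split; auto.
Qed.

Lemma sum_over_unique (A : C -> Prop) (f : C -> C) (s : C) :
  is_sum_over A f s -> sum_over A f = s.
Proof.
intros H. apply (iota_filterlim_locally (V := C_CompleteNormedModule)
  (F := finite_subsets A) (sum_list f)). exact H.
Qed.

Definition expi (t : R) : C := (cos t, sin t).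

Definition hexagonal_lattice (L : C -> Prop) : Prop :=
  exists c : C, c <> 0 /\
    forall z, L z <->
      exists m n : Z, z = c * (IZR m + IZR n * expi (PI / 3)).

(** The Weierstrass function of [L], with value infinity at the points of [L]. *)
Definition weierstrass_p (z : C) (L : C -> Prop) : sphere :=
  if excluded_middle_informative (L z) then None
  else Some (/ z ^ 2 +
             sum_over (fun l => L l /\ l <> 0)
                      (fun l => / (z - l) ^ 2 - / l ^ 2)).

(** [w |-> w^(-2)], with its double pole at [0]. *)
Definition inv_square (w : C) : sphere :=
  if Ceq_dec w 0 then None else Some (/ w ^ 2).

(* Main.v *)
(** A solution is determined near a regular point by [F] and [F'] there, and agreement of two meromorphic
    solutions spreads along paths, also through poles, because a punctured disc is connected. As [De] is
    connected, it suffices to match [(F, F')] at one regular point by a solution that is meromorphic on the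
    whole plane. Put [g3 = 4 F^3 - F'^2] at that point. If [g3 = 0], the match is [0] or [(z + gamma0)^(-2)].
    If [g3 <> 0], it is a rescaled Weierstrass function of the lattice [Z + e^(i pi/3) Z].

    No Cauchy theory is used. The substitute for Liouville's theorem is that a doubly periodic [H] which has
    quadratic Taylor expansions off the lattice and is [O(z)] at [0] vanishes: otherwise [|H^2 / z|], which
    tends to [0] at infinity and at the lattice points, would have a maximum, against the mean value
    inequality on the four points [z + t], [z - t], [z + i t], [z - i t]. Applied to [p'' - 6 p^2] this gives
    the equation of the Weierstrass function [p] (hexagonal symmetry kills [G_4]); applied to [1 / (p - a)]
    it shows that [p] takes every value [a]. *)

Require Import Defs.
From Stdlib Require Import Reals Lra Lia Psatz ZArith List Permutation Classical ClassicalEpsilon.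
From Coquelicot Require Import Coquelicot.
Import ListNotations.

Local Open Scope C_scope.

(** * Complex derivatives and a uniqueness principle for linear equations *)

(** If [F] solves the equation, so does [c^(-2) F(z/c)], and its invariant [4 F^3 - F'^2] is
    multiplied by [c^(-6)]. Hence one lattice serves all solutions of nonzero invariant, once its
    own [wp_g3] is known not to vanish. That [wp] takes every value adjusts only the value of the
    solution; the first-order equation then determines the derivative up to sign, and the sign is
    absorbed by passing from [c] to [- c]. The form [H^2 / z] is a compromise. Periodicity makes [H]
    bounded but gives no decay, so a division by [z] is needed at infinity; [H / z] would be merely
    bounded at [0], and the square restores the limit [0] there. The quotient is no longer periodic,
    so its maximum is sought on a large square. The mean value inequality needs only quadratic
    expansions with cubic remainder. Lattice sums have them by adding up the expansions of the
    terms, with no theorem on differentiation of series. *)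

Lemma Cmod_minus_sym (x y : C) : Cmod (x - y) = Cmod (y - x).
Proof. rewrite <- Cmod_opp. f_equal. ring. Qed.

Lemma Cmod_triangle_rev (x y : C) : (Cmod x - Cmod y <= Cmod (x - y))%R.
Proof. pose proof (Cmod_triangle (x - y) y) as H. replace (x - y + y) with x in H by ring. lra. Qed.

Lemma Cmod_triangle_minus (x y : C) : (Cmod (x - y) <= Cmod x + Cmod y)%R.
Proof. pose proof (Cmod_triangle x (- y)). rewrite Cmod_opp in H. exact H. Qed.

Lemma locally_Cmod (z : C) (P : C -> Prop) :
  @locally C_UniformSpace z P <->
  exists d : R, (0 < d)%R /\ forall w, (Cmod (w - z) < d)%R -> P w.
Proof.
split.
- intros [e H]. exists e. split; [apply cond_pos|].
  intros w Hw. apply H. apply C_NormedModule_mixin_compat1. exact Hw.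
- intros (d & Hd & H). apply locally_C. exists (mkposreal d Hd). intros w Hw. apply H. exact Hw.
Qed.

Lemma locally'_Cmod (z : C) (P : C -> Prop) :
  @locally' C_UniformSpace z P <->
  exists d : R, (0 < d)%R /\ forall w, w <> z -> (Cmod (w - z) < d)%R -> P w.
Proof.
unfold locally', within. rewrite locally_Cmod.
split; intros (d & Hd & H); exists d; split; auto.
Qed.

Lemma is_derive_Cmod (f : C -> C) (z l : C) :
  @is_derive C_AbsRing C_NormedModule f z l <->
  forall eps : R, (0 < eps)%R -> exists d : R, (0 < d)%R /\
    forall w, (Cmod (w - z) < d)%R -> (Cmod (f w - f z - (w - z) * l) <= eps * Cmod (w - z))%R.
Proof.
split.
- intros [_ H] eps He.
  specialize (H z (fun P HP => HP) (mkposreal eps He)).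
  destruct H as [d H]. exists d. split; [apply cond_pos|]. intros w Hw. apply H. exact Hw.
- intros H. split; [apply is_linear_scal_l|].
  intros x Hx eps.
  assert (x = z) by (symmetry; apply (is_filter_lim_locally_unique (V := AbsRing_NormedModule C_AbsRing)); exact Hx). subst x.
  destruct (H eps (cond_pos eps)) as (d & Hd & K).
  exists (mkposreal d Hd). intros w Hw. apply K. exact Hw.
Qed.


Definition Cder (f : C -> C) (z l : C) : Prop :=
  @is_derive C_AbsRing C_NormedModule f z l.

Lemma Cder_continuous (f : C -> C) (z l : C) : Cder f z l ->
  forall eps : R, (0 < eps)%R -> exists d : R, (0 < d)%R /\
    forall w, (Cmod (w - z) < d)%R -> (Cmod (f w - f z) < eps)%R.
Proof.
intros H eps He. apply is_derive_Cmod with (eps := 1%R) in H; [|lra].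
destruct H as (d & Hd & H).
pose proof (Cmod_ge_0 l) as Hl.
assert (Hq : (0 < eps / (2 + Cmod l))%R) by (apply Rdiv_lt_0_compat; lra).
exists (Rmin d (eps / (2 + Cmod l))). split; [apply Rmin_pos; auto|].
intros w Hw. assert (H1 := Rmin_l d (eps / (2 + Cmod l))). assert (H2 := Rmin_r d (eps / (2 + Cmod l))).
specialize (H w ltac:(lra)).
replace (f w - f z) with ((f w - f z - (w - z) * l) + (w - z) * l) by ring.
eapply Rle_lt_trans; [apply Cmod_triangle|]. rewrite Cmod_mult.
apply Rle_lt_trans with (Cmod (w - z) * (1 + Cmod l))%R; [lra|].
apply Rle_lt_trans with (eps / (2 + Cmod l) * (1 + Cmod l))%R.
- apply Rmult_le_compat_r; lra.
- replace eps with (eps / (2 + Cmod l) * (2 + Cmod l))%R at 2 by (field; lra).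
  apply Rmult_lt_compat_l; lra.
Qed.

Lemma Cder_ext_loc (f g : C -> C) (z l : C) (d : R) : (0 < d)%R ->
  (forall w, (Cmod (w - z) < d)%R -> f w = g w) -> Cder f z l -> Cder g z l.
Proof.
intros Hd He H. apply is_derive_Cmod. intros eps Hp.
destruct (proj1 (is_derive_Cmod f z l) H eps Hp) as (d' & Hd' & K).
exists (Rmin d d'). split; [apply Rmin_pos; auto|].
intros w Hw. assert (H1 := Rmin_l d d'). assert (H2 := Rmin_r d d').
rewrite <- He by lra. rewrite <- (He z). apply K; lra.
replace (z - z) with (RtoC 0) by ring. rewrite Cmod_0. lra.
Qed.

Lemma Cder_const (c z : C) : Cder (fun _ => c) z 0.
Proof. exact (is_derive_const (K := C_AbsRing) (V := C_NormedModule) c z). Qed.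

Lemma Cder_minus (f g : C -> C) (z a b : C) : Cder f z a -> Cder g z b ->
  Cder (fun w => f w - g w) z (a - b).
Proof. exact (is_derive_minus (K := C_AbsRing) (V := C_NormedModule) f g z a b). Qed.

Lemma Cder_mult (f g : C -> C) (z a b : C) : Cder f z a -> Cder g z b ->
  Cder (fun w => f w * g w) z (a * g z + f z * b).
Proof.
intros Hf Hg. apply is_derive_Cmod. intros eps He.
destruct (Cder_continuous g z b Hg (eps / (3 * (1 + Cmod a)))) as (d1 & Hd1 & K1).
{ pose proof (Cmod_ge_0 a). apply Rdiv_lt_0_compat; lra. }
destruct (Cder_continuous g z b Hg 1) as (d2 & Hd2 & K2); [lra|].
pose proof (Cmod_ge_0 (f z)) as Pf. pose proof (Cmod_ge_0 (g z)) as Pg. pose proof (Cmod_ge_0 a) as Pa.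
destruct (proj1 (is_derive_Cmod _ _ _) Hf (eps / (3 * (1 + Cmod (g z))))%R) as (d3 & Hd3 & K3).
{ apply Rdiv_lt_0_compat; lra. }
destruct (proj1 (is_derive_Cmod _ _ _) Hg (eps / (3 * (1 + Cmod (f z))))%R) as (d4 & Hd4 & K4).
{ apply Rdiv_lt_0_compat; lra. }
exists (Rmin (Rmin d1 d2) (Rmin d3 d4)). split; [repeat apply Rmin_pos; auto|].
intros w Hw.
assert (B : (Cmod (w - z) < d1 /\ Cmod (w - z) < d2 /\ Cmod (w - z) < d3 /\ Cmod (w - z) < d4)%R).
{ pose proof (Rmin_l (Rmin d1 d2) (Rmin d3 d4)). pose proof (Rmin_r (Rmin d1 d2) (Rmin d3 d4)).
  pose proof (Rmin_l d1 d2). pose proof (Rmin_r d1 d2).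
  pose proof (Rmin_l d3 d4). pose proof (Rmin_r d3 d4). lra. }
destruct B as (B1 & B2 & B3 & B4).
specialize (K1 w B1). specialize (K2 w B2). specialize (K3 w B3). specialize (K4 w B4).
set (k := w - z) in *.
replace (f w * g w - f z * g z - k * (a * g z + f z * b))
  with ((f w - f z - k * a) * g w + (k * a * (g w - g z) + f z * (g w - g z - k * b))) by ring.
assert (G : (Cmod (g w) <= 1 + Cmod (g z))%R).
{ pose proof (Cmod_triangle_rev (g w) (g z)). lra. }
pose proof (Cmod_ge_0 k) as Pk.
eapply Rle_trans; [apply Cmod_triangle|].
eapply Rle_trans; [apply Rplus_le_compat_l, Cmod_triangle|].
rewrite !Cmod_mult.
assert (T1 : (Cmod (f w - f z - k * a) * Cmod (g w) <= eps / 3 * Cmod k)%R).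
{ apply Rle_trans with (eps / (3 * (1 + Cmod (g z))) * Cmod k * (1 + Cmod (g z)))%R.
  - apply Rmult_le_compat; auto using Cmod_ge_0.
  - right. field. lra. }
assert (T2 : (Cmod k * Cmod a * Cmod (g w - g z) <= eps / 3 * Cmod k)%R).
{ apply Rle_trans with (Cmod k * (1 + Cmod a) * (eps / (3 * (1 + Cmod a))))%R.
  - apply Rmult_le_compat; try apply Rmult_le_pos; try apply Rmult_le_compat_l; try lra; auto using Cmod_ge_0.
  - right. field. lra. }
assert (T3 : (Cmod (f z) * Cmod (g w - g z - k * b) <= eps / 3 * Cmod k)%R).
{ apply Rle_trans with ((1 + Cmod (f z)) * (eps / (3 * (1 + Cmod (f z))) * Cmod k))%R.
  - apply Rmult_le_compat; try lra; auto using Cmod_ge_0.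
  - right. field. lra. }
lra.
Qed.

Lemma Cder_scal (f : C -> C) (c z a : C) : Cder f z a ->
  Cder (fun w => c * f w) z (c * a).
Proof.
intros H. replace (c * a) with (0 * f z + c * a) by ring.
exact (Cder_mult (fun _ => c) f z 0 a (Cder_const c z) H).
Qed.

Lemma Cder_affine (f : C -> C) (a b z l : C) : Cder f (a * z + b) l ->
  Cder (fun w => f (a * w + b)) z (a * l).
Proof.
intros H. apply is_derive_Cmod. intros eps He.
pose proof (Cmod_ge_0 a) as Pa.
destruct (proj1 (is_derive_Cmod _ _ _) H (eps / (1 + Cmod a))%R) as (d & Hd & K).
{ apply Rdiv_lt_0_compat; lra. }
exists (d / (1 + Cmod a))%R. split; [apply Rdiv_lt_0_compat; lra|].
intros w Hw. specialize (K (a * w + b)).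
replace (a * w + b - (a * z + b)) with (a * (w - z)) in K by ring.
replace (a * (w - z) * l) with ((w - z) * (a * l)) in K by ring.
rewrite Cmod_mult in K. pose proof (Cmod_ge_0 (w - z)).
eapply Rle_trans; [apply K|].
- apply Rle_lt_trans with ((1 + Cmod a) * Cmod (w - z))%R; [apply Rmult_le_compat_r; lra|].
  replace d with ((1 + Cmod a) * (d / (1 + Cmod a)))%R by (field; lra).
  apply Rmult_lt_compat_l; lra.
- apply Rle_trans with (eps / (1 + Cmod a) * ((1 + Cmod a) * Cmod (w - z)))%R.
  + apply Rmult_le_compat_l; [left; apply Rdiv_lt_0_compat; lra|]. apply Rmult_le_compat_r; lra.
  + right. field. lra.
Qed.

(** Passage to real functions of one variable, for which the mean value theorem is available. *)
Lemma Cder_segment (f : C -> C) (z k l : C) (t : R) : Cder f (z + t * k) l ->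
  is_derive (fun s : R => fst (f (z + s * k))) t (fst (k * l)) /\
  is_derive (fun s : R => snd (f (z + s * k))) t (snd (k * l)).
Proof.
intros H.
assert (K : forall eps : R, (0 < eps)%R -> exists d : posreal, forall h : R, h <> 0%R -> (Rabs h < d)%R ->
   (Cmod ((f (z + (t + h)%R * k)%C - f (z + t * k)%C) / h - k * l)%C < eps)%R).
{ intros eps He. pose proof (Cmod_ge_0 k) as Pk.
  destruct (proj1 (is_derive_Cmod _ _ _) H (eps / (1 + Cmod k))%R) as (d & Hd & K).
  { apply Rdiv_lt_0_compat; lra. }
  assert (Hd' : (0 < d / (1 + Cmod k))%R) by (apply Rdiv_lt_0_compat; lra).
  exists (mkposreal _ Hd'). simpl. intros h Hh Hlt.
  assert (Hh' : RtoC h <> 0) by (intros E; apply Hh, RtoC_inj, E).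
  specialize (K (z + (t + h)%R * k)).
  rewrite RtoC_plus in *.
  replace (z + (t + h) * k - (z + t * k)) with (h * k) in K by ring.
  rewrite Cmod_mult, Cmod_R in K. pose proof (Rabs_pos_lt h Hh).
  replace ((f (z + (t + h) * k) - f (z + t * k)) / h - k * l)
    with ((f (z + (t + h) * k) - f (z + t * k) - h * k * l) / h) by (field; auto).
  rewrite Cmod_div, Cmod_R by auto.
  apply Rmult_lt_reg_r with (Rabs h); auto.
  unfold Rdiv. rewrite Rmult_assoc, Rinv_l, Rmult_1_r by lra.
  eapply Rle_lt_trans; [apply K|].
  - apply Rle_lt_trans with (Rabs h * (1 + Cmod k))%R; [apply Rmult_le_compat_l; lra|].
    replace d with (d / (1 + Cmod k) * (1 + Cmod k))%R by (field; lra).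
    apply Rmult_lt_compat_r; lra.
  - replace (eps * Rabs h)%R with (eps / (1 + Cmod k) * (Rabs h * (1 + Cmod k)))%R by (field; lra).
    apply Rmult_lt_compat_l; [apply Rdiv_lt_0_compat; lra|]. apply Rmult_lt_compat_l; lra. }
assert (Dre : forall (w : C) (h : R), h <> 0%R -> fst (w / h) = (fst w / h)%R /\ snd (w / h) = (snd w / h)%R).
{ intros [x y] h Hh. unfold Cdiv, Cinv, Cmult, RtoC; simpl. split; field; auto. }
split; apply is_derive_Reals; intros eps He; destruct (K eps He) as (d & Kd); exists d; intros h Hh Hlt;
  specialize (Kd h Hh Hlt);
  (eapply Rle_lt_trans; [|exact Kd]);
  (eapply Rle_trans; [|apply Rmax_Cmod]);
  destruct (Dre (f (z + (t + h)%R * k) - f (z + t * k)) h Hh) as (D1 & D2).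
- eapply Rle_trans; [|apply Rmax_l]. right. f_equal.
  match goal with |- _ = fst (?x - ?y) => change (fst (x - y)) with (fst x - fst y)%R end.
  rewrite D1. reflexivity.
- eapply Rle_trans; [|apply Rmax_r]. right. f_equal.
  match goal with |- _ = snd (?x - ?y) => change (snd (x - y)) with (snd x - snd y)%R end.
  rewrite D2. reflexivity.
Qed.

(** [E t * exp (- c * t)] has nonpositive derivative and starts at [0]. *)
Lemma gronwall_zero (E E' : R -> R) (c : R) :
  (forall t, (0 <= t <= 1)%R -> is_derive E t (E' t) /\ (E' t <= c * E t)%R) ->
  (E 0 = 0 -> 0 <= E 1 -> E 1 = 0)%R.
Proof.
intros H E0 E1.
destruct (MVT_gen (fun t => E t * exp (- c * t))%R 0 1 (fun t => (E' t - c * E t) * exp (- c * t))%R) as (x & Hx & Ex).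
- intros x Hx. rewrite Rmin_left, Rmax_right in Hx by lra.
  destruct (H x ltac:(lra)) as (D & _).
  auto_derive_fun (fun t => exp (- c * t))%R. intros Dexp.
  pose proof (is_derive_mult E (fun t => exp (- c * t))%R x _ _ D (Dexp x ltac:(exact I)) Rmult_comm) as D2.
  eapply is_derive_ext; [|].
  2: { replace ((E' x - c * E x) * exp (- c * x))%R with (plus (mult (E' x) (exp (- c * x))) (mult (E x) (- c * 1 * exp (- c * x))))%R; [exact D2|]. unfold plus, mult; simpl. ring. }
  intros t. reflexivity.
- intros x Hx. rewrite Rmin_left, Rmax_right in Hx by lra.
  destruct (H x ltac:(lra)) as (D & _).
  apply continuity_pt_mult.
  + apply derivable_continuous_pt. exists (E' x). apply is_derive_Reals. exact D.
  + apply derivable_continuous_pt. apply ex_derive_Reals_0. auto_derive. exact I.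
- rewrite Rmin_left, Rmax_right in Hx by lra.
  destruct (H x Hx) as (_ & D). rewrite E0 in Ex.
  assert (E 1 * exp (- c * 1) <= 0)%R.
  { replace (E 1 * exp (- c * 1))%R with ((E' x - c * E x) * exp (- c * x) * (1 - 0))%R by lra.
    pose proof (exp_pos (- c * x)). nra. }
  pose proof (exp_pos (- c * 1)). nra.
Qed.

Lemma Cmod_sqr (x : C) : (Cmod x ^ 2 = fst x ^ 2 + snd x ^ 2)%R.
Proof. rewrite Cmod2_alt. reflexivity. Qed.

(** Along the segment from [z] to [w] the energy [|u|^2 + |v|^2] starts at [0] and satisfies
    [E' <= c E] with [c = |w - z| (1 + |M|)]. *)
Lemma linear_ode_zero (u v phi : C -> C) (z : C) (d M : R) :
  (forall w, (Cmod (w - z) < d)%R ->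
     Cder u w (v w) /\ Cder v w (phi w * u w) /\ (Cmod (phi w) <= M)%R) ->
  u z = 0 -> v z = 0 ->
  forall w, (Cmod (w - z) < d)%R -> u w = 0 /\ v w = 0.
Proof.
intros H u0 v0 w Hw. set (k := w - z) in *.
pose (E := fun t : R => (Cmod (u (z + t * k)%C) ^ 2 + Cmod (v (z + t * k)%C) ^ 2)%R).
(* Twice the real inner product, so that [E'] is the derivative of [E]; [Hip] is the Cauchy-Schwarz
   inequality. *)
pose (ip := fun a b : C => (2 * (fst a * fst b + snd a * snd b))%R).
pose (E' := fun t : R => (ip (u (z + t * k)%C) (k * v (z + t * k)%C)%C + ip (v (z + t * k)%C) (k * (phi (z + t * k) * u (z + t * k)))%C)%R).
assert (Hip : forall a b, (ip a b <= 2 * (Cmod a * Cmod b))%R).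
{ intros a b. unfold ip. apply Rmult_le_compat_l; [lra|].
  apply Rsqr_incr_0_var; [|apply Rmult_le_pos; apply Cmod_ge_0].
  rewrite !Rsqr_pow2, Rpow_mult_distr, !Cmod_sqr.
  assert (0 <= (fst a * snd b - snd a * fst b) ^ 2)%R by apply pow2_ge_0. nra. }
assert (E1 : E 1%R = 0%R).
{ apply (gronwall_zero E E' (Cmod k * (1 + Rabs M))%R).
  - intros t Ht.
    assert (Hin : (Cmod (z + t * k - z) < d)%R).
    { replace (z + t * k - z) with (t * k) by ring. rewrite Cmod_mult, Cmod_R, Rabs_pos_eq by lra.
      pose proof (Cmod_ge_0 k). nra. }
    destruct (H _ Hin) as (Du & Dv & Hphi).
    apply Cder_segment in Du. apply Cder_segment in Dv.
    destruct Du as (Du1 & Du2). destruct Dv as (Dv1 & Dv2).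
    split.
    + apply is_derive_ext with (fun s : R => (fst (u (z + s * k)%C) ^ 2 + snd (u (z + s * k)%C) ^ 2 + (fst (v (z + s * k)%C) ^ 2 + snd (v (z + s * k)%C) ^ 2))%R).
      { intros s. unfold E. rewrite !Cmod_sqr. reflexivity. }
      unfold E', ip.
      match goal with |- is_derive _ _ ?l => replace l with
        ((INR 2 * fst (k * v (z + t * k))%C * fst (u (z + t * k)%C) ^ 1 + INR 2 * snd (k * v (z + t * k))%C * snd (u (z + t * k)%C) ^ 1
         + (INR 2 * fst (k * (phi (z + t * k) * u (z + t * k)))%C * fst (v (z + t * k)%C) ^ 1 + INR 2 * snd (k * (phi (z + t * k) * u (z + t * k)))%C * snd (v (z + t * k)%C) ^ 1)))%R end.
      2: { simpl INR. ring. }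
      apply @is_derive_plus; apply @is_derive_plus; apply is_derive_pow; assumption.
    + unfold E', E. set (U := u (z + t * k)) in *. set (V := v (z + t * k)) in *. set (P := phi (z + t * k)) in *.
      pose proof (Hip U (k * V)) as I1. pose proof (Hip V (k * (P * U))) as I2.
      rewrite Cmod_mult in I1. rewrite (Cmod_mult k), (Cmod_mult P U) in I2.
      pose proof (Cmod_ge_0 U). pose proof (Cmod_ge_0 V). pose proof (Cmod_ge_0 k). pose proof (Cmod_ge_0 P).
      assert (Cmod P <= Rabs M)%R by (eapply Rle_trans; [exact Hphi|apply Rle_abs]).
      assert (2 * (Cmod U * Cmod V) <= Cmod U ^ 2 + Cmod V ^ 2)%R.
      { assert (0 <= (Cmod U - Cmod V) ^ 2)%R by apply pow2_ge_0. nra. }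
      assert (0 <= Cmod U * Cmod V)%R by (apply Rmult_le_pos; auto).
      assert (Cmod P * (Cmod U * Cmod V) <= Rabs M * (Cmod U * Cmod V))%R by (apply Rmult_le_compat_r; auto).
      assert (0 <= Rabs M)%R by lra.
      apply Rle_trans with (Cmod k * (2 * (Cmod U * Cmod V) * (1 + Rabs M)))%R.
      { apply Rle_trans with (Cmod k * (2 * (Cmod U * Cmod V) + 2 * (Cmod P * (Cmod U * Cmod V))))%R; [lra|].
        apply Rmult_le_compat_l; lra. }
      apply Rle_trans with (Cmod k * ((Cmod U ^ 2 + Cmod V ^ 2) * (1 + Rabs M)))%R; [|right; ring].
      apply Rmult_le_compat_l; auto. apply Rmult_le_compat_r; lra.
  - unfold E. replace (z + 0%R * k) with z by ring. rewrite u0, v0, Cmod_0. ring.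
  - unfold E. apply Rplus_le_le_0_compat; apply pow2_ge_0. }
unfold E in E1. replace (z + 1%R * k) with w in E1 by (unfold k; ring).
pose proof (pow2_ge_0 (Cmod (u w))). pose proof (pow2_ge_0 (Cmod (v w))).
split; apply Cmod_eq_0; pose proof (Cmod_ge_0 (u w)); pose proof (Cmod_ge_0 (v w)); nra.
Qed.

(** * Continuation along paths *)

(** Connectedness of [[0, 1]]: [Q] holds at the supremum [T] of the times reached because it is
    closed along the path, and openness rules out [T < 1]. *)
Lemma path_continuation (Q : C -> Prop) (g : R -> C) :
  (forall t eps : R, (0 < eps)%R -> exists d : R, (0 < d)%R /\
     forall s, (Rabs (s - t) < d)%R -> (Cmod (g s - g t) < eps)%R) ->
  (forall t, (0 <= t <= 1)%R -> Q (g t) -> exists d : R, (0 < d)%R /\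
     forall w, (Cmod (w - g t) < d)%R -> Q w) ->
  (forall t, (0 <= t <= 1)%R ->
     (forall d : R, (0 < d)%R -> exists w, (Cmod (w - g t) < d)%R /\ Q w) -> Q (g t)) ->
  Q (g 0%R) -> Q (g 1%R).
Proof.
intros Hc Ho Hcl H0.
pose (S := fun t : R => (0 <= t <= 1)%R /\ forall s, (0 <= s <= t)%R -> Q (g s)).
destruct (completeness S) as (T & HT1 & HT2).
{ exists 1%R. intros t [Ht _]. lra. }
{ exists 0%R. split; [lra|]. intros s Hs. replace s with 0%R by lra. exact H0. }
assert (T0 : (0 <= T)%R).
{ apply HT1. split; [lra|]. intros s Hs. replace s with 0%R by lra. exact H0. }
assert (T1 : (T <= 1)%R).
{ apply HT2. intros t [Ht _]. lra. }
assert (Hlt : forall s, (0 <= s < T)%R -> Q (g s)).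
{ intros s Hs. destruct (classic (exists t, S t /\ (s < t)%R)) as [(t & [Ht1 Ht2] & Hst)|N].
  - apply Ht2. lra.
  - exfalso. assert (T <= s)%R; [|lra]. apply HT2. intros t Ht.
    destruct (Rle_or_lt t s); auto. exfalso. apply N. eauto. }
assert (QT : Q (g T)).
{ destruct (Req_dec T 0) as [->|NT]; [exact H0|].
  apply Hcl; [lra|]. intros e He. destruct (Hc T e He) as (d & Hd & K).
  exists (g (Rmax 0 (T - d / 2))).
  assert (0 <= Rmax 0 (T - d / 2) < T)%R.
  { split; [apply Rmax_l|]. apply Rmax_lub_lt; lra. }
  split; [apply K|apply Hlt; auto].
  pose proof (Rmax_r 0 (T - d / 2)). apply Rabs_def1; lra. }
destruct (Req_dec T 1) as [<-|NT]; [exact QT|]. exfalso.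
destruct (Ho T ltac:(lra) QT) as (e & He & K).
destruct (Hc T e He) as (d & Hd & K2).
assert (S (Rmin 1 (T + d / 2))).
{ split; [split; [apply Rmin_glb; lra|apply Rmin_l]|].
  intros s Hs. destruct (Rlt_or_le s T); [apply Hlt; lra|].
  apply K, K2. pose proof (Rmin_r 1 (T + d / 2)). apply Rabs_def1; lra. }
apply HT1 in H.
assert (T < Rmin 1 (T + d / 2))%R by (apply Rmin_glb_lt; lra). lra.
Qed.

Lemma Cmod_expi (t : R) : Cmod (expi t) = 1%R.
Proof.
transitivity (sqrt 1); [|apply sqrt_1]. unfold Cmod, expi; cbn [fst snd]. f_equal.
pose proof (sin2_cos2 t). unfold Rsqr in H. nra.
Qed.

Lemma expi_0 : expi 0 = 1.
Proof. unfold expi. rewrite cos_0, sin_0. reflexivity. Qed.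

Lemma expi_plus (s t : R) : expi (s + t) = expi s * expi t.
Proof.
unfold expi, Cmult; simpl. rewrite cos_plus, sin_plus. f_equal. ring.
Qed.

Lemma polar_form (w : C) : exists t : R, w = Cmod w * expi t.
Proof.
destruct (Ceq_dec w 0) as [->|Hw].
{ exists 0%R. rewrite Cmod_0. ring. }
assert (Hm : (0 < Cmod w)%R) by (apply Cmod_gt_0; auto).
destruct w as [x y]. set (m := Cmod (x, y)) in *.
assert (E : (m ^ 2 = x ^ 2 + y ^ 2)%R) by (unfold m; rewrite Cmod_sqr; reflexivity).
assert (E1 : ((x / m) ^ 2 + (y / m) ^ 2 = 1)%R) by (field_simplify; [rewrite <- E; field; lra | lra]).
assert (B : (-1 <= x / m <= 1)%R).
{ pose proof (pow2_ge_0 (y / m)). split; nra. }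
pose proof (cos_acos _ B) as Ec.
pose proof (sin2_cos2 (acos (x / m))) as Es. unfold Rsqr in Es. rewrite Ec in Es.
(* [acos] gives the angle up to sign: its sine is [y / m] or the opposite. *)
assert (Fac : ((sin (acos (x / m)) - y / m) * (sin (acos (x / m)) + y / m) = 0)%R) by nra.
apply Rmult_integral in Fac.
destruct Fac as [F|F].
- exists (acos (x / m)). unfold expi. rewrite Ec.
  replace (sin (acos (x / m))) with (y / m)%R by lra.
  unfold Cmult, RtoC; simpl. f_equal; field; lra.
- exists (- acos (x / m))%R. unfold expi. rewrite cos_neg, sin_neg, Ec.
  replace (- sin (acos (x / m)))%R with (y / m)%R by lra.
  unfold Cmult, RtoC; simpl. f_equal; field; lra.
Qed.

Lemma sixth_root (w : C) : w <> 0 -> exists c : C, c <> 0 /\ c ^ 6 = w.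
Proof.
intros Hw. apply Cmod_gt_0 in Hw. destruct (polar_form w) as (t & Ht).
exists (exp (ln (Cmod w) / 6) * expi (t / 6)).
assert (E : (exp (ln (Cmod w) / 6) ^ 6 = Cmod w)%R).
{ transitivity (exp (ln (Cmod w))); [|apply exp_ln; auto].
  replace (ln (Cmod w)) with (6 * (ln (Cmod w) / 6))%R at 2 by field.
  replace 6%R with (1 + (1 + (1 + (1 + (1 + 1)))))%R at 2 by ring.
  rewrite !Rmult_plus_distr_r, !Rmult_1_l, !exp_plus. ring. }
split.
- apply Cmod_gt_0. rewrite Cmod_mult, Cmod_expi, Cmod_R, Rmult_1_r. apply Rabs_pos_lt.
  pose proof (exp_pos (ln (Cmod w) / 6)). lra.
- assert (Et : expi t = expi (t / 6) ^ 6).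
  { replace t with (t / 6 + (t / 6 + (t / 6 + (t / 6 + (t / 6 + t / 6)))))%R at 1 by field.
    rewrite !expi_plus. ring. }
  transitivity (Cmod w * expi t); [|symmetry; exact Ht].
  rewrite <- E at 2. rewrite Et, RtoC_pow. ring.
Qed.

(* The path is a logarithmic spiral, which keeps [|w - z|] between its end values. *)
Lemma annulus_continuation (Q : C -> Prop) (z a b : C) : a <> z -> b <> z ->
  (forall w, (Rmin (Cmod (a - z)) (Cmod (b - z)) <= Cmod (w - z) <= Rmax (Cmod (a - z)) (Cmod (b - z)))%R ->
    (Q w -> exists d : R, (0 < d)%R /\ forall w', (Cmod (w' - w) < d)%R -> Q w') /\
    ((forall d : R, (0 < d)%R -> exists w', (Cmod (w' - w) < d)%R /\ Q w') -> Q w)) ->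
  Q a -> Q b.
Proof.
intros Ha Hb H Qa.
assert (Ha' : a - z <> 0) by (intros E; apply Ha; replace a with (a - z + z) by ring; rewrite E; ring).
assert (Hb' : b - z <> 0) by (intros E; apply Hb; replace b with (b - z + z) by ring; rewrite E; ring).
set (q := (b - z) / (a - z)).
assert (Hq : q <> 0).
{ intros E. apply Hb'. replace (b - z) with (q * (a - z)) by (unfold q; field; auto). rewrite E. ring. }
assert (Hm := proj1 (Cmod_gt_0 q) Hq).
destruct (polar_form q) as (th & Hth).
set (l := ln (Cmod q)).
assert (El : exp l = Cmod q) by (apply exp_ln; auto).
pose (e := fun t : R => (exp (t * l) * cos (t * th), exp (t * l) * sin (t * th))%R : C).
assert (Ee : forall t, e t = exp (t * l) * expi (t * th)).
{ intros t. unfold e, expi, Cmult, RtoC; simpl. f_equal; ring. }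
assert (Em : forall t, Cmod (e t) = exp (t * l)).
{ intros t. rewrite Ee, Cmod_mult, Cmod_expi, Cmod_R, Rmult_1_r. apply Rabs_pos_eq. left. apply exp_pos. }
pose (g := fun t : R => z + (a - z) * e t).
assert (G0 : g 0%R = a).
{ unfold g. rewrite Ee, !Rmult_0_l, exp_0, expi_0. ring. }
assert (G1 : g 1%R = b).
{ unfold g. rewrite Ee, !Rmult_1_l, El, <- Hth. unfold q. field. auto. }
assert (Eb : (Cmod (b - z) = Cmod (a - z) * exp l)%R).
{ rewrite El. unfold q. rewrite <- Cmod_mult. f_equal. field. auto. }
assert (Hr : forall t, (0 <= t <= 1)%R ->
  (Rmin (Cmod (a - z)) (Cmod (b - z)) <= Cmod (g t - z) <= Rmax (Cmod (a - z)) (Cmod (b - z)))%R).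
{ assert (exp_le : forall x y, (x <= y)%R -> (exp x <= exp y)%R).
  { intros x y [h| ->]; [left; apply exp_increasing; auto|lra]. }
  intros t Ht. replace (g t - z) with ((a - z) * e t) by (unfold g; ring).
  rewrite Cmod_mult, Em, Eb. pose proof (Cmod_ge_0 (a - z)) as Pa.
  destruct (Rle_or_lt 0 l) as [Hl|Hl].
  - assert (1 <= exp (t * l))%R by (rewrite <- exp_0; apply exp_le; nra).
    assert (exp (t * l) <= exp l)%R by (apply exp_le; nra).
    rewrite Rmin_left, Rmax_right by nra. nra.
  - assert (exp (t * l) <= 1)%R by (rewrite <- exp_0; apply exp_le; nra).
    assert (exp l <= exp (t * l))%R by (apply exp_le; nra).
    rewrite Rmin_right, Rmax_left by nra. nra. }
rewrite <- G1.
apply (path_continuation Q g); [ | | |rewrite G0; exact Qa].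
- intros t eps He.
  assert (Pa := proj1 (Cmod_gt_0 _) Ha').
  assert (C1 : continuity_pt (fun t => exp (t * l) * cos (t * th))%R t).
  { apply derivable_continuous_pt, ex_derive_Reals_0. auto_derive. auto. }
  assert (C2 : continuity_pt (fun t => exp (t * l) * sin (t * th))%R t).
  { apply derivable_continuous_pt, ex_derive_Reals_0. auto_derive. auto. }
  assert (He' : (0 < eps / (2 * Cmod (a - z)))%R) by (apply Rdiv_lt_0_compat; lra).
  apply continuity_pt_locally with (eps := mkposreal _ He') in C1.
  apply continuity_pt_locally with (eps := mkposreal _ He') in C2.
  destruct C1 as [d1 K1]. destruct C2 as [d2 K2]. simpl in K1, K2.
  exists (Rmin d1 d2). split; [apply Rmin_pos; apply cond_pos|].
  intros s Hs.
  specialize (K1 s (Rlt_le_trans _ _ _ Hs (Rmin_l _ _))).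
  specialize (K2 s (Rlt_le_trans _ _ _ Hs (Rmin_r _ _))).
  unfold g. replace (z + (a - z) * e s - (z + (a - z) * e t)) with ((a - z) * (e s - e t)) by ring.
  rewrite Cmod_mult.
  set (x := (exp (s * l) * cos (s * th) - exp (t * l) * cos (t * th))%R) in *.
  set (y := (exp (s * l) * sin (s * th) - exp (t * l) * sin (t * th))%R) in *.
  assert (Ed : e s - e t = x + Ci * y).
  { unfold e, x, y, Cminus, Cplus, Copp, Cmult, Ci, RtoC; simpl. f_equal; ring. }
  assert (Cmod (e s - e t) < 2 * (eps / (2 * Cmod (a - z))))%R.
  { rewrite Ed. eapply Rle_lt_trans; [apply Cmod_triangle|]. rewrite Cmod_mult, Cmod_Ci, !Cmod_R. lra. }
  apply Rlt_le_trans with (Cmod (a - z) * (2 * (eps / (2 * Cmod (a - z)))))%R.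
  + apply Rmult_lt_compat_l; auto.
  + right. field. lra.
- intros t Ht. apply (H _ (Hr t Ht)).
- intros t Ht. apply (H _ (Hr t Ht)).
Qed.

(** * Continuation of solutions through poles *)

Definition near (z : C) (P : C -> Prop) : Prop :=
  exists d : R, (0 < d)%R /\ forall w, (Cmod (w - z) < d)%R -> P w.

Definition near' (z : C) (P : C -> Prop) : Prop :=
  exists d : R, (0 < d)%R /\ forall w, w <> z -> (Cmod (w - z) < d)%R -> P w.

Lemma near_self (z : C) (P : C -> Prop) : near z P -> P z.
Proof.
intros (d & Hd & H). apply H. replace (z - z) with (RtoC 0) by ring. rewrite Cmod_0. exact Hd.
Qed.

Lemma near_and (z : C) (P Q : C -> Prop) :
  near z P -> near z Q -> near z (fun w => P w /\ Q w).
Proof.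
intros (d & Hd & H) (e & He & K). exists (Rmin d e). split; [apply Rmin_pos; auto|].
intros w Hw. pose proof (Rmin_l d e). pose proof (Rmin_r d e). split; [apply H|apply K]; lra.
Qed.

Lemma near_imp (z : C) (P Q : C -> Prop) :
  (forall w, P w -> Q w) -> near z P -> near z Q.
Proof. intros I (d & Hd & H). exists d. auto. Qed.

Lemma near_near (z : C) (P : C -> Prop) : near z P -> near z (fun w => near w P).
Proof.
intros (d & Hd & H). exists d. split; auto. intros w Hw.
exists (d - Cmod (w - z))%R. split; [lra|]. intros x Hx. apply H.
replace (x - z) with ((x - w) + (w - z)) by ring.
eapply Rle_lt_trans; [apply Cmod_triangle|]. lra.
Qed.

Lemma near'_near (z : C) (P : C -> Prop) : near' z P -> near' z (fun w => near w P).
Proof.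
intros (d & Hd & H). exists d. split; auto. intros w Hwz Hw.
assert (Hp : (0 < Cmod (w - z))%R).
{ apply Cmod_gt_0. intros E. apply Hwz. replace w with (w - z + z) by ring. rewrite E. ring. }
exists (Rmin (Cmod (w - z)) (d - Cmod (w - z))). split; [apply Rmin_pos; lra|]. intros x Hx.
pose proof (Rmin_l (Cmod (w - z)) (d - Cmod (w - z))).
pose proof (Rmin_r (Cmod (w - z)) (d - Cmod (w - z))).
apply H.
- intros ->. rewrite Cmod_minus_sym in Hx. lra.
- replace (x - z) with ((x - w) + (w - z)) by ring.
  eapply Rle_lt_trans; [apply Cmod_triangle|]. lra.
Qed.

(** The witness may be [z] itself: this is closure, not accumulation. *)
Definition adherent (Q : C -> Prop) (z : C) : Prop :=
  forall d : R, (0 < d)%R -> exists w, (Cmod (w - z) < d)%R /\ Q w.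

Lemma adherent_near (Q P : C -> Prop) (z : C) : adherent Q z -> near z P -> exists w, P w /\ Q w.
Proof. intros H (d & Hd & K). destruct (H d Hd) as (w & Hw & Qw). eauto. Qed.

Lemma Cder_near (f : C -> C) (z l : C) (eps : R) : (0 < eps)%R -> Cder f z l ->
  near z (fun w => (Cmod (f w - f z) < eps)%R).
Proof. intros He H. exact (Cder_continuous f z l H eps He). Qed.

Lemma adherent_eq (Q : C -> Prop) (f g : C -> C) (z a b : C) :
  adherent Q z -> (forall w, Q w -> f w = g w) -> Cder f z a -> Cder g z b -> f z = g z.
Proof.
intros HQ He Hf Hg.
destruct (Ceq_dec (f z - g z) 0) as [E|N].
{ replace (f z) with (f z - g z + g z) by ring. rewrite E. ring. }
exfalso. apply Cmod_gt_0 in N.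
destruct (adherent_near _ _ _ HQ (near_and _ _ _
  (Cder_near f z a (Cmod (f z - g z) / 2) ltac:(lra) Hf)
  (Cder_near g z b (Cmod (f z - g z) / 2) ltac:(lra) Hg))) as (w & (H1 & H2) & Qw).
rewrite (He w Qw) in H1. rewrite Cmod_minus_sym in H1.
pose proof (Cmod_triangle (f z - g w) (g w - g z)) as T.
replace (f z - g w + (g w - g z)) with (f z - g z) in T by ring. lra.
Qed.

(** The second-order equation as a first-order system for the pair [(F, f1)]. *)
Definition ode_at (F : C -> sphere) (f1 : C -> C) (z : C) : Prop :=
  F z <> None /\ Cder (finval F) z (f1 z) /\ Cder f1 z (6 * finval F z ^ 2).

(* [f1] is the derivative of [F]; its values at the poles are junk. *)
Definition ode_solution (D : C -> Prop) (F : C -> sphere) (f1 : C -> C) : Prop :=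
  forall z, D z ->
    (F z <> None -> near z (ode_at F f1)) /\
    (F z = None -> near' z (ode_at F f1) /\
       forall M : R, near' z (fun w => (M < Cmod (finval F w))%R)).

(** Agreement on a whole neighbourhood is an open condition by construction, which leaves only
    closedness to prove. Derivatives are included because uniqueness needs both initial values. *)
Definition agree (F : C -> sphere) (f1 : C -> C) (G : C -> sphere) (g1 : C -> C) (z : C) : Prop :=
  near z (fun w => F w = G w /\ (F w <> None -> f1 w = g1 w)).

Lemma finval_inj (F G : C -> sphere) (z : C) :
  F z <> None -> G z <> None -> finval F z = finval G z -> F z = G z.
Proof. unfold finval. destruct (F z), (G z); congruence. Qed.

(** Since [F^2 - G^2 = (F + G) (F - G)], the difference solves the linear equation [u'' = phi u]
    with [phi = 6 (F + G)], which is bounded near [z] by continuity. *)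
Lemma ode_unique (F G : C -> sphere) (f1 g1 : C -> C) (z : C) :
  near z (ode_at F f1) -> near z (ode_at G g1) ->
  finval F z = finval G z -> f1 z = g1 z -> agree F f1 G g1 z.
Proof.
intros HF HG E E1.
destruct (near_self _ _ HF) as (_ & DF & _). destruct (near_self _ _ HG) as (_ & DG & _).
assert (B := near_and _ _ _ (near_and _ _ _ HF HG) (near_and _ _ _
  (Cder_near _ _ _ 1 Rlt_0_1 DF) (Cder_near _ _ _ 1 Rlt_0_1 DG))).
destruct B as (d & Hd & B). exists d. split; auto.
pose proof (linear_ode_zero (fun w => finval F w - finval G w) (fun w => f1 w - g1 w)
  (fun w => 6 * (finval F w + finval G w)) z d (6 * (2 + Cmod (finval F z) + Cmod (finval G z)))) as L.
intros w Hw.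
destruct (L) with (w := w) as (L1 & L2).
- intros x Hx. destruct (B x Hx) as (((F0 & F1 & F2) & (G0 & G1 & G2)) & C1 & C2).
  split; [|split].
  + apply Cder_minus; assumption.
  + replace (6 * (finval F x + finval G x) * (finval F x - finval G x)) with
      (6 * finval F x ^ 2 - 6 * finval G x ^ 2) by ring. apply Cder_minus; assumption.
  + rewrite Cmod_mult, Cmod_R, Rabs_pos_eq by lra. apply Rmult_le_compat_l; [lra|].
    eapply Rle_trans; [apply Cmod_triangle|].
    pose proof (Cmod_triangle_rev (finval F x) (finval F z)).
    pose proof (Cmod_triangle_rev (finval G x) (finval G z)). lra.
- rewrite E. ring.
- rewrite E1. ring.
- exact Hw.
- destruct (B w Hw) as (((F0 & _) & (G0 & _)) & _).
  assert (Z : forall a b : C, a - b = 0 -> a = b).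
  { intros a b H. replace a with (a - b + b) by ring. rewrite H. ring. }
  split; [|intros _; apply Z; exact L2].
  apply finval_inj; auto.
Qed.

(** Values and derivatives pass to the limit by continuity, so both solutions have the same initial
    values at [z]. *)
Lemma agree_adherent_regular (F G : C -> sphere) (f1 g1 : C -> C) (z : C) :
  near z (ode_at F f1) -> near z (ode_at G g1) ->
  adherent (agree F f1 G g1) z -> agree F f1 G g1 z.
Proof.
intros HF HG HA.
destruct (near_self _ _ HF) as (F0 & F1 & F2). destruct (near_self _ _ HG) as (G0 & G1 & G2).
(* The witnesses are taken where [F] is finite, since [agree] says nothing about [f1] at a pole. *)
assert (HA' : adherent (fun w => ode_at F f1 w /\ agree F f1 G g1 w) z).
{ intros d Hd. destruct HF as (e & He & HF).
  destruct (HA (Rmin d e) (Rmin_pos _ _ Hd He)) as (w & Hw & Aw).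
  pose proof (Rmin_l d e). pose proof (Rmin_r d e).
  exists w. split; [lra|]. split; auto. apply HF. lra. }
apply ode_unique; auto.
- eapply (adherent_eq _ _ _ _ _ _ HA'); [|exact F1|exact G1].
  intros w (_ & Aw). apply near_self in Aw. unfold finval. rewrite (proj1 Aw). reflexivity.
- eapply (adherent_eq _ _ _ _ _ _ HA'); [|exact F2|exact G2].
  intros w ((Fw & _) & Aw). apply near_self in Aw. apply (proj2 Aw Fw).
Qed.

Lemma agree_sym (F G : C -> sphere) (f1 g1 : C -> C) (z : C) :
  agree F f1 G g1 z -> agree G g1 F f1 z.
Proof.
apply near_imp. intros w (H1 & H2). split; auto. intros N. symmetry. apply H2. rewrite H1. exact N.
Qed.

(** Close to [z] one function is large and the other bounded; if the witness is [z] itself, [None]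
    meets a finite value. *)
Lemma no_agree_at_pole (F G : C -> sphere) (f1 g1 : C -> C) (z : C) :
  F z = None -> (forall M : R, near' z (fun w => (M < Cmod (finval F w))%R)) ->
  near z (ode_at G g1) -> ~ adherent (agree F f1 G g1) z.
Proof.
intros HF Hinf HG HA.
destruct (near_self _ _ HG) as (G0 & G1 & _).
destruct (Hinf (Cmod (finval G z) + 1)%R) as (d & Hd & K).
destruct (Cder_near _ _ _ 1 Rlt_0_1 G1) as (e & He & K2).
destruct (HA _ (Rmin_pos _ _ Hd He)) as (w & Hw & Aw).
pose proof (Rmin_l d e). pose proof (Rmin_r d e).
apply near_self in Aw. destruct Aw as (Aw & _).
destruct (Ceq_dec w z) as [->|N].
- rewrite HF in Aw. congruence.
- specialize (K w N ltac:(lra)). specialize (K2 w ltac:(lra)).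
  assert (E : finval F w = finval G w) by (unfold finval; rewrite Aw; reflexivity).
  rewrite E in K. pose proof (Cmod_triangle_rev (finval G w) (finval G z)). lra.
Qed.

(* At a common pole no Laurent expansion is needed: both solutions are finite on a punctured disc,
   which is connected, so that agreement at one of its points spreads to all of them. *)
Lemma agree_adherent (D : C -> Prop) (F G : C -> sphere) (f1 g1 : C -> C) (z : C) :
  ode_solution D F f1 -> ode_solution D G g1 -> D z ->
  adherent (agree F f1 G g1) z -> agree F f1 G g1 z.
Proof.
intros SF SG Dz HA.
destruct (SF z Dz) as (RF & PF). destruct (SG z Dz) as (RG & PG).
destruct (F z) as [fz|] eqn:EF; destruct (G z) as [gz|] eqn:EG.
- apply agree_adherent_regular; auto; [apply RF|apply RG]; discriminate.
- exfalso. destruct (PG eq_refl) as (_ & PG2).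
  apply (no_agree_at_pole G F g1 f1 z EG PG2); [apply RF; discriminate|].
  intros d Hd. destruct (HA d Hd) as (w & Hw & Aw). exists w. split; auto. apply agree_sym; auto.
- exfalso. destruct (PF eq_refl) as (_ & PF2).
  apply (no_agree_at_pole F G f1 g1 z EF PF2); [apply RG; discriminate|auto].
- destruct (PF eq_refl) as (PF1 & _). destruct (PG eq_refl) as (PG1 & _).
  apply near'_near in PF1. apply near'_near in PG1.
  destruct PF1 as (d & Hd & PF1). destruct PG1 as (e & He & PG1).
  pose proof (Rmin_l d e). pose proof (Rmin_r d e).
  destruct (HA _ (Rmin_pos _ _ Hd He)) as (a & Ha & Aa).
  destruct (Ceq_dec a z) as [->|N]; [exact Aa|].
  exists (Rmin d e). split; [apply Rmin_pos; auto|].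
  intros b Hb. destruct (Ceq_dec b z) as [->|Nb].
  + split; congruence.
  + apply (near_self b (fun w => F w = G w /\ (F w <> None -> f1 w = g1 w))).
    apply (annulus_continuation (agree F f1 G g1) z a b N Nb); auto.
    intros w Hw.
    assert (Hw' : (Cmod (w - z) < Rmin d e)%R) by (eapply Rle_lt_trans; [apply Hw|apply Rmax_lub_lt; lra]).
    assert (Nw : w <> z).
    { intros ->. destruct Hw as (Hw & _). replace (z - z) with (RtoC 0) in Hw by ring. rewrite Cmod_0 in Hw.
      assert (0 < Rmin (Cmod (a - z)) (Cmod (b - z)))%R; [|lra].
      apply Rmin_pos; apply Cmod_gt_0; intros E0; [apply N|apply Nb].
      - replace a with (a - z + z) by ring. rewrite E0. ring.
      - replace b with (b - z + z) by ring. rewrite E0. ring. }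
    split; [apply near_near|].
    apply agree_adherent_regular; [apply PF1|apply PG1]; auto; lra.
Qed.

(** The centre [z] is free, apart from being neither end. This suits [De] with centre [0], and the
    whole plane with any centre. *)
Lemma ode_continuation (D : C -> Prop) (F G : C -> sphere) (f1 g1 : C -> C) (a b z : C) :
  ode_solution D F f1 -> ode_solution D G g1 ->
  a <> z -> b <> z ->
  (forall w, (Rmin (Cmod (a - z)) (Cmod (b - z)) <= Cmod (w - z))%R -> D w) ->
  F a <> None -> G a <> None -> finval F a = finval G a -> f1 a = g1 a -> F b = G b.
Proof.
intros SF SG Na Nb HD Fa Ga E E1.
apply (near_self b (fun w => F w = G w /\ (F w <> None -> f1 w = g1 w))).
apply (annulus_continuation (agree F f1 G g1) z a b Na Nb).
- intros w (Hw & _). split; [apply near_near|].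
  apply (agree_adherent D); auto.
- assert (Da : D a) by (apply HD, Rmin_l).
  apply ode_unique; auto; [apply (proj1 (SF a Da))|apply (proj1 (SG a Da))]; auto.
Qed.

(** * Unordered sums *)

Definition rsum {T : Type} (f : T -> R) (l : list T) : R :=
  fold_right (fun x s => (f x + s)%R) 0%R l.

Lemma rsum_app {T : Type} (f : T -> R) (l m : list T) : rsum f (l ++ m) = (rsum f l + rsum f m)%R.
Proof. induction l as [|x l IH]; simpl; [ring|rewrite IH; ring]. Qed.

Lemma rsum_pos {T : Type} (f : T -> R) (l : list T) :
  (forall x, (0 <= f x)%R) -> (0 <= rsum f l)%R.
Proof. intros H. induction l as [|x l IH]; simpl; [lra|]. specialize (H x). lra. Qed.

Lemma rsum_le {T : Type} (f g : T -> R) (l : list T) :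
  (forall x, In x l -> (f x <= g x)%R) -> (rsum f l <= rsum g l)%R.
Proof.
induction l as [|x l IH]; intros H; simpl; [lra|].
apply Rplus_le_compat; [apply H; now left|apply IH; intros; apply H; now right].
Qed.

Lemma rsum_scal {T : Type} (c : R) (f : T -> R) (l : list T) :
  rsum (fun x => (c * f x)%R) l = (c * rsum f l)%R.
Proof. induction l as [|x l IH]; simpl; [ring|rewrite IH; ring]. Qed.

Lemma rsum_map {T U : Type} (g : T -> U) (f : U -> R) (l : list T) :
  rsum f (map g l) = rsum (fun x => f (g x)) l.
Proof. induction l as [|x l IH]; simpl; [ring|rewrite IH; ring]. Qed.

Lemma rsum_incl {T : Type} (f : T -> R) (l m : list T) :
  (forall x, (0 <= f x)%R) -> NoDup l -> incl l m -> (rsum f l <= rsum f m)%R.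
Proof.
intros Hf. revert m. induction l as [|x l IH]; intros m Nd Hi; simpl.
- apply rsum_pos; auto.
- destruct (in_split x m (Hi x (or_introl eq_refl))) as (m1 & m2 & ->).
  inversion Nd as [|? ? Nx Nl]; subst.
  assert (H : (rsum f l <= rsum f (m1 ++ m2))%R).
  { apply IH; auto. intros y Hy. assert (In y (m1 ++ x :: m2)) by (apply Hi; now right).
    apply in_app_or in H. apply in_or_app. destruct H as [H|[H|H]]; auto. subst. contradiction. }
  rewrite rsum_app in *. simpl. lra.
Qed.

Lemma rsum_list_prod {T U : Type} (f : T -> R) (g : U -> R) (l : list T) (m : list U) :
  rsum (fun p => (f (fst p) * g (snd p))%R) (list_prod l m) = (rsum f l * rsum g m)%R.
Proof.
induction l as [|x l IH]; simpl; [ring|].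
rewrite rsum_app, IH, rsum_map. simpl. rewrite rsum_scal. ring.
Qed.

Lemma sum_list_app (f : C -> C) (l m : list C) : sum_list f (l ++ m) = sum_list f l + sum_list f m.
Proof. induction l as [|x l IH]; simpl; [ring|rewrite IH; ring]. Qed.

Lemma sum_list_perm (f : C -> C) (l m : list C) : Permutation l m -> sum_list f l = sum_list f m.
Proof. induction 1; simpl; [reflexivity|rewrite IHPermutation; reflexivity|ring|congruence]. Qed.

Lemma sum_list_bound (f : C -> C) (l : list C) :
  (Cmod (sum_list f l) <= rsum (fun x => Cmod (f x)) l)%R.
Proof.
induction l as [|x l IH]; simpl; [rewrite Cmod_0; lra|].
eapply Rle_trans; [apply Cmod_triangle|]. lra.
Qed.

Lemma NoDup_incl_split (l m : list C) : NoDup l -> NoDup m -> incl l m ->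
  exists k, Permutation m (l ++ k).
Proof.
intros Nl Nm Hi.
exists (filter (fun x => if in_dec Ceq_dec x l then false else true) m).
apply NoDup_Permutation; auto.
- apply NoDup_app; auto.
  + apply NoDup_filter; auto.
  + intros x Hx Hf. apply filter_In in Hf. destruct Hf as (_ & Hf).
    destruct (in_dec Ceq_dec x l); [discriminate|contradiction].
- intros x. rewrite in_app_iff, filter_In. split.
  + intros Hx. destruct (in_dec Ceq_dec x l); auto.
  + intros [Hx|[Hx _]]; auto.
Qed.

Lemma is_sum_over_Cmod (A : C -> Prop) (f : C -> C) (s : C) :
  is_sum_over A f s <->
  forall eps : R, (0 < eps)%R -> exists l0, finite_subset A l0 /\
    forall l, finite_subset A l -> incl l0 l -> (Cmod (sum_list f l - s) < eps)%R.
Proof.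
split.
- intros H eps He. apply (H (fun w => (Cmod (w - s) < eps)%R)).
  apply locally_Cmod. exists eps. auto.
- intros H P HP. apply locally_Cmod in HP. destruct HP as (d & Hd & HP).
  destruct (H d Hd) as (l0 & H0 & K). exists l0. split; auto.
Qed.

(** Absolute convergence gives the Cauchy property: take [l0] whose absolute sum is within [eps / 2]
    of the supremum [m]; whatever a larger finite set adds to it contributes less than [eps / 2]. *)
Lemma sum_over_exists (A : C -> Prop) (f : C -> C) (K : R) :
  (forall l, finite_subset A l -> (rsum (fun x => Cmod (f x)) l <= K)%R) ->
  exists s, is_sum_over A f s.
Proof.
intros HK.
apply (proj1 (filterlim_locally_cauchy (U := C_CompleteNormedModule) (F := finite_subsets A) (sum_list f))).
intros eps.
destruct (completeness (fun r => exists l, finite_subset A l /\ r = rsum (fun x => Cmod (f x)) l)) as (m & Hm1 & Hm2).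
{ exists K. intros r (l & Hl & ->). auto. }
{ exists 0%R. exists []. split; [split; [constructor|easy]|reflexivity]. }
assert (Hl : exists l, finite_subset A l /\ (m - eps / 2 < rsum (fun x => Cmod (f x)) l)%R).
{ apply NNPP. intros N. assert (m <= m - eps / 2)%R; [|pose proof (cond_pos eps); lra].
  apply Hm2. intros r (l & Hl & ->). apply Rnot_lt_le. intros Hr. apply N. eauto. }
destruct Hl as (l0 & Hl0 & Hgt).
exists (fun l => finite_subset A l /\ incl l0 l). split.
{ exists l0. split; auto. }
assert (Hu : forall u, finite_subset A u -> incl l0 u -> (Cmod (sum_list f u - sum_list f l0) < eps / 2)%R).
{ intros u Hu Hi. destruct (NoDup_incl_split l0 u (proj1 Hl0) (proj1 Hu) Hi) as (k & Hk).
  rewrite (sum_list_perm f _ _ Hk), sum_list_app.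
  replace (sum_list f l0 + sum_list f k - sum_list f l0) with (sum_list f k) by ring.
  eapply Rle_lt_trans; [apply sum_list_bound|].
  assert (Hlk : finite_subset A (l0 ++ k)).
  { split; [apply (Permutation_NoDup Hk), Hu|]. intros x Hx. apply Hu.
    apply (Permutation_in x (Permutation_sym Hk)), Hx. }
  assert (rsum (fun x => Cmod (f x)) (l0 ++ k) <= m)%R by (apply Hm1; eauto).
  rewrite rsum_app in H. lra. }
intros u v (Hu1 & Hu2) (Hv1 & Hv2).
apply C_NormedModule_mixin_compat1.
change (minus (sum_list f v) (sum_list f u)) with (sum_list f v - sum_list f u).
replace (sum_list f v - sum_list f u) with
  ((sum_list f v - sum_list f l0) - (sum_list f u - sum_list f l0)) by ring.
eapply Rle_lt_trans; [apply Cmod_triangle_minus|].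
pose proof (Hu u Hu1 Hu2). pose proof (Hu v Hv1 Hv2). lra.
Qed.

Lemma is_sum_over_unique (A : C -> Prop) (f : C -> C) (s t : C) :
  is_sum_over A f s -> is_sum_over A f t -> s = t.
Proof. intros H K. rewrite <- (sum_over_unique A f s H). apply sum_over_unique, K. Qed.

Lemma is_sum_over_bound (A : C -> Prop) (f : C -> C) (s : C) (K : R) :
  is_sum_over A f s ->
  (forall l, finite_subset A l -> (rsum (fun x => Cmod (f x)) l <= K)%R) -> (Cmod s <= K)%R.
Proof.
intros H HK. apply Rnot_lt_le. intros N.
destruct (proj1 (is_sum_over_Cmod A f s) H (Cmod s - K)%R ltac:(lra)) as (l & Hl & Hc).
specialize (Hc l Hl (incl_refl l)). specialize (HK l Hl).
pose proof (sum_list_bound f l). rewrite Cmod_minus_sym in Hc.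
pose proof (Cmod_triangle_rev s (sum_list f l)). lra.
Qed.

Lemma is_sum_over_ext (A : C -> Prop) (f g : C -> C) (s : C) :
  (forall x, A x -> f x = g x) -> is_sum_over A f s -> is_sum_over A g s.
Proof.
intros E. rewrite !is_sum_over_Cmod. intros H eps He. destruct (H eps He) as (l0 & H0 & K).
exists l0. split; auto. intros l Hl Hi.
replace (sum_list g l) with (sum_list f l); auto.
destruct Hl as (_ & Hl). clear Hi. induction l as [|x l IH]; simpl; auto.
rewrite E, IH; auto; [intros; apply Hl; now right|apply Hl; now left].
Qed.

Lemma sum_list_plus (f g : C -> C) (l : list C) :
  sum_list (fun x => f x + g x) l = sum_list f l + sum_list g l.
Proof. induction l as [|x l IH]; simpl; [ring|rewrite IH; ring]. Qed.

Lemma sum_list_scal (c : C) (f : C -> C) (l : list C) :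
  sum_list (fun x => c * f x) l = c * sum_list f l.
Proof. induction l as [|x l IH]; simpl; [ring|rewrite IH; ring]. Qed.

Lemma finite_subset_union (A : C -> Prop) (l m : list C) :
  finite_subset A l -> finite_subset A m ->
  exists k, finite_subset A k /\ incl l k /\ incl m k.
Proof.
intros (Nl & Hl) (Nm & Hm). exists (nodup Ceq_dec (l ++ m)). split; [split|split].
- apply NoDup_nodup.
- intros x Hx. apply nodup_In, in_app_or in Hx. destruct Hx; auto.
- intros x Hx. apply nodup_In, in_or_app. auto.
- intros x Hx. apply nodup_In, in_or_app. auto.
Qed.

Lemma is_sum_over_plus (A : C -> Prop) (f g : C -> C) (s t : C) :
  is_sum_over A f s -> is_sum_over A g t -> is_sum_over A (fun x => f x + g x) (s + t).
Proof.
rewrite !is_sum_over_Cmod. intros Hf Hg eps He.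
destruct (Hf (eps / 2)%R ltac:(lra)) as (l1 & H1 & K1).
destruct (Hg (eps / 2)%R ltac:(lra)) as (l2 & H2 & K2).
destruct (finite_subset_union A l1 l2 H1 H2) as (k & Hk & I1 & I2).
exists k. split; auto. intros l Hl Hi.
rewrite sum_list_plus.
replace (sum_list f l + sum_list g l - (s + t)) with ((sum_list f l - s) + (sum_list g l - t)) by ring.
eapply Rle_lt_trans; [apply Cmod_triangle|].
specialize (K1 l Hl (incl_tran I1 Hi)). specialize (K2 l Hl (incl_tran I2 Hi)). lra.
Qed.

Lemma is_sum_over_scal (A : C -> Prop) (c : C) (f : C -> C) (s : C) :
  is_sum_over A f s -> is_sum_over A (fun x => c * f x) (c * s).
Proof.
rewrite !is_sum_over_Cmod. intros Hf eps He. pose proof (Cmod_ge_0 c).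
destruct (Hf (eps / (1 + Cmod c))%R) as (l1 & H1 & K1); [apply Rdiv_lt_0_compat; lra|].
exists l1. split; auto. intros l Hl Hi. specialize (K1 l Hl Hi).
rewrite sum_list_scal. replace (c * sum_list f l - c * s) with (c * (sum_list f l - s)) by ring.
rewrite Cmod_mult. pose proof (Cmod_ge_0 (sum_list f l - s)).
apply Rle_lt_trans with ((1 + Cmod c) * Cmod (sum_list f l - s))%R; [nra|].
replace eps with ((1 + Cmod c) * (eps / (1 + Cmod c)))%R by (field; lra).
apply Rmult_lt_compat_l; lra.
Qed.

Lemma is_sum_over_minus (A : C -> Prop) (f g : C -> C) (s t : C) :
  is_sum_over A f s -> is_sum_over A g t -> is_sum_over A (fun x => f x - g x) (s - t).
Proof.
intros Hf Hg. replace (s - t) with (s + (-1) * t) by ring.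
apply is_sum_over_ext with (fun x => f x + (-1) * g x); [intros; ring|].
apply is_sum_over_plus, is_sum_over_scal; auto.
Qed.

Lemma is_sum_over_reindex (A B : C -> Prop) (phi psi : C -> C) (f : C -> C) (s : C) :
  (forall x, A x -> B (phi x)) -> (forall y, B y -> A (psi y)) ->
  (forall x, psi (phi x) = x) -> (forall y, phi (psi y) = y) ->
  is_sum_over B f s -> is_sum_over A (fun x => f (phi x)) s.
Proof.
intros HA HB E1 E2. rewrite !is_sum_over_Cmod. intros H eps He.
destruct (H eps He) as (l0 & (N0 & H0) & K).
exists (map psi l0). split; [split|].
- apply NoDup_map_NoDup_ForallPairs; auto. intros x y _ _ E. rewrite <- (E2 x), <- (E2 y), E. reflexivity.
- intros x Hx. apply in_map_iff in Hx. destruct Hx as (y & <- & Hy). auto.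
- intros l (Nl & Hl) Hi.
  assert (E : sum_list (fun x => f (phi x)) l = sum_list f (map phi l)).
  { clear. induction l as [|x l IH]; simpl; [reflexivity|rewrite IH; reflexivity]. }
  rewrite E. apply K; [split|].
  + apply NoDup_map_NoDup_ForallPairs; auto. intros x y _ _ E'. rewrite <- (E1 x), <- (E1 y), E'. reflexivity.
  + intros y Hy. apply in_map_iff in Hy. destruct Hy as (x & <- & Hx). auto.
  + intros y Hy. apply in_map_iff. exists (psi y). split; auto. apply Hi, in_map, Hy.
Qed.

Lemma is_sum_over_insert (A : C -> Prop) (a : C) (f : C -> C) (s : C) : A a ->
  is_sum_over (fun x => A x /\ x <> a) f s -> is_sum_over A f (f a + s).
Proof.
intros Aa. rewrite !is_sum_over_Cmod. intros H eps He.
destruct (H eps He) as (l0 & (N0 & H0) & K).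
exists (a :: l0). split; [split|].
- constructor; auto. intros Ha. apply (proj2 (H0 a Ha)). reflexivity.
- intros x [<-|Hx]; auto. apply H0, Hx.
- intros l (Nl & Hl) Hi.
  destruct (in_split a l (Hi a (or_introl eq_refl))) as (l1 & l2 & ->).
  assert (Np := NoDup_remove l1 l2 a Nl). destruct Np as (N1 & N2).
  rewrite (sum_list_perm f _ _ (Permutation_sym (Permutation_middle l1 l2 a))). simpl.
  replace (f a + sum_list f (l1 ++ l2) - (f a + s)) with (sum_list f (l1 ++ l2) - s) by ring.
  apply K; [split; auto|].
  + intros x Hx. split.
    * apply Hl. apply in_app_or in Hx. apply in_or_app. simpl. tauto.
    * intros ->. contradiction.
  + intros x Hx. assert (Hx' : In x (l1 ++ a :: l2)) by (apply Hi; now right).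
    apply in_app_or in Hx'. apply in_or_app. destruct Hx' as [?|[?|?]]; auto.
    subst. exfalso. apply (proj2 (H0 x Hx)). reflexivity.
Qed.

(** * The Eisenstein lattice *)

Definition zeta : C := expi (PI / 3).

Definition eisenstein (z : C) : Prop := exists m n : Z, z = IZR m + IZR n * zeta.

Lemma zeta_coords : zeta = (1 / 2, sqrt 3 / 2)%R.
Proof. unfold zeta, expi. rewrite cos_PI3, sin_PI3. reflexivity. Qed.

Lemma sqrt3_sqr : (sqrt 3 * sqrt 3 = 3)%R.
Proof. apply sqrt_sqrt. lra. Qed.

Lemma zeta_sqr : zeta * zeta = zeta - 1.
Proof.
rewrite zeta_coords. unfold Cmult, Cminus, Cplus, Copp, RtoC; simpl.
pose proof sqrt3_sqr. f_equal; lra.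
Qed.

Lemma zeta_neq_0 : zeta <> 0.
Proof. apply Cmod_gt_0. unfold zeta. rewrite Cmod_expi. lra. Qed.

Lemma zeta_cube : zeta ^ 3 = -1.
Proof.
replace (zeta ^ 3) with (zeta * zeta * zeta) by ring. rewrite zeta_sqr.
replace ((zeta - 1) * zeta) with (zeta * zeta - zeta) by ring. rewrite zeta_sqr. ring.
Qed.

Lemma eisenstein_plus (x y : C) : eisenstein x -> eisenstein y -> eisenstein (x + y).
Proof.
intros (m & n & ->) (p & q & ->). exists (m + p)%Z, (n + q)%Z. rewrite !plus_IZR, !RtoC_plus. ring.
Qed.

Lemma eisenstein_opp (x : C) : eisenstein x -> eisenstein (- x).
Proof.
intros (m & n & ->). exists (- m)%Z, (- n)%Z. rewrite !opp_IZR, !RtoC_opp. ring.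
Qed.

Lemma eisenstein_minus (x y : C) : eisenstein x -> eisenstein y -> eisenstein (x - y).
Proof. intros Hx Hy. apply eisenstein_plus; auto. apply eisenstein_opp; auto. Qed.

Lemma eisenstein_0 : eisenstein 0.
Proof. exists 0%Z, 0%Z. ring. Qed.

Lemma eisenstein_1 : eisenstein 1.
Proof. exists 1%Z, 0%Z. ring. Qed.

Lemma eisenstein_mult_zeta (x : C) : eisenstein x -> eisenstein (zeta * x).
Proof.
intros (m & n & ->). exists (- n)%Z, (m + n)%Z. rewrite plus_IZR, opp_IZR, RtoC_plus, RtoC_opp.
replace (zeta * (IZR m + IZR n * zeta)) with (IZR m * zeta + IZR n * (zeta * zeta)) by ring.
rewrite zeta_sqr. ring.
Qed.

Lemma eisenstein_div_zeta (x : C) : eisenstein x -> eisenstein (x / zeta).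
Proof.
(* [/ zeta = - zeta ^ 2], because [zeta ^ 3 = -1]. *)
intros H. replace (x / zeta) with (- (zeta * (zeta * x))).
- apply eisenstein_opp. do 2 apply eisenstein_mult_zeta. exact H.
- assert (E : - zeta ^ 3 = 1) by (rewrite zeta_cube; ring).
  replace (x / zeta) with (x / zeta * 1) by ring. rewrite <- E. field. apply zeta_neq_0.
Qed.

Lemma eisenstein_norm (m n : Z) :
  (Cmod (IZR m + IZR n * zeta) ^ 2 = IZR m ^ 2 + IZR m * IZR n + IZR n ^ 2)%R.
Proof.
rewrite Cmod_sqr, zeta_coords. unfold Cmult, Cplus, RtoC; simpl.
pose proof sqrt3_sqr. nra.
Qed.

(** The squared modulus is [m^2 + m n + n^2], a positive integer. *)
Lemma eisenstein_ge_1 (x : C) : eisenstein x -> x <> 0 -> (1 <= Cmod x)%R.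
Proof.
intros (m & n & ->) Hx.
assert (Hp := proj1 (Cmod_gt_0 _) Hx).
pose proof (eisenstein_norm m n) as E.
assert (P : (0 < Cmod (IZR m + IZR n * zeta) ^ 2)%R) by (apply pow_lt; auto).
rewrite E in P. replace (IZR m ^ 2 + IZR m * IZR n + IZR n ^ 2)%R with (IZR (m * m + m * n + n * n)) in *
  by (rewrite !plus_IZR, !mult_IZR; ring).
apply lt_IZR in P. assert (Q : (1 <= m * m + m * n + n * n)%Z) by lia.
apply IZR_le in Q. nra.
Qed.

(** [4 (m^2 + m n + n^2) = 3 m^2 + (m + 2 n)^2], and likewise with [m] and [n] exchanged. *)
Lemma eisenstein_coord_bound (m n : Z) :
  (IZR (Z.abs m) ^ 2 <= 4 / 3 * Cmod (IZR m + IZR n * zeta) ^ 2 /\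
   IZR (Z.abs n) ^ 2 <= 4 / 3 * Cmod (IZR m + IZR n * zeta) ^ 2)%R.
Proof.
rewrite eisenstein_norm, !abs_IZR, !pow2_abs. split.
- assert (0 <= (IZR m + 2 * IZR n) ^ 2)%R by apply pow2_ge_0. nra.
- assert (0 <= (2 * IZR m + IZR n) ^ 2)%R by apply pow2_ge_0. nra.
Qed.

Lemma nearest_Z (x : R) : exists n : Z, (Rabs (x - IZR n) <= 1 / 2)%R.
Proof.
exists (up (x - 1 / 2)). destruct (archimed (x - 1 / 2)) as (H1 & H2). apply Rabs_le. lra.
Qed.

(** Rounding the coordinate along [zeta] and then the one along [1] leaves a squared distance of at
    most [3/16 + 1/4 = 7/16]. What matters is a bound below [1], the least distance between lattice
    points. *)
Lemma eisenstein_close (z : C) : exists l, eisenstein l /\ (Cmod (z - l) <= 3 / 4)%R.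
Proof.
destruct z as [x y].
assert (S3 := sqrt3_sqr). assert (P3 : (0 < sqrt 3)%R) by (apply sqrt_lt_R0; lra).
destruct (nearest_Z (2 * y / sqrt 3)) as (n & Hn).
destruct (nearest_Z (x - IZR n / 2)) as (m & Hm).
exists (IZR m + IZR n * zeta). split; [exists m, n; reflexivity|].
apply Rsqr_incr_0_var; [|lra]. rewrite !Rsqr_pow2, Cmod_sqr, zeta_coords.
unfold Cmult, Cminus, Cplus, Copp, RtoC; simpl.
apply Rabs_le_between in Hn. apply Rabs_le_between in Hm.
set (u := (2 * y / sqrt 3 - IZR n)%R) in *. set (v := (x - IZR n / 2 - IZR m)%R) in *.
replace (x + - (IZR m + (IZR n * (1 / 2) - 0 * (sqrt 3 / 2))))%R with v by (unfold v; field).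
replace (y + - (0 + (IZR n * (sqrt 3 / 2) + 0 * (1 / 2))))%R with (u * sqrt 3 / 2)%R
  by (unfold u; field; lra).
assert (u * u <= 1 / 4)%R by nra. assert (v * v <= 1 / 4)%R by nra.
replace (u * sqrt 3 / 2 * (u * sqrt 3 / 2 * 1))%R with (u * u * (sqrt 3 * sqrt 3) / 4)%R by field.
rewrite S3. lra.
Qed.

(* Of order [|m|^(-3/2)], with telescoping sums; [(1 + |m + n zeta|)^(-3)] is at most a constant times
   [zweight m * zweight n]. *)
Definition zweight (m : Z) : R := (/ sqrt (1 + IZR (Z.abs m)) - / sqrt (2 + IZR (Z.abs m)))%R.

Lemma zabs_pos (m : Z) : (0 <= IZR (Z.abs m))%R.
Proof. apply IZR_le, Z.abs_nonneg. Qed.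

(** With [p^2 = 1 + |m|] and [q^2 = 2 + |m|] the weight [1/p - 1/q] is [1 / (p q (p + q))], and
    [p <= q <= b]. *)
Lemma zweight_lower (m : Z) (b : R) : (0 < b)%R -> (2 + IZR (Z.abs m) <= b ^ 2)%R ->
  (/ (2 * b ^ 3) <= zweight m)%R.
Proof.
intros Hb H. pose proof (zabs_pos m) as Hm. unfold zweight. set (x := IZR (Z.abs m)) in *.
set (p := sqrt (1 + x)). set (q := sqrt (2 + x)).
assert (Pp : (0 < p)%R) by (apply sqrt_lt_R0; lra).
assert (Pq : (0 < q)%R) by (apply sqrt_lt_R0; lra).
assert (Ep : (p * p = 1 + x)%R) by (apply sqrt_sqrt; lra).
assert (Eq : (q * q = 2 + x)%R) by (apply sqrt_sqrt; lra).
assert (Hpq : (p <= q)%R) by (apply sqrt_le_1; lra).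
assert (Hqb : (q <= b)%R) by nra.
replace (/ p - / q)%R with (/ (p * q * (p + q)))%R.
- apply Rinv_le_contravar.
  + repeat apply Rmult_lt_0_compat; lra.
  + assert (p * q <= b * b)%R by (apply Rmult_le_compat; lra).
    assert (p * q * (p + q) <= b * b * (b + b))%R by (apply Rmult_le_compat; nra). lra.
- transitivity ((q * q - p * p) / (p * q * (p + q)))%R.
  + rewrite Ep, Eq. field. lra.
  + field. lra.
Qed.

Lemma zweight_pos (m : Z) : (0 <= zweight m)%R.
Proof.
pose proof (zabs_pos m) as Hm.
apply Rle_trans with (/ (2 * (sqrt (2 + IZR (Z.abs m))) ^ 3))%R.
- left. apply Rinv_0_lt_compat. apply Rmult_lt_0_compat; [lra|]. apply pow_lt, sqrt_lt_R0. lra.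
- apply zweight_lower; [apply sqrt_lt_R0; lra|]. right. simpl. rewrite Rmult_1_r, sqrt_sqrt; lra.
Qed.

Fixpoint zrange (n : nat) : list Z :=
  match n with
  | O => [0%Z]
  | S k => Z.of_nat n :: (- Z.of_nat n)%Z :: zrange k
  end.

Lemma in_zrange (n : nat) (m : Z) : In m (zrange n) <-> (Z.abs m <= Z.of_nat n)%Z.
Proof.
induction n as [|n IH].
- simpl. split; [intros [<-|[]]; lia|intros; left; lia].
- change (zrange (S n)) with (Z.of_nat (S n) :: (- Z.of_nat (S n))%Z :: zrange n).
  simpl In. rewrite IH. lia.
Qed.

(** The terms at [m] and at [- m] telescope alike, whence the factor [2]; the term at [0] occurs
    only once, which the inequality absorbs. *)
Lemma zweight_sum (n : nat) :
  (rsum zweight (zrange n) <= 2 - 2 / sqrt (2 + INR n))%R.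
Proof.
assert (P : forall x, (0 <= x)%R -> (0 < / sqrt (1 + x))%R).
{ intros x Hx. apply Rinv_0_lt_compat, sqrt_lt_R0. lra. }
induction n as [|n IH].
- unfold zrange, rsum, fold_right, zweight. simpl Z.abs. rewrite !Rplus_0_r, sqrt_1. simpl INR.
  assert (0 < / sqrt 2)%R by (apply Rinv_0_lt_compat, sqrt_lt_R0; lra).
  assert (/ sqrt 2 <= 1)%R.
  { rewrite <- Rinv_1. apply Rinv_le_contravar; [lra|]. rewrite <- sqrt_1. apply sqrt_le_1; lra. }
  unfold Rdiv. lra.
- change (zrange (S n)) with (Z.of_nat (S n) :: (- Z.of_nat (S n))%Z :: zrange n).
  unfold rsum in *. simpl fold_right.
  assert (E : forall m, (Z.abs m = Z.of_nat (S n))%Z ->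
    zweight m = (/ sqrt (2 + INR n) - / sqrt (2 + INR (S n)))%R).
  { intros m Hm. unfold zweight. rewrite Hm, <- INR_IZR_INZ, S_INR. do 3 f_equal; ring. }
  rewrite !E by lia. unfold Rdiv in *. lra.
Qed.

Lemma zweight_summable (n : nat) : (rsum zweight (zrange n) <= 2)%R.
Proof.
eapply Rle_trans; [apply zweight_sum|].
assert (0 < / sqrt (2 + INR n))%R; [|unfold Rdiv; lra].
apply Rinv_0_lt_compat, sqrt_lt_R0. pose proof (pos_INR n). lra.
Qed.

Definition eis_of (p : Z * Z) : C := IZR (fst p) + IZR (snd p) * zeta.

(** For [b^2 = 3 (1 + c)] both [2 + |m|] and [2 + |n|] are at most [b^2], and
    [(2 b^3)^2 = 108 (1 + c)^3]. *)
Lemma eisenstein_term_bound (p : Z * Z) :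
  (/ (1 + Cmod (eis_of p)) ^ 3 <= 108 * (zweight (fst p) * zweight (snd p)))%R.
Proof.
destruct p as [m n]. unfold eis_of. cbn [fst snd].
destruct (eisenstein_coord_bound m n) as (Hm & Hn).
pose proof (Cmod_ge_0 (IZR m + IZR n * zeta)) as Hc. set (c := Cmod (IZR m + IZR n * zeta)) in *.
pose proof (zabs_pos m) as Pm. pose proof (zabs_pos n) as Pn.
set (b := sqrt (3 * (1 + c))).
assert (Hb : (0 < b)%R) by (apply sqrt_lt_R0; lra).
assert (Eb : (b ^ 2 = 3 * (1 + c))%R) by (unfold b; simpl; rewrite Rmult_1_r, sqrt_sqrt; lra).
assert (Hm' : (/ (2 * b ^ 3) <= zweight m)%R) by (apply zweight_lower; [auto|rewrite Eb; nra]).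
assert (Hn' : (/ (2 * b ^ 3) <= zweight n)%R) by (apply zweight_lower; [auto|rewrite Eb; nra]).
assert (P : (0 < / (2 * b ^ 3))%R).
{ apply Rinv_0_lt_compat. apply Rmult_lt_0_compat; [lra|]. apply pow_lt; auto. }
apply Rle_trans with (108 * (/ (2 * b ^ 3) * / (2 * b ^ 3)))%R.
- right. rewrite <- Rinv_mult. replace (2 * b ^ 3 * (2 * b ^ 3))%R with (4 * (b ^ 2) ^ 3)%R by ring.
  rewrite Eb. field. lra.
- apply Rmult_le_compat_l; [lra|]. apply Rmult_le_compat; lra.
Qed.

Lemma eisenstein_coords (l : list C) : (forall x, In x l -> eisenstein x) ->
  exists l', l = map eis_of l'.
Proof.
induction l as [|x l IH]; intros H; [exists []; reflexivity|].
destruct IH as (l' & ->); [intros; apply H; now right|].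
destruct (H x (or_introl eq_refl)) as (m & n & ->). exists ((m, n) :: l'). reflexivity.
Qed.

Lemma incl_box (l : list (Z * Z)) : exists n, incl l (list_prod (zrange n) (zrange n)).
Proof.
induction l as [|[a b] l (n & IH)]; [exists O; easy|].
exists (n + Z.to_nat (Z.abs a) + Z.to_nat (Z.abs b))%nat.
intros [x y] [E|H].
- injection E as <- <-. apply in_prod; apply in_zrange; lia.
- apply IH in H. apply in_prod_iff in H. rewrite !in_zrange in H. apply in_prod; apply in_zrange; lia.
Qed.

(** The constant is [108 * 2 * 2]: over a box the product weights add up to a product of two
    one-dimensional sums, each at most [2]. *)
Lemma eisenstein_summable (l : list C) : finite_subset eisenstein l ->
  (rsum (fun x => / (1 + Cmod x) ^ 3)%R l <= 432)%R.
Proof.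
intros (Nl & Hl). destruct (eisenstein_coords l Hl) as (l' & ->).
apply NoDup_map_inv in Nl. destruct (incl_box l') as (n & Hn).
rewrite rsum_map.
eapply Rle_trans; [apply rsum_le; intros; apply eisenstein_term_bound|].
rewrite rsum_scal.
assert (H : (rsum (fun p => zweight (fst p) * zweight (snd p)) l' <= 2 * 2)%R); [|lra].
eapply Rle_trans; [apply (rsum_incl _ _ _ (fun p => Rmult_le_pos _ _ (zweight_pos (fst p)) (zweight_pos (snd p))) Nl Hn)|].
rewrite rsum_list_prod. pose proof (zweight_summable n).
pose proof (rsum_pos zweight (zrange n) zweight_pos). apply Rmult_le_compat; lra.
Qed.

(** * Second-order expansions of lattice sums *)

(** [c] is half the second derivative. The remainder has to be cubic because the gain in the mean
    value argument [no_local_max] is quadratic. *)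
Definition taylor2 (f : C -> C) (z b c : C) : Prop :=
  exists M : R, (0 <= M)%R /\
    near 0 (fun k => (Cmod (f (z + k)%C - f z - b * k - c * k ^ 2) <= M * Cmod k ^ 3)%R).

Lemma Cpow_neq_0 (x : C) (n : nat) : x <> 0 -> x ^ n <> 0.
Proof.
intros Hx. apply Cmod_gt_0. rewrite Cmod_pow. apply pow_lt. apply Cmod_gt_0. exact Hx.
Qed.

Lemma Cmod_inv_pow (x : C) (n : nat) : x <> 0 -> Cmod (/ x ^ n) = (/ Cmod x ^ n)%R.
Proof. intros Hx. rewrite Cmod_inv, Cmod_pow; auto. apply Cpow_neq_0. exact Hx. Qed.

Lemma half_away (x k : C) : x <> 0 -> (Cmod k <= Cmod x / 2)%R ->
  x + k <> 0 /\ (Cmod x / 2 <= Cmod (x + k))%R.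
Proof.
intros Hx Hk. apply Cmod_gt_0 in Hx.
assert (H : (Cmod x / 2 <= Cmod (x + k))%R).
{ pose proof (Cmod_triangle_rev x (- k)) as T. rewrite Cmod_opp in T.
  replace (x - - k) with (x + k) in T by ring. lra. }
split; auto. apply Cmod_gt_0. lra.
Qed.

(** Induction on the exponent, multiplying by [/ (x + k)]. As [K] does not depend on [x], the bound
    can be summed over all [x = z - l]. *)
Lemma inv_pow_taylor (n : nat) : exists K : R, (0 <= K)%R /\
  forall x k : C, x <> 0 -> (Cmod k <= Cmod x / 2)%R ->
  (Cmod (/ (x + k) ^ n - / x ^ n + INR n * k * / x ^ (n + 1) - INR n * (INR n + 1) / 2 * k ^ 2 * / x ^ (n + 2))
    <= K * Cmod k ^ 3 * / Cmod x ^ (n + 3))%R.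
Proof.
induction n as [|n (K & HK & IH)].
- exists 0%R. split; [lra|]. intros x k Hx Hk. simpl Nat.add.
  destruct (half_away x k Hx Hk) as (Hxk & _).
  match goal with |- (Cmod ?X <= _)%R => replace X with (RtoC 0) end.
  + rewrite Cmod_0. lra.
  + simpl. field. auto.
- exists (2 * (K + (INR n + 1) * (INR n + 2) / 2))%R. pose proof (pos_INR n) as Pn.
  split; [apply Rmult_le_pos; [lra|]; apply Rplus_le_le_0_compat; auto; apply Rmult_le_pos; [apply Rmult_le_pos|]; lra|].
  intros x k Hx Hk. specialize (IH x k Hx Hk).
  destruct (half_away x k Hx Hk) as (Hxk & Hxk').
  set (N := INR n) in *.
  assert (En : INR (S n) = (N + 1)%R) by (unfold N; apply S_INR).
  rewrite En.
  set (E := / (x + k) ^ n - / x ^ n + N * k * / x ^ (n + 1) - N * (N + 1) / 2 * k ^ 2 * / x ^ (n + 2)) in *.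
  (* [q] is the defect in [(x + k) T' = T + q k^3 / x^(n+3)], where [T] and [T'] are the quadratic
     Taylor polynomials for the exponents [n] and [n + 1]. *)
  set (q := ((N + 1) * (N + 2) / 2)%R).
  assert (Hq : (0 <= q)%R) by (unfold q; apply Rmult_le_pos; [apply Rmult_le_pos|]; lra).
  assert (Eq : RtoC q = (N + 1) * (N + 2) / 2).
  { unfold q. rewrite RtoC_div, RtoC_mult, !RtoC_plus by lra. reflexivity. }
  match goal with |- (Cmod ?X <= _)%R => replace X with
    (/ (x + k) * (E - q * k ^ 3 * / x ^ (n + 3))) end.
  2: { rewrite Eq. unfold E. rewrite RtoC_plus. rewrite !Cpow_add_r. simpl.
       pose proof (Cpow_neq_0 x n Hx). pose proof (Cpow_neq_0 (x + k) n Hxk).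
       set (X := x ^ n) in *. set (Y := (x + k) ^ n) in *. field. auto. }
  pose proof (proj1 (Cmod_gt_0 _) Hx) as Px.
  rewrite Cmod_mult, Cmod_inv by auto.
  assert (I : (/ Cmod (x + k) <= 2 * / Cmod x)%R).
  { replace (2 * / Cmod x)%R with (/ (Cmod x / 2))%R by (field; lra).
    apply Rinv_le_contravar; lra. }
  assert (J : (Cmod (E - q * k ^ 3 * / x ^ (n + 3)) <=
     (K + q) * Cmod k ^ 3 * / Cmod x ^ (n + 3))%R).
  { eapply Rle_trans; [apply Cmod_triangle_minus|].
    rewrite !Cmod_mult, Cmod_inv_pow, Cmod_pow, Cmod_R, Rabs_pos_eq by auto. lra. }
  eapply Rle_trans; [apply Rmult_le_compat; [left; apply Rinv_0_lt_compat, Cmod_gt_0; auto|apply Cmod_ge_0|exact I|exact J]|].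
  right. replace (S n + 3)%nat with (1 + (n + 3))%nat by lia. rewrite (pow_add _ 1 (n + 3)), pow_1.
  field. split; [apply pow_nonzero|]; lra.
Qed.

(** The distance to [l] is asked to grow linearly with [|l|]: this bounds [/ |z - l|^n] by a
    multiple of [/ (1 + |l|)^n] and persists for points near [z]. *)
Definition separated (A : C -> Prop) (z : C) (c : R) : Prop :=
  (0 < c)%R /\ forall l, A l -> (c * (1 + Cmod l) <= Cmod (z - l))%R.

Lemma separated_neq (A : C -> Prop) (z : C) (c : R) (l : C) :
  separated A z c -> A l -> z - l <> 0.
Proof.
intros (Hc & H) Al. apply Cmod_gt_0. specialize (H l Al). pose proof (Cmod_ge_0 l). nra.
Qed.

Lemma separated_near (A : C -> Prop) (z w : C) (c : R) :
  separated A z c -> (Cmod (w - z) <= c / 2)%R -> separated A w (c / 2).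
Proof.
intros (Hc & H) Hw. split; [lra|]. intros l Al. specialize (H l Al).
pose proof (Cmod_triangle_rev (z - l) (z - w)) as T.
replace (z - l - (z - w)) with (w - l) in T by ring. rewrite (Cmod_minus_sym z w) in T.
pose proof (Cmod_ge_0 l). nra.
Qed.

(** Lattice points other than the close one [l0] are at distance at least [1 - 3/4] from [z]. This
    minimum distance settles the [l] with [1 + |l| <= m]; for the others the triangle inequality
    suffices. *)
Lemma eisenstein_separated (z : C) : ~ eisenstein z -> exists c, separated eisenstein z c.
Proof.
intros Hz. destruct (eisenstein_close z) as (l0 & H0 & H1).
assert (Hp : (0 < Cmod (z - l0))%R).
{ apply Cmod_gt_0. intros E. apply Hz. replace z with (z - l0 + l0) by ring. rewrite E.
  replace (0 + l0) with l0 by ring. exact H0. }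
set (d := Rmin (Cmod (z - l0)) (1 / 4)).
assert (Hd : (0 < d)%R) by (apply Rmin_pos; lra).
assert (D : forall l, eisenstein l -> (d <= Cmod (z - l))%R).
{ intros l Hl. destruct (Ceq_dec l l0) as [->|N]; [apply Rmin_l|].
  assert (1 <= Cmod (l - l0))%R.
  { apply eisenstein_ge_1; [apply eisenstein_minus; auto|]. intros E. apply N.
    replace l with (l - l0 + l0) by ring. rewrite E. ring. }
  pose proof (Cmod_triangle_minus (z - l0) (z - l)) as T.
  replace (z - l0 - (z - l)) with (l - l0) in T by ring.
  pose proof (Rmin_r (Cmod (z - l0)) (1 / 4)). fold d in H2. lra. }
pose proof (Cmod_ge_0 z) as Pz.
set (m := (2 + 2 * Cmod z)%R).
exists (Rmin (1 / 4) (d / m)). split; [apply Rmin_pos; [lra|apply Rdiv_lt_0_compat; unfold m; lra]|].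
intros l Hl. specialize (D l Hl). pose proof (Cmod_ge_0 l) as Pl.
destruct (Rle_or_lt (1 + Cmod l) m) as [B|B].
- apply Rle_trans with d; auto.
  apply Rle_trans with (d / m * m)%R; [|right; field; unfold m; lra].
  apply Rmult_le_compat; try lra; [left; apply Rmin_pos; [lra|apply Rdiv_lt_0_compat; unfold m; lra]|apply Rmin_r].
- pose proof (Cmod_triangle_rev l z). rewrite (Cmod_minus_sym l z) in H.
  apply Rle_trans with (1 / 4 * (1 + Cmod l))%R; [apply Rmult_le_compat_r; [lra|apply Rmin_l]|].
  unfold m in B. lra.
Qed.

Definition eisenstein' (l : C) : Prop := eisenstein l /\ l <> 0.

Lemma eisenstein'_separated : separated eisenstein' 0 (1 / 2).
Proof.
split; [lra|]. intros l (Hl & N). pose proof (eisenstein_ge_1 l Hl N).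
replace (0 - l) with (- l) by ring. rewrite Cmod_opp. lra.
Qed.

Lemma lattice_sum_bound (A : C -> Prop) (f : C -> C) (K : R) :
  (forall l, A l -> eisenstein l) -> (0 <= K)%R ->
  (forall l, A l -> (Cmod (f l) <= K * / (1 + Cmod l) ^ 3)%R) ->
  forall l, finite_subset A l -> (rsum (fun x => Cmod (f x)) l <= K * 432)%R.
Proof.
intros HA HK Hf l (Nl & Hl).
eapply Rle_trans; [apply rsum_le; intros x Hx; apply Hf, Hl, Hx|].
rewrite rsum_scal. apply Rmult_le_compat_l; auto.
apply eisenstein_summable. split; auto.
Qed.

Lemma separated_inv_pow (A : C -> Prop) (z : C) (c : R) (n : nat) (l : C) :
  separated A z c -> (3 <= n)%nat -> A l ->
  (/ Cmod (z - l) ^ n <= / c ^ n * / (1 + Cmod l) ^ 3)%R.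
Proof.
intros (Hc & H) Hn Al. specialize (H l Al). pose proof (Cmod_ge_0 l) as Pl.
rewrite <- Rinv_mult. apply Rinv_le_contravar.
- apply Rmult_lt_0_compat; apply pow_lt; lra.
- apply Rle_trans with ((c * (1 + Cmod l)) ^ n)%R.
  + rewrite Rpow_mult_distr. apply Rmult_le_compat_l; [apply pow_le; lra|].
    apply Rle_pow; [lra|lia].
  + apply pow_incr. split; [apply Rmult_le_pos; lra|exact H].
Qed.

(** [psum eisenstein' n 0] is the Eisenstein series [G_n] up to the sign [(-1)^n]. *)
Definition psum (A : C -> Prop) (n : nat) (z : C) : C := sum_over A (fun l => / (z - l) ^ n).

Lemma psum_correct (A : C -> Prop) (n : nat) (z : C) (c : R) :
  (forall l, A l -> eisenstein l) -> (3 <= n)%nat -> separated A z c ->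
  is_sum_over A (fun l => / (z - l) ^ n) (psum A n z).
Proof.
intros HA Hn Hs.
destruct (sum_over_exists A (fun l => / (z - l) ^ n) (/ c ^ n * 432)) as (s & H).
- apply (lattice_sum_bound A _ (/ c ^ n) HA).
  + left. apply Rinv_0_lt_compat, pow_lt, Hs.
  + intros l Al. rewrite Cmod_inv_pow by (apply (separated_neq A z c); auto).
    apply (separated_inv_pow A); auto.
- unfold psum. rewrite (sum_over_unique _ _ _ H). exact H.
Qed.

(** The expansions of the terms are added; their remainders are [O(k^3)] times [/ |z - l|^(n+3)].
    The correction [B l], which makes the sum converge when [n = 2], cancels in [S (z + k) - S z]
    and leaves no trace in the coefficients. *)
Lemma lattice_sum_taylor2 (A : C -> Prop) (n : nat) (B S : C -> C) (z : C) (c : R) :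
  (forall l, A l -> eisenstein l) -> (2 <= n)%nat -> separated A z c ->
  near z (fun w => is_sum_over A (fun l => / (w - l) ^ n - B l) (S w)) ->
  taylor2 S z (- INR n * psum A (n + 1) z) (INR n * (INR n + 1) / 2 * psum A (n + 2) z).
Proof.
intros HA Hn Hs HS.
destruct (inv_pow_taylor n) as (K & HK & T).
assert (Hc := proj1 Hs).
assert (Pc : (0 <= / c ^ (n + 3))%R) by (left; apply Rinv_0_lt_compat, pow_lt, Hc).
exists (K * / c ^ (n + 3) * 432)%R. split; [repeat apply Rmult_le_pos; lra|].
assert (Sz := near_self _ _ HS). destruct HS as (d & Hd & HS).
exists (Rmin d (c / 2)). split; [apply Rmin_pos; lra|].
intros k Hk. replace (k - 0) with k in Hk by ring.
pose proof (Rmin_l d (c / 2)). pose proof (Rmin_r d (c / 2)).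
assert (Sk : is_sum_over A (fun l => / (z + k - l) ^ n - B l) (S (z + k))).
{ apply HS. replace (z + k - z) with k by ring. lra. }
assert (S1 := psum_correct A (n + 1) z c HA ltac:(lia) Hs).
assert (S2 := psum_correct A (n + 2) z c HA ltac:(lia) Hs).
assert (Sum := is_sum_over_plus _ _ _ _ _ (is_sum_over_plus _ _ _ _ _ (is_sum_over_minus _ _ _ _ _ Sk Sz)
  (is_sum_over_scal _ (INR n * k) _ _ S1)) (is_sum_over_scal _ (- (INR n * (INR n + 1) / 2 * k ^ 2)) _ _ S2)).
match goal with |- (Cmod ?X <= _)%R => match type of Sum with is_sum_over _ _ ?Y => replace X with Y by ring end end.
apply (is_sum_over_bound _ _ _ _ Sum).
replace (K * / c ^ (n + 3) * 432 * Cmod k ^ 3)%R with (K * Cmod k ^ 3 * / c ^ (n + 3) * 432)%R by ring.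
pose proof (Cmod_ge_0 k) as Pk.
assert (Pk3 : (0 <= K * Cmod k ^ 3)%R) by (apply Rmult_le_pos; auto; apply pow_le; auto).
apply (lattice_sum_bound A); auto; [apply Rmult_le_pos; auto|].
intros l Al.
assert (Nx := separated_neq A z c l Hs Al).
assert (Hx : (Cmod k <= Cmod (z - l) / 2)%R).
{ destruct Hs as (_ & Hs). specialize (Hs l Al). pose proof (Cmod_ge_0 l). nra. }
specialize (T (z - l) k Nx Hx).
replace (z - l + k) with (z + k - l) in T by ring.
match goal with |- (Cmod ?X <= _)%R => match type of T with (Cmod ?Y <= _)%R => replace X with Y by ring end end.
eapply Rle_trans; [exact T|].
rewrite (Rmult_assoc (K * Cmod k ^ 3)). apply Rmult_le_compat_l; auto.
apply (separated_inv_pow A); auto. lia.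
Qed.

Lemma Cinv_0 : / 0 = 0.
Proof. unfold Cinv, RtoC; simpl. unfold Rdiv. f_equal; ring. Qed.

(** For [l <> 0] the term is [z (2 l - z) / ((z - l)^2 l^2)], of order [|l|^(-3)]. The index [0] is
    treated apart, with [/ 0 = 0]. *)
Lemma wp_sum_exists (A : C -> Prop) (z : C) (c : R) :
  (forall l, A l -> eisenstein l) -> separated A z c ->
  is_sum_over A (fun l => / (z - l) ^ 2 - / l ^ 2) (sum_over A (fun l => / (z - l) ^ 2 - / l ^ 2)).
Proof.
intros HA Hs. pose proof (Cmod_ge_0 z) as Pz.
assert (Hc := proj1 Hs).
assert (Pc : (0 < / c ^ 2)%R) by (apply Rinv_0_lt_compat, pow_lt, Hc).
assert (Q : (0 <= Cmod z * (2 + Cmod z))%R) by (apply Rmult_le_pos; lra).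
destruct (sum_over_exists A (fun l => / (z - l) ^ 2 - / l ^ 2) (/ c ^ 2 * (1 + 4 * (Cmod z * (2 + Cmod z))) * 432)) as (s & H).
2: { rewrite (sum_over_unique _ _ _ H). exact H. }
apply (lattice_sum_bound A); auto; [apply Rmult_le_pos; lra|].
intros l Al. assert (Nx := separated_neq A z c l Hs Al).
assert (Hx := proj2 Hs l Al).
pose proof (Cmod_ge_0 l) as Pl.
assert (I2 : (/ Cmod (z - l) ^ 2 <= / c ^ 2 * / (1 + Cmod l) ^ 2)%R).
{ rewrite <- Rinv_mult, <- Rpow_mult_distr. apply Rinv_le_contravar.
  - apply pow_lt. apply Rmult_lt_0_compat; lra.
  - apply pow_incr. split; [apply Rmult_le_pos; lra|exact Hx]. }
assert (Pl2 : (0 < / (1 + Cmod l) ^ 2)%R) by (apply Rinv_0_lt_compat, pow_lt; lra).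
assert (Pl3 : (0 < / (1 + Cmod l) ^ 3)%R) by (apply Rinv_0_lt_compat, pow_lt; lra).
destruct (Ceq_dec l 0) as [->|Nl].
- replace (/ (z - 0) ^ 2 - / 0 ^ 2) with (/ (z - 0) ^ 2).
  2: { replace (0 ^ 2) with (RtoC 0) by ring. rewrite Cinv_0. ring. }
  rewrite Cmod_inv_pow by auto. rewrite Cmod_0 in *.
  eapply Rle_trans; [exact I2|]. rewrite Rplus_0_r, !pow1, Rinv_1.
  assert (0 <= / c ^ 2 * (4 * (Cmod z * (2 + Cmod z))))%R by (apply Rmult_le_pos; lra). lra.
- pose proof (eisenstein_ge_1 l (HA l Al) Nl) as L1.
  replace (/ (z - l) ^ 2 - / l ^ 2) with (z * (2 * l - z) * / (z - l) ^ 2 * / l ^ 2) by (field; auto).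
  rewrite !Cmod_mult, !Cmod_inv_pow by auto.
  assert (I1 : (/ Cmod l ^ 2 <= 4 * / (1 + Cmod l) ^ 2)%R).
  { replace (4 * / (1 + Cmod l) ^ 2)%R with (/ ((1 + Cmod l) / 2) ^ 2)%R by (field; lra).
    apply Rinv_le_contravar; [apply pow_lt; lra|]. apply pow_incr. lra. }
  assert (I3 : (Cmod (2 * l - z) <= (2 + Cmod z) * (1 + Cmod l))%R).
  { eapply Rle_trans; [apply Cmod_triangle_minus|]. rewrite Cmod_mult, Cmod_R, Rabs_pos_eq by lra. nra. }
  apply Rle_trans with (Cmod z * ((2 + Cmod z) * (1 + Cmod l)) * (/ c ^ 2 * / (1 + Cmod l) ^ 2) * (4 * / (1 + Cmod l) ^ 2))%R.
  + assert (0 <= / Cmod (z - l) ^ 2)%R by (left; apply Rinv_0_lt_compat, pow_lt, Cmod_gt_0; auto).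
    assert (0 <= / Cmod l ^ 2)%R by (left; apply Rinv_0_lt_compat, pow_lt, Cmod_gt_0; auto).
    pose proof (Cmod_ge_0 (2 * l - z)).
    repeat (apply Rmult_le_compat; auto; try (repeat apply Rmult_le_pos; auto; fail)); lra.
  + replace (Cmod z * ((2 + Cmod z) * (1 + Cmod l)) * (/ c ^ 2 * / (1 + Cmod l) ^ 2) * (4 * / (1 + Cmod l) ^ 2))%R
      with (/ c ^ 2 * (4 * (Cmod z * (2 + Cmod z))) * / (1 + Cmod l) ^ 3)%R by (field; lra).
    apply Rmult_le_compat_r; [lra|]. apply Rmult_le_compat_l; lra.
Qed.

(** * The Weierstrass function of the Eisenstein lattice *)

Definition wp_reg (z : C) : C := sum_over eisenstein' (fun l => / (z - l) ^ 2 - / l ^ 2).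

Definition wp (z : C) : C := / z ^ 2 + wp_reg z.

(** The termwise derivatives are defined as lattice sums of their own; [wp_taylor2] and
    [wp'_taylor2] identify them as derivatives. *)
Definition wp' (z : C) : C := - (2) * psum eisenstein 3 z.

Definition wp'' (z : C) : C := 6 * psum eisenstein 4 z.

Lemma separated_sub (A B : C -> Prop) (z : C) (c : R) :
  (forall l, A l -> B l) -> separated B z c -> separated A z c.
Proof. intros H (Hc & K). split; auto. Qed.

Lemma eisenstein'_sub (l : C) : eisenstein' l -> eisenstein l.
Proof. intros H. apply H. Qed.

Lemma not_eisenstein_near (z : C) : ~ eisenstein z -> near z (fun w => ~ eisenstein w).
Proof.
intros Hz. destruct (eisenstein_separated z Hz) as (c & Hs).
exists c. split; [apply Hs|]. intros w Hw Ew. destruct Hs as (Hc & Hs). specialize (Hs w Ew).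
rewrite Cmod_minus_sym in Hs. pose proof (Cmod_ge_0 w). nra.
Qed.

(** Thanks to [/ 0 = 0] the polar part [/ z ^ 2] is the term at [l = 0]. A sum over the full lattice
    can be compared term by term with its translates and rotations. *)
Lemma wp_is_sum (z : C) : ~ eisenstein z ->
  is_sum_over eisenstein (fun l => / (z - l) ^ 2 - / l ^ 2) (wp z).
Proof.
intros Hz. destruct (eisenstein_separated z Hz) as (c & Hs).
assert (E : / z ^ 2 = / (z - 0) ^ 2 - / 0 ^ 2).
{ replace (0 ^ 2) with (RtoC 0) by ring. rewrite Cinv_0. replace (z - 0) with z by ring. ring. }
unfold wp. rewrite E.
apply (is_sum_over_insert eisenstein 0 (fun l => / (z - l) ^ 2 - / l ^ 2)); [apply eisenstein_0|].
apply (wp_sum_exists eisenstein' z c eisenstein'_sub).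
apply (separated_sub _ eisenstein); auto. apply eisenstein'_sub.
Qed.

Lemma psum_is_sum (n : nat) (z : C) : (3 <= n)%nat -> ~ eisenstein z ->
  is_sum_over eisenstein (fun l => / (z - l) ^ n) (psum eisenstein n z).
Proof.
intros Hn Hz. destruct (eisenstein_separated z Hz) as (c & Hs). apply (psum_correct _ _ _ c); auto.
Qed.

Lemma taylor2_scal (f : C -> C) (z b c a : C) :
  taylor2 f z b c -> taylor2 (fun w => a * f w) z (a * b) (a * c).
Proof.
intros (M & HM & H). pose proof (Cmod_ge_0 a). exists (Cmod a * M)%R. split; [apply Rmult_le_pos; auto|].
revert H. apply near_imp. intros k Hk.
replace (a * f (z + k) - a * f z - a * b * k - a * c * k ^ 2)
  with (a * (f (z + k) - f z - b * k - c * k ^ 2)) by ring.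
rewrite Cmod_mult, Rmult_assoc. apply Rmult_le_compat_l; auto.
Qed.

Lemma taylor2_Cder (f : C -> C) (z b c : C) : taylor2 f z b c -> Cder f z b.
Proof.
intros (M & HM & d & Hd & H). apply is_derive_Cmod. intros eps He.
pose proof (Cmod_ge_0 c) as Pc.
exists (Rmin (Rmin d 1) (eps / (1 + Cmod c + M))).
assert (Q : (0 < eps / (1 + Cmod c + M))%R) by (apply Rdiv_lt_0_compat; lra).
split; [repeat apply Rmin_pos; lra|]. intros w Hw.
pose proof (Rmin_l (Rmin d 1) (eps / (1 + Cmod c + M))). pose proof (Rmin_r (Rmin d 1) (eps / (1 + Cmod c + M))).
pose proof (Rmin_l d 1). pose proof (Rmin_r d 1).
set (k := w - z) in *. replace w with (z + k) by (unfold k; ring).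
specialize (H k). replace (k - 0) with k in H by ring. specialize (H ltac:(lra)).
pose proof (Cmod_ge_0 k) as Pk.
replace (f (z + k) - f z - k * b) with ((f (z + k) - f z - b * k - c * k ^ 2) + c * k ^ 2) by ring.
eapply Rle_trans; [apply Cmod_triangle|]. rewrite Cmod_mult, Cmod_pow.
apply Rle_trans with ((1 + Cmod c + M) * Cmod k * Cmod k)%R.
- assert (Cmod k ^ 3 <= Cmod k * Cmod k)%R by (simpl; nra). simpl in *. nra.
- apply Rmult_le_compat_r; auto.
  replace eps with ((1 + Cmod c + M) * (eps / (1 + Cmod c + M)))%R by (field; lra).
  apply Rmult_le_compat_l; lra.
Qed.

Lemma taylor2_ext_coef (f : C -> C) (z b c b' c' : C) :
  b = b' -> c = c' -> taylor2 f z b c -> taylor2 f z b' c'.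
Proof. intros -> ->. auto. Qed.

Lemma wp_taylor2 (z : C) : ~ eisenstein z -> taylor2 wp z (wp' z) (wp'' z / 2).
Proof.
intros Hz. destruct (eisenstein_separated z Hz) as (c & Hs).
eapply taylor2_ext_coef;
  [| |apply (lattice_sum_taylor2 eisenstein 2 (fun l => / l ^ 2) wp z c (fun l H => H) (le_n 2) Hs)].
- unfold wp'. simpl. rewrite RtoC_plus. ring.
- unfold wp''. simpl. rewrite RtoC_plus. field.
- generalize (not_eisenstein_near z Hz). apply near_imp. apply wp_is_sum.
Qed.

Lemma psum_taylor2 (A : C -> Prop) (n : nat) (z : C) (c : R) :
  (forall l, A l -> eisenstein l) -> (3 <= n)%nat -> separated A z c ->
  taylor2 (psum A n) z (- INR n * psum A (n + 1) z) (INR n * (INR n + 1) / 2 * psum A (n + 2) z).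
Proof.
intros HA Hn Hs. apply (lattice_sum_taylor2 A n (fun _ => 0) _ z c HA); [lia|auto|].
exists (c / 2)%R. assert (Hc := proj1 Hs). split; [lra|]. intros w Hw.
apply is_sum_over_ext with (fun l => / (w - l) ^ n); [intros; ring|].
apply (psum_correct A n w (c / 2)); auto. apply (separated_near A z); auto. lra.
Qed.

Lemma wp'_taylor2 (z : C) : ~ eisenstein z -> exists c, taylor2 wp' z (wp'' z) c.
Proof.
intros Hz. destruct (eisenstein_separated z Hz) as (c & Hs). eexists.
eapply taylor2_ext_coef; [| |apply taylor2_scal, (psum_taylor2 eisenstein 3 z c); auto].
- unfold wp''. simpl. rewrite !RtoC_plus. ring.
- reflexivity.
Qed.

Lemma wp''_taylor2 (z : C) : ~ eisenstein z -> exists b c, taylor2 wp'' z b c.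
Proof.
intros Hz. destruct (eisenstein_separated z Hz) as (c & Hs). do 2 eexists.
apply taylor2_scal, (psum_taylor2 eisenstein 4 z c); auto.
Qed.

(** * Double periodicity *)

Lemma not_eisenstein_plus (z l : C) : eisenstein l -> ~ eisenstein z -> ~ eisenstein (z + l).
Proof.
intros Hl Hz H. apply Hz. replace z with (z + l - l) by ring. apply eisenstein_minus; auto.
Qed.

Lemma psum_periodic (n : nat) (z l : C) : (3 <= n)%nat -> eisenstein l -> ~ eisenstein z ->
  psum eisenstein n (z + l) = psum eisenstein n z.
Proof.
intros Hn Hl Hz.
apply (is_sum_over_unique _ _ _ _ (psum_is_sum n (z + l) Hn (not_eisenstein_plus z l Hl Hz))).
apply is_sum_over_ext with (fun x => / (z - (x - l)) ^ n).
{ intros x _. do 2 f_equal. ring. }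
apply (is_sum_over_reindex eisenstein eisenstein (fun x => x - l) (fun x => x + l) (fun x => / (z - x) ^ n)).
- intros. apply eisenstein_minus; auto.
- intros. apply eisenstein_plus; auto.
- intros. ring.
- intros. ring.
- apply psum_is_sum; auto.
Qed.

Definition csum {T : Type} (f : T -> C) (l : list T) : C := fold_right (fun x s => f x + s) 0 l.

Lemma csum_ext {T : Type} (f g : T -> C) (l : list T) :
  (forall x, f x = g x) -> csum f l = csum g l.
Proof. intros H. induction l as [|x l IH]; simpl; [reflexivity|rewrite H, IH; reflexivity]. Qed.

Lemma csum_app {T : Type} (f : T -> C) (l m : list T) : csum f (l ++ m) = csum f l + csum f m.
Proof. induction l as [|x l IH]; simpl; [ring|rewrite IH; ring]. Qed.

Lemma csum_map {T U : Type} (g : T -> U) (f : U -> C) (l : list T) :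
  csum f (map g l) = csum (fun x => f (g x)) l.
Proof. induction l as [|x l IH]; simpl; [ring|rewrite IH; ring]. Qed.

Lemma csum_list_prod {T U : Type} (f : T * U -> C) (l : list T) (m : list U) :
  csum f (list_prod l m) = csum (fun x => csum (fun y => f (x, y)) m) l.
Proof.
induction l as [|x l IH]; simpl; [reflexivity|].
rewrite csum_app, IH, csum_map. reflexivity.
Qed.

Lemma csum_bound {T : Type} (f : T -> C) (K : R) (l : list T) :
  (forall x, In x l -> (Cmod (f x) <= K)%R) -> (Cmod (csum f l) <= INR (length l) * K)%R.
Proof.
induction l as [|x l IH]; intros H.
- simpl. rewrite Cmod_0. lra.
- change (length (x :: l)) with (S (length l)). rewrite S_INR. simpl.
  eapply Rle_trans; [apply Cmod_triangle|].
  specialize (IH (fun y Hy => H y (or_intror Hy))). specialize (H x (or_introl eq_refl)). lra.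
Qed.

Lemma csum_telescope (g : Z -> C) (n : nat) :
  csum (fun m => g (m - 1)%Z - g m) (zrange n) = g (- Z.of_nat n - 1)%Z - g (Z.of_nat n).
Proof.
induction n as [|n IH].
- simpl. ring.
- change (zrange (S n)) with (Z.of_nat (S n) :: (- Z.of_nat (S n))%Z :: zrange n).
  unfold csum in *. cbn [fold_right]. rewrite IH.
  replace (Z.of_nat (S n) - 1)%Z with (Z.of_nat n) by lia.
  replace (- Z.of_nat n - 1)%Z with (- Z.of_nat (S n))%Z by lia. ring.
Qed.

Lemma length_zrange (n : nat) : length (zrange n) = (2 * n + 1)%nat.
Proof.
induction n as [|n IH]; [reflexivity|].
change (zrange (S n)) with (Z.of_nat (S n) :: (- Z.of_nat (S n))%Z :: zrange n).
cbn [length]. rewrite IH. lia.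
Qed.

Lemma NoDup_zrange (n : nat) : NoDup (zrange n).
Proof.
induction n as [|n IH]; [repeat constructor; auto|].
change (zrange (S n)) with (Z.of_nat (S n) :: (- Z.of_nat (S n))%Z :: zrange n).
constructor; [|constructor; auto].
- intros [H|H]; [lia|]. apply in_zrange in H. lia.
- intros H. apply in_zrange in H. lia.
Qed.

Lemma NoDup_list_prod {T U : Type} (l : list T) (m : list U) :
  NoDup l -> NoDup m -> NoDup (list_prod l m).
Proof.
intros Nl Nm. induction Nl as [|x l Hx Nl IH]; simpl; [constructor|].
apply NoDup_app; auto.
- apply NoDup_map_NoDup_ForallPairs; auto. intros a b _ _ E. congruence.
- intros [a b] Ha Hb. apply in_map_iff in Ha. destruct Ha as (y & E & _).
  apply in_prod_iff in Hb. injection E as <- _. tauto.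
Qed.

Lemma eis_of_inj (p q : Z * Z) : eis_of p = eis_of q -> p = q.
Proof.
destruct p as [m n], q as [m' n']. unfold eis_of. cbn [fst snd]. rewrite zeta_coords.
unfold Cmult, Cplus, RtoC; simpl. intros E. injection E as E1 E2.
assert (0 < sqrt 3)%R by (apply sqrt_lt_R0; lra).
assert (E3 : (IZR n = IZR n')%R) by nra.
apply eq_IZR in E3. subst. f_equal. apply eq_IZR. lra.
Qed.

(** The coordinates are swapped so that the inner index of [list_prod] is the coefficient of [1];
    each row then runs in the direction of the translation by [1]. *)
Definition box (n : nat) : list C :=
  map (fun p => eis_of (snd p, fst p)) (list_prod (zrange n) (zrange n)).

Lemma box_finite_subset (n : nat) : finite_subset eisenstein (box n).
Proof.
split.
- apply NoDup_map_NoDup_ForallPairs.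
  + intros [a b] [c d] _ _ E. apply eis_of_inj in E. cbn in E. congruence.
  + apply NoDup_list_prod; apply NoDup_zrange.
- intros x Hx. apply in_map_iff in Hx. destruct Hx as ([a b] & <- & _). exists b, a. reflexivity.
Qed.

Lemma incl_box_large (l : list C) : (forall x, In x l -> eisenstein x) ->
  exists n0, forall n, (n0 <= n)%nat -> incl l (box n).
Proof.
intros H. destruct (eisenstein_coords l H) as (l' & ->). destruct (incl_box l') as (n0 & Hn).
exists n0. intros n Hle x Hx. apply in_map_iff in Hx. destruct Hx as ([a b] & <- & Hp).
apply Hn, in_prod_iff in Hp. rewrite !in_zrange in Hp.
apply in_map_iff. exists (b, a). split; auto. apply in_prod; apply in_zrange; lia.
Qed.

(* The terms of [wp (z + 1) - wp z] telescope along the rows of the lattice, and the boundary terms of a box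
   of size [n] add up to [O(1/n)]. *)
Lemma wp_periodic_1 (z : C) : ~ eisenstein z -> wp (z + 1) = wp z.
Proof.
intros Hz. destruct (eisenstein_separated z Hz) as (c & Hc & Hs).
pose (a := fun l : C => / (z - l) ^ 2). pose (t := fun l : C => a (l - 1) - a l).
assert (Sum : is_sum_over eisenstein t (wp (z + 1) - wp z)).
{ eapply is_sum_over_ext; [|apply is_sum_over_minus; [apply wp_is_sum, not_eisenstein_plus, Hz; apply eisenstein_1|apply wp_is_sum, Hz]].
  intros x _. unfold t, a. cbn beta. replace (z - (x - 1)) with (z + 1 - x) by ring. ring. }
destruct (Ceq_dec (wp (z + 1) - wp z) 0) as [E|N].
{ replace (wp (z + 1)) with (wp (z + 1) - wp z + wp z) by ring. rewrite E. ring. }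
exfalso. apply Cmod_gt_0 in N. set (D := wp (z + 1) - wp z) in *.
destruct (proj1 (is_sum_over_Cmod _ _ _) Sum (Cmod D / 2)%R ltac:(lra)) as (l0 & H0 & K).
destruct (incl_box_large l0 (proj2 H0)) as (n0 & Hn0).
(* Chosen to make the final bound [8 / (c^2 n)] smaller than [|D| / 2]. *)
destruct (INR_unbounded (16 / (c ^ 2 * Cmod D))) as (n1 & Hn1).
set (n := (S (n0 + n1))%nat).
specialize (K (box n) (box_finite_subset n) (Hn0 n ltac:(unfold n; lia))).
assert (Pn : (0 < INR n)%R) by (apply lt_0_INR; unfold n; lia).
assert (Pc2 : (0 < c ^ 2)%R) by (apply pow_lt, Hc).
assert (Hn : (16 / (c ^ 2 * Cmod D) < INR n)%R).
{ eapply Rlt_le_trans; [exact Hn1|]. apply le_INR. unfold n. lia. }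
(* By [eisenstein_coord_bound], [|m| >= n] forces [|l|^2 >= 3/4 n^2]. *)
assert (A : forall m k, (INR n <= IZR (Z.abs m))%R -> (Cmod (a (eis_of (m, k))) <= 4 / (3 * c ^ 2 * INR n ^ 2))%R).
{ intros m k Hm. unfold a.
  assert (El : eisenstein (eis_of (m, k))) by (exists m, k; reflexivity).
  assert (Nx : z - eis_of (m, k) <> 0) by (apply (separated_neq eisenstein z c); auto; split; auto).
  rewrite Cmod_inv_pow by auto. specialize (Hs _ El).
  destruct (eisenstein_coord_bound m k) as (B & _).
  change (IZR m + IZR k * zeta) with (eis_of (m, k)) in B.
  replace (4 / (3 * c ^ 2 * INR n ^ 2))%R with (/ (c ^ 2 * (3 / 4 * INR n ^ 2)))%R by (field; split; lra).
  pose proof (Cmod_ge_0 (eis_of (m, k))) as Pe.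
  apply Rinv_le_contravar.
  - apply Rmult_lt_0_compat; auto. apply Rmult_lt_0_compat; [lra|apply pow_lt; auto].
  - apply Rle_trans with (c ^ 2 * (1 + Cmod (eis_of (m, k))) ^ 2)%R.
    + apply Rmult_le_compat_l; [lra|]. assert (INR n ^ 2 <= IZR (Z.abs m) ^ 2)%R by (apply pow_incr; lra). nra.
    + rewrite <- Rpow_mult_distr. apply pow_incr. split; [apply Rmult_le_pos; lra|exact Hs]. }
assert (B : (Cmod (sum_list t (box n)) <= INR (2 * n + 1) * (8 / (3 * c ^ 2 * INR n ^ 2)))%R).
{ change (sum_list t (box n)) with (csum t (box n)).
  unfold box. rewrite csum_map, csum_list_prod.
  rewrite <- length_zrange. apply csum_bound. intros k _. cbn [fst snd].
  rewrite (csum_ext _ (fun m => a (eis_of ((m - 1)%Z, k)) - a (eis_of (m, k)))).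
  - rewrite (csum_telescope (fun m => a (eis_of (m, k)))).
    eapply Rle_trans; [apply Cmod_triangle_minus|].
    replace (8 / (3 * c ^ 2 * INR n ^ 2))%R with (4 / (3 * c ^ 2 * INR n ^ 2) + 4 / (3 * c ^ 2 * INR n ^ 2))%R by (field; split; lra).
    apply Rplus_le_compat; apply A; rewrite INR_IZR_INZ; apply IZR_le; lia.
  - intros m. unfold t. do 2 f_equal. unfold eis_of. cbn [fst snd]. rewrite minus_IZR, RtoC_minus. ring. }
assert (B2 : (INR (2 * n + 1) * (8 / (3 * c ^ 2 * INR n ^ 2)) <= 8 / (c ^ 2 * INR n))%R).
{ assert (1 <= INR n)%R by (change 1%R with (INR 1); apply le_INR; unfold n; lia).
  rewrite plus_INR, mult_INR. change (INR 1) with 1%R. replace (INR 2) with 2%R by (simpl; ring).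
  replace (8 / (c ^ 2 * INR n))%R with ((3 * INR n) * (8 / (3 * c ^ 2 * INR n ^ 2)))%R by (field; split; lra).
  apply Rmult_le_compat_r; [|lra].
  left. apply Rdiv_lt_0_compat; [lra|]. repeat apply Rmult_lt_0_compat; try lra. }
assert (B3 : (8 / (c ^ 2 * INR n) < Cmod D / 2)%R).
{ apply Rmult_lt_reg_r with (2 * INR n / Cmod D)%R; [apply Rdiv_lt_0_compat; lra|].
  replace (8 / (c ^ 2 * INR n) * (2 * INR n / Cmod D))%R with (16 / (c ^ 2 * Cmod D))%R by (field; repeat split; lra).
  replace (Cmod D / 2 * (2 * INR n / Cmod D))%R with (INR n) by (field; lra). exact Hn. }
rewrite Cmod_minus_sym in K.
pose proof (Cmod_triangle_rev D (sum_list t (box n))). lra.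
Qed.

Lemma not_eisenstein_zeta (z : C) : ~ eisenstein z -> ~ eisenstein (zeta * z).
Proof.
intros Hz H. apply Hz. apply eisenstein_div_zeta in H.
replace (zeta * z / zeta) with z in H by (field; apply zeta_neq_0). exact H.
Qed.

(** The terms are homogeneous of degree [-2], and division by [zeta] permutes the lattice. *)
Lemma wp_zeta (z : C) : ~ eisenstein z -> wp (zeta * z) = / zeta ^ 2 * wp z.
Proof.
intros Hz. assert (Z0 := zeta_neq_0).
apply (is_sum_over_unique _ _ _ _ (wp_is_sum _ (not_eisenstein_zeta z Hz))).
apply is_sum_over_ext with (fun x => / zeta ^ 2 * (/ (z - x / zeta) ^ 2 - / (x / zeta) ^ 2)).
- intros x Hx.
  assert (Nx : zeta * z - x <> 0).
  { intros E. apply (not_eisenstein_zeta z Hz). replace (zeta * z) with (zeta * z - x + x) by ring.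
    rewrite E. replace (0 + x) with x by ring. exact Hx. }
  assert (Nx' : z - x / zeta <> 0).
  { intros E. apply Nx. replace (zeta * z - x) with (zeta * (z - x / zeta)) by (field; auto). rewrite E. ring. }
  destruct (Ceq_dec x 0) as [->|N].
  + replace (0 / zeta) with (RtoC 0) by (field; auto). replace (0 ^ 2) with (RtoC 0) by ring. rewrite Cinv_0.
    assert (z <> 0).
    { intros ->. apply Hz, eisenstein_0. }
    field. repeat split; auto; replace (z - 0) with z by ring; auto.
  + field. auto.
- apply (is_sum_over_reindex eisenstein eisenstein (fun x => x / zeta) (fun x => zeta * x)
    (fun x => / zeta ^ 2 * (/ (z - x) ^ 2 - / x ^ 2))).
  + apply eisenstein_div_zeta.
  + apply eisenstein_mult_zeta.
  + intros. field. auto.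
  + intros. field. auto.
  + apply is_sum_over_scal. apply wp_is_sum, Hz.
Qed.

(** [z + zeta = zeta (z / zeta + 1)]: the rotation turns the period [1] into the period [zeta]. *)
Lemma wp_periodic_zeta (z : C) : ~ eisenstein z -> wp (z + zeta) = wp z.
Proof.
intros Hz. assert (Z0 := zeta_neq_0).
assert (Hw : ~ eisenstein (z / zeta)).
{ intros H. apply Hz. apply eisenstein_mult_zeta in H.
  replace (zeta * (z / zeta)) with z in H by (field; auto). exact H. }
replace (z + zeta) with (zeta * (z / zeta + 1)) by (field; auto).
rewrite wp_zeta by (apply not_eisenstein_plus; auto; apply eisenstein_1).
rewrite wp_periodic_1 by auto.
rewrite <- wp_zeta by auto. f_equal. field. auto.
Qed.

Lemma periodic_Z (f : C -> C) (u : C) :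
  eisenstein u ->
  (forall z, ~ eisenstein z -> f (z + u) = f z) ->
  forall (n : Z) z, ~ eisenstein z -> f (z + IZR n * u) = f z.
Proof.
intros Hu H.
assert (Hn : forall n : nat, forall z, ~ eisenstein z -> ~ eisenstein (z + INR n * u) /\ f (z + INR n * u) = f z).
{ induction n as [|n IH]; intros z Hz.
  - simpl. replace (z + 0 * u) with z by ring. auto.
  - rewrite S_INR, RtoC_plus. replace (z + (INR n + 1) * u) with (z + INR n * u + u) by ring.
    destruct (IH z Hz) as (H1 & H2). split; [apply not_eisenstein_plus; auto|].
    rewrite H by auto. exact H2. }
intros n z Hz. destruct (Z_le_gt_dec 0 n) as [Hp|Hp].
- rewrite <- (Z2Nat.id n Hp), <- INR_IZR_INZ. apply Hn, Hz.
- set (w := z + IZR n * u).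
  assert (Ez : z = w + INR (Z.to_nat (- n)) * u).
  { unfold w. rewrite INR_IZR_INZ, Z2Nat.id, opp_IZR, RtoC_opp by lia. ring. }
  assert (Hw : ~ eisenstein w).
  { intros E. apply Hz. rewrite Ez. apply eisenstein_plus; auto.
    generalize (Z.to_nat (- n)). induction n0 as [|k IH].
    - simpl. replace (0 * u) with (RtoC 0) by ring. apply eisenstein_0.
    - rewrite S_INR, RtoC_plus. replace ((INR k + 1) * u) with (INR k * u + u) by ring.
      apply eisenstein_plus; auto. }
  transitivity (f (w + INR (Z.to_nat (- n)) * u)); [symmetry|rewrite <- Ez; reflexivity]. apply Hn, Hw.
Qed.

Lemma wp_periodic (z l : C) : eisenstein l -> ~ eisenstein z -> wp (z + l) = wp z.
Proof.
intros (m & n & ->) Hz.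
replace (z + (IZR m + IZR n * zeta)) with (z + IZR m * 1 + IZR n * zeta) by ring.
assert (Hzeta : eisenstein zeta) by (exists 0%Z, 1%Z; ring).
rewrite (periodic_Z wp zeta Hzeta wp_periodic_zeta).
- apply (periodic_Z wp 1 eisenstein_1 wp_periodic_1). exact Hz.
- apply not_eisenstein_plus; auto. exists m, 0%Z. ring.
Qed.

Lemma wp'_periodic (z l : C) : eisenstein l -> ~ eisenstein z -> wp' (z + l) = wp' z.
Proof. intros Hl Hz. unfold wp'. rewrite psum_periodic; auto. Qed.

Lemma wp''_periodic (z l : C) : eisenstein l -> ~ eisenstein z -> wp'' (z + l) = wp'' z.
Proof. intros Hl Hz. unfold wp''. rewrite psum_periodic; auto. Qed.

(** * A maximum principle for doubly periodic functions *)

Definition taylor2_at (f : C -> C) (z : C) : Prop := exists b c, taylor2 f z b c.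

Lemma quadratic_bound (a b c k : C) : (Cmod k <= 1)%R ->
  (Cmod (a + b * k + c * k ^ 2) <= Cmod a + Cmod b + Cmod c)%R.
Proof.
intros Hk. pose proof (Cmod_ge_0 k). pose proof (Cmod_ge_0 b). pose proof (Cmod_ge_0 c).
eapply Rle_trans; [apply Cmod_triangle|].
eapply Rle_trans; [apply Rplus_le_compat_r, Cmod_triangle|].
rewrite !Cmod_mult, Cmod_pow.
assert (Cmod k ^ 2 <= 1)%R by nra. nra.
Qed.

Lemma near_ball (z : C) (r : R) : (0 < r)%R -> near z (fun w => (Cmod (w - z) < r)%R).
Proof. intros Hr. exists r. auto. Qed.

Lemma near_0_ball (r : R) : (0 < r)%R -> near 0 (fun k => (Cmod k < r)%R).
Proof.
intros Hr. exists r. split; auto. intros w Hw. replace (w - 0) with w in Hw by ring. exact Hw.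
Qed.

Lemma taylor2_mult (f g : C -> C) (z : C) :
  taylor2_at f z -> taylor2_at g z -> taylor2_at (fun w => f w * g w) z.
Proof.
intros (b & c & M & HM & Hf) (b' & c' & M' & HM' & Hg).
exists (b * g z + f z * b'), (c * g z + b * b' + f z * c').
(* [K1] accounts for the terms of degree three and four in the product of the two quadratic
   polynomials; [Cmod 0] is there to fit [quadratic_bound]. *)
set (K1 := (Cmod (b * c' + c * b') + Cmod (c * c') + Cmod 0)%R).
set (K2 := (M * (Cmod (g z) + Cmod b' + Cmod c' + M'))%R).
set (K3 := ((Cmod (f z) + Cmod b + Cmod c) * M')%R).
assert (P1 : (0 <= K1)%R) by (unfold K1; pose proof (Cmod_ge_0 (b * c' + c * b')); pose proof (Cmod_ge_0 (c * c')); rewrite Cmod_0; lra).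
assert (P2 : (0 <= K2)%R) by (unfold K2; pose proof (Cmod_ge_0 (g z)); pose proof (Cmod_ge_0 b'); pose proof (Cmod_ge_0 c'); apply Rmult_le_pos; lra).
assert (P3 : (0 <= K3)%R) by (unfold K3; pose proof (Cmod_ge_0 (f z)); pose proof (Cmod_ge_0 b); pose proof (Cmod_ge_0 c); apply Rmult_le_pos; lra).
exists (K1 + K2 + K3)%R. split; [lra|].
generalize (near_and _ _ _ (near_and _ _ _ Hf Hg) (near_0_ball 1 Rlt_0_1)).
apply near_imp. intros k ((H1 & H2) & Hk).
pose proof (Cmod_ge_0 k) as Pk.
set (r := f (z + k) - f z - b * k - c * k ^ 2) in *.
set (r' := g (z + k) - g z - b' * k - c' * k ^ 2) in *.
replace (f (z + k) * g (z + k) - f z * g z - (b * g z + f z * b') * k - (c * g z + b * b' + f z * c') * k ^ 2)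
  with (k ^ 3 * ((b * c' + c * b') + (c * c') * k + 0 * k ^ 2) + r * (g z + b' * k + c' * k ^ 2 + r') + (f z + b * k + c * k ^ 2) * r')
  by (unfold r, r'; ring).
assert (Pk3 : (0 <= Cmod k ^ 3 <= 1)%R).
{ split; [apply pow_le; auto|]. rewrite <- (pow1 3). apply pow_incr. lra. }
eapply Rle_trans; [apply Cmod_triangle|].
eapply Rle_trans; [apply Rplus_le_compat_r, Cmod_triangle|].
rewrite (Cmod_mult (k ^ 3)), (Cmod_mult r), (Cmod_mult _ r'), Cmod_pow.
rewrite !Rmult_plus_distr_r. repeat apply Rplus_le_compat.
- rewrite Rmult_comm. apply Rmult_le_compat_r; [lra|]. apply quadratic_bound. lra.
- unfold K2. replace (M * (Cmod (g z) + Cmod b' + Cmod c' + M') * Cmod k ^ 3)%R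
    with (M * Cmod k ^ 3 * (Cmod (g z) + Cmod b' + Cmod c' + M'))%R by ring.
  apply Rmult_le_compat; auto using Cmod_ge_0.
  eapply Rle_trans; [apply Cmod_triangle|]. apply Rplus_le_compat; [apply quadratic_bound; lra|].
  eapply Rle_trans; [exact H2|]. nra.
- unfold K3. rewrite Rmult_assoc. apply Rmult_le_compat; auto using Cmod_ge_0. apply quadratic_bound. lra.
Qed.

Lemma taylor2_minus (f g : C -> C) (z : C) :
  taylor2_at f z -> taylor2_at g z -> taylor2_at (fun w => f w - g w) z.
Proof.
intros (b & c & M & HM & Hf) (b' & c' & M' & HM' & Hg).
exists (b - b'), (c - c'). exists (M + M')%R. split; [lra|].
generalize (near_and _ _ _ Hf Hg). apply near_imp. intros k (H1 & H2).
replace (f (z + k) - g (z + k) - (f z - g z) - (b - b') * k - (c - c') * k ^ 2)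
  with ((f (z + k) - f z - b * k - c * k ^ 2) - (g (z + k) - g z - b' * k - c' * k ^ 2)) by ring.
eapply Rle_trans; [apply Cmod_triangle_minus|]. lra.
Qed.

Lemma taylor2_const (a z : C) : taylor2_at (fun _ => a) z.
Proof.
exists 0, 0, 0%R. split; [lra|]. exists 1%R. split; [lra|]. intros k _.
replace (a - a - 0 * k - 0 * k ^ 2) with (RtoC 0) by ring. rewrite Cmod_0. lra.
Qed.

Lemma taylor2_id (z : C) : taylor2_at (fun w => w) z.
Proof.
exists 1, 0, 0%R. split; [lra|]. exists 1%R. split; [lra|]. intros k _.
replace (z + k - z - 1 * k - 0 * k ^ 2) with (RtoC 0) by ring. rewrite Cmod_0. lra.
Qed.

Lemma taylor2_near (f : C -> C) (z : C) (eps : R) : (0 < eps)%R -> taylor2_at f z ->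
  near z (fun w => (Cmod (f w - f z) < eps)%R).
Proof. intros He (b & c & H). apply (Cder_near f z b eps He), (taylor2_Cder f z b c H). Qed.

Lemma near_shift (z : C) (P : C -> Prop) : near z P -> near 0 (fun k => P (z + k)).
Proof.
intros (d & Hd & H). exists d. split; auto. intros k Hk. apply H.
replace (z + k - z) with (k - 0) by ring. exact Hk.
Qed.

Lemma taylor2_inv (f : C -> C) (z : C) : f z <> 0 -> taylor2_at f z -> taylor2_at (fun w => / f w) z.
Proof.
intros Hz Ht. assert (N := near_shift _ _ (taylor2_near f z (Cmod (f z) / 2) ltac:(apply Cmod_gt_0 in Hz; lra) Ht)).
destruct Ht as (b & c & M & HM & Hf).
(* The power series inverse to order two: the product of [u + b1 k + c1 k^2] and [f z + b k + c k^2]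
   is [1 + O(k^3)]. *)
set (u := / f z). set (b1 := - b * u ^ 2). set (c1 := b ^ 2 * u ^ 3 - c * u ^ 2).
exists b1, c1.
set (K1 := (Cmod (b * c1 + c * b1) + Cmod (c * c1) + Cmod 0)%R).
set (K2 := (M * (Cmod u + Cmod b1 + Cmod c1))%R).
assert (P1 : (0 <= K1)%R) by (unfold K1; pose proof (Cmod_ge_0 (b * c1 + c * b1)); pose proof (Cmod_ge_0 (c * c1)); rewrite Cmod_0; lra).
assert (P2 : (0 <= K2)%R) by (unfold K2; pose proof (Cmod_ge_0 u); pose proof (Cmod_ge_0 b1); pose proof (Cmod_ge_0 c1); apply Rmult_le_pos; lra).
assert (Pz := proj1 (Cmod_gt_0 _) Hz).
assert (Pi : (0 < / (Cmod (f z) / 2))%R) by (apply Rinv_0_lt_compat; lra).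
exists ((K1 + K2) * / (Cmod (f z) / 2))%R. split; [apply Rmult_le_pos; lra|].
generalize (near_and _ _ _ (near_and _ _ _ Hf N) (near_0_ball 1 Rlt_0_1)).
apply near_imp. intros k ((H1 & H2) & Hk).
pose proof (Cmod_ge_0 k) as Pk.
set (r := f (z + k) - f z - b * k - c * k ^ 2) in *.
assert (L : (Cmod (f z) / 2 <= Cmod (f (z + k)%C))%R).
{ rewrite Cmod_minus_sym in H2. pose proof (Cmod_triangle_rev (f z) (f (z + k))). lra. }
assert (Hn : f (z + k) <> 0) by (apply Cmod_gt_0; lra).
cbv beta. fold u. replace (/ f (z + k) - u - b1 * k - c1 * k ^ 2)
  with (- (k ^ 3 * ((b * c1 + c * b1) + (c * c1) * k + 0 * k ^ 2) + r * (u + b1 * k + c1 * k ^ 2)) * / f (z + k)).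
2: { transitivity ((1 - (u + b1 * k + c1 * k ^ 2) * f (z + k)) * / f (z + k)); [|field; auto].
     f_equal. replace (f (z + k)) with (f z + b * k + c * k ^ 2 + r) by (unfold r; ring).
     unfold c1, b1, u. field. auto. }
rewrite Cmod_mult, Cmod_opp, Cmod_inv by auto.
assert (Pk3 : (0 <= Cmod k ^ 3)%R) by (apply pow_le; auto).
replace ((K1 + K2) * / (Cmod (f z) / 2) * Cmod k ^ 3)%R with ((K1 * Cmod k ^ 3 + K2 * Cmod k ^ 3) * / (Cmod (f z) / 2))%R by ring.
apply Rmult_le_compat; auto using Cmod_ge_0.
- left. apply Rinv_0_lt_compat. lra.
- eapply Rle_trans; [apply Cmod_triangle|].
  rewrite (Cmod_mult (k ^ 3)), (Cmod_mult r), Cmod_pow. apply Rplus_le_compat.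
  + rewrite Rmult_comm. apply Rmult_le_compat_r; [lra|]. apply quadratic_bound. lra.
  + unfold K2. replace (M * (Cmod u + Cmod b1 + Cmod c1) * Cmod k ^ 3)%R
      with (M * Cmod k ^ 3 * (Cmod u + Cmod b1 + Cmod c1))%R by ring.
    apply Rmult_le_compat; auto using Cmod_ge_0. apply quadratic_bound. lra.
- apply Rinv_le_contravar; lra.
Qed.

(** The increments are [t] times the fourth roots of unity. The cross terms carry their first and
    second powers or conjugates of these, all of which sum to [0]. *)
Lemma four_point_sum (a b c : C) (t : R) :
  (Cmod (a + b * t + c * t ^ 2) ^ 2 + Cmod (a + b * (- t) + c * (- t) ^ 2) ^ 2
   + Cmod (a + b * (Ci * t) + c * (Ci * t) ^ 2) ^ 2 + Cmod (a + b * (- (Ci * t)) + c * (- (Ci * t)) ^ 2) ^ 2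
   = 4 * Cmod a ^ 2 + 4 * Cmod b ^ 2 * t ^ 2 + 4 * Cmod c ^ 2 * t ^ 4)%R.
Proof.
rewrite !Cmod_sqr. destruct a as [a1 a2], b as [b1 b2], c as [c1 c2].
unfold Ci, RtoC, Cplus, Cmult, Copp, Cpow; simpl. ring.
Qed.

(* Averaging over [z + t], [z - t], [z + it], [z - it] annihilates the linear and the quadratic terms
   of [Re (conj (g z) * g)], so that the average of [|g|^2] is at least [|g z|^2 - O(t^3)]. *)
Lemma no_local_max (g : C -> C) (z : C) (eps : R) : (0 < eps)%R -> taylor2_at g z ->
  ~ near z (fun w => (Cmod (g w) ^ 2 + eps * Cmod w ^ 2 <= Cmod (g z) ^ 2 + eps * Cmod z ^ 2)%R).
Proof.
intros He (b & c & M & HM & Hg) Hmax. apply near_shift in Hmax.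
destruct (near_and _ _ _ (near_and _ _ _ Hg Hmax) (near_0_ball 1 Rlt_0_1)) as (d & Hd & H).
set (Q := (Cmod (g z) + Cmod b + Cmod c)%R).
assert (PQ : (0 <= Q)%R) by (unfold Q; pose proof (Cmod_ge_0 (g z)); pose proof (Cmod_ge_0 b); pose proof (Cmod_ge_0 c); lra).
assert (PQM : (0 <= Q * M)%R) by (apply Rmult_le_pos; auto).
(* Over the four points the term in [eps] gains [4 eps t^2] in total, while the remainders cost at
   most [8 Q M t^3]; this [t] makes the gain prevail. *)
set (t := Rmin (d / 2) (eps / (1 + 2 * Q * M) / 2)).
assert (Pe : (0 < eps / (1 + 2 * Q * M))%R) by (apply Rdiv_lt_0_compat; lra).
assert (Pt : (0 < t)%R) by (apply Rmin_pos; lra).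
assert (B : forall k, Cmod k = t ->
  (Cmod (g z + b * k + c * k ^ 2) ^ 2 - 2 * Q * M * t ^ 3 + eps * Cmod (z + k) ^ 2 <= Cmod (g z) ^ 2 + eps * Cmod z ^ 2)%R).
{ intros k Ek. pose proof (Rmin_l (d / 2) (eps / (1 + 2 * Q * M) / 2)) as Lt. fold t in Lt.
  destruct (H k) as ((H1 & H2) & H3).
  { replace (k - 0) with k by ring. lra. }
  rewrite Ek in H1.
  set (q := g z + b * k + c * k ^ 2) in *.
  assert (Bq : (Cmod q <= Q)%R) by (apply quadratic_bound; lra).
  replace (g (z + k) - g z - b * k - c * k ^ 2) with (g (z + k) - q) in H1 by (unfold q; ring).
  rewrite Cmod_minus_sym in H1. pose proof (Cmod_triangle_rev q (g (z + k))) as T.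
  pose proof (Cmod_ge_0 q). pose proof (Cmod_ge_0 (g (z + k))).
  assert (Pt3 : (0 <= t ^ 3)%R) by (apply pow_le; lra).
  assert (PMt : (0 <= M * t ^ 3)%R) by (apply Rmult_le_pos; auto).
  assert (Cmod q ^ 2 - 2 * Q * M * t ^ 3 <= Cmod (g (z + k)%C) ^ 2)%R.
  { set (x := Cmod q) in *. set (y := Cmod (g (z + k))) in *. set (s := (M * t ^ 3)%R) in *.
    replace (2 * Q * M * t ^ 3)%R with (2 * Q * s)%R by (unfold s; ring).
    assert (Hxy : (x - s <= y)%R) by lra.
    destruct (Rle_or_lt 0 (x - s)); nra. }
  lra. }
assert (N1 : Cmod t = t) by (rewrite Cmod_R; apply Rabs_pos_eq; lra).
assert (N2 : Cmod (Ci * t) = t) by (rewrite Cmod_mult, Cmod_Ci, N1; ring).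
assert (B1 := B (RtoC t) N1). assert (B2 := B (- t) ltac:(rewrite Cmod_opp; exact N1)).
assert (B3 := B (Ci * t) N2). assert (B4 := B (- (Ci * t)) ltac:(rewrite Cmod_opp; exact N2)).
pose proof (four_point_sum (g z) b c t) as S1.
pose proof (four_point_sum z 1 0 t) as S2.
replace (z + 1 * t + 0 * t ^ 2) with (z + t) in S2 by ring.
replace (z + 1 * - t + 0 * (- t) ^ 2) with (z + - t) in S2 by ring.
replace (z + 1 * (Ci * t) + 0 * (Ci * t) ^ 2) with (z + Ci * t) in S2 by ring.
replace (z + 1 * - (Ci * t) + 0 * (- (Ci * t)) ^ 2) with (z + - (Ci * t)) in S2 by ring.
rewrite Cmod_1, Cmod_0 in S2.
assert (S2' : (eps * Cmod (z + t) ^ 2 + eps * Cmod (z + - t) ^ 2 + eps * Cmod (z + Ci * t) ^ 2 + eps * Cmod (z + - (Ci * t)) ^ 2 = 4 * eps * Cmod z ^ 2 + 4 * eps * t ^ 2)%R).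
{ rewrite <- !Rmult_plus_distr_l, S2. ring. }
assert (0 <= Cmod b ^ 2 * t ^ 2)%R by (apply Rmult_le_pos; apply pow2_ge_0).
assert (0 <= Cmod c ^ 2 * t ^ 4)%R by (apply Rmult_le_pos; [apply pow2_ge_0|apply pow_le; lra]).
assert (F : (4 * eps * t ^ 2 <= 8 * Q * M * t ^ 3)%R) by lra.
assert (Lt : (t <= eps / (1 + 2 * Q * M) / 2)%R) by apply Rmin_r.
assert (G : (eps <= 2 * Q * M * t)%R).
{ apply Rmult_le_reg_r with (4 * t ^ 2)%R; [apply Rmult_lt_0_compat; [lra|apply pow_lt; auto]|]. simpl in *. lra. }
assert (E : ((1 + 2 * Q * M) * (eps / (1 + 2 * Q * M) / 2) = eps / 2)%R) by (field; lra).
assert ((1 + 2 * Q * M) * t <= eps / 2)%R by (rewrite <- E; apply Rmult_le_compat_l; lra).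
lra.
Qed.

(** A square rather than a disc, to fit the compactness of rectangles in the plane. *)
Definition in_square (r : R) (z : C) : Prop := (Rabs (fst z) <= r /\ Rabs (snd z) <= r)%R.

Lemma Cmod_le_Rabs (z : C) : (Cmod z <= Rabs (fst z) + Rabs (snd z))%R.
Proof.
replace z with (RtoC (fst z) + Ci * RtoC (snd z)) at 1.
- eapply Rle_trans; [apply Cmod_triangle|]. rewrite Cmod_mult, Cmod_Ci, !Cmod_R. lra.
- destruct z as [x y]. unfold Ci, RtoC, Cplus, Cmult; simpl. f_equal; ring.
Qed.

Lemma in_square_Cmod (r : R) (z : C) : (Cmod z <= r)%R -> in_square r z.
Proof.
intros H. pose proof (Rmax_Cmod z).
pose proof (Rmax_l (Rabs (fst z)) (Rabs (snd z))). pose proof (Rmax_r (Rabs (fst z)) (Rabs (snd z))).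
split; lra.
Qed.

(** Compactness turns local constants [e] into a common one. The factor [2] in [2 * d] pays for
    passing from closeness in each coordinate to closeness in [Cmod]. *)
Lemma square_uniform (r : R) (P : R -> C -> Prop) :
  (forall e e' w, (0 < e' <= e)%R -> P e w -> P e' w) ->
  (forall z, in_square r z -> exists e, (0 < e)%R /\ near z (P e)) ->
  exists e, (0 < e)%R /\ forall z, in_square r z -> P e z.
Proof.
intros Hmono H.
assert (Hd : forall z : C, exists d : posreal, in_square r z ->
  forall w, (Cmod (w - z) < 2 * d)%R -> P d w).
{ intros z. destruct (classic (in_square r z)) as [Hz|Hz].
  - destruct (H z Hz) as (e & He & d & Hd & K).
    assert (Hm : (0 < Rmin e (d / 2))%R) by (apply Rmin_pos; lra).
    exists (mkposreal _ Hm). simpl. intros _ w Hw.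
    pose proof (Rmin_l e (d / 2)). pose proof (Rmin_r e (d / 2)).
    apply (Hmono e); [lra|]. apply K. lra.
  - exists (mkposreal 1 Rlt_0_1). intros; contradiction. }
pose (delta := fun x y : R => proj1_sig (constructive_indefinite_description _ (Hd (x, y)))).
assert (Hdelta : forall x y, in_square r (x, y) -> forall w, (Cmod (w - (x, y)) < 2 * delta x y)%R -> P (delta x y) w).
{ intros x y. unfold delta. destruct (constructive_indefinite_description _ (Hd (x, y))) as (d & K). exact K. }
destruct (compactness_value_2d (- r) r (- r) r delta) as (d & K).
exists d. split; [apply cond_pos|]. intros [x y] (Hx & Hy). cbn in Hx, Hy.
apply Rabs_le_between in Hx. apply Rabs_le_between in Hy.
apply NNPP. intros N. apply (K x y Hx Hy). intros (u & v & Hu & Hv & H1 & H2 & H3). apply N.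
apply (Hmono (delta u v)); [split; [apply cond_pos|exact H3]|].
apply Hdelta.
- split; apply Rabs_le_between; assumption.
- eapply Rle_lt_trans; [apply Cmod_le_Rabs|]. cbn. unfold Rminus in *. lra.
Qed.

Definition upper_semicontinuous (v : C -> R) : Prop :=
  forall z eps, (0 < eps)%R -> near z (fun w => (v w < v z + eps)%R).

(** [square_uniform] is applied to [v <= / e], which gives boundedness, and then to [v <= m - e],
    which is absurd for the supremum [m] and would follow if [m] were not attained. *)
Lemma square_max (v : C -> R) (r : R) : (0 <= r)%R -> upper_semicontinuous v ->
  exists z0, in_square r z0 /\ forall z, in_square r z -> (v z <= v z0)%R.
Proof.
intros Hr Hv.
assert (B : exists e, (0 < e)%R /\ forall z, in_square r z -> (v z <= / e)%R).
{ apply square_uniform.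
  - intros e e' w He Hw. eapply Rle_trans; [exact Hw|]. apply Rinv_le_contravar; lra.
  - intros z _. pose proof (Rabs_pos (v z)). exists (/ (1 + Rabs (v z)))%R.
    split; [apply Rinv_0_lt_compat; lra|]. generalize (Hv z 1%R Rlt_0_1). apply near_imp.
    intros w Hw. rewrite Rinv_inv. pose proof (Rle_abs (v z)). lra. }
destruct B as (e & He & B).
assert (S0 : in_square r 0) by (split; cbn; rewrite Rabs_R0; exact Hr).
destruct (completeness (fun y => exists z, in_square r z /\ y = v z)) as (m & Hm1 & Hm2).
{ exists (/ e)%R. intros y (z & Hz & ->). auto. }
{ exists (v 0), 0. auto. }
apply NNPP. intros N.
assert (Hlt : forall z, in_square r z -> (v z < m)%R).
{ intros z Hz. assert (v z <= m)%R by (apply Hm1; eauto).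
  destruct (Req_dec (v z) m) as [E|]; [|lra]. exfalso. apply N. exists z. split; auto.
  intros z' Hz'. rewrite E. apply Hm1. eauto. }
destruct (square_uniform r (fun e w => (v w <= m - e)%R)) as (e' & He' & K).
- intros a b w Hab Hw. lra.
- intros z Hz. specialize (Hlt z Hz). exists ((m - v z) / 2)%R. split; [lra|].
  generalize (Hv z ((m - v z) / 2)%R ltac:(lra)). apply near_imp. intros w Hw. lra.
- assert (m <= m - e')%R; [|lra]. apply Hm2. intros y (z & Hz & ->). auto.
Qed.

(** In the applications [f] is nonnegative and tends to [0] at the lattice points, so that this
    extension is upper semicontinuous on the whole plane. *)
Definition off_lattice (f : C -> R) (z : C) : R :=
  if excluded_middle_informative (eisenstein z) then 0%R else f z.

Lemma off_lattice_in (f : C -> R) (z : C) : eisenstein z -> off_lattice f z = 0%R.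
Proof. intros H. unfold off_lattice. destruct (excluded_middle_informative (eisenstein z)); tauto. Qed.

Lemma off_lattice_out (f : C -> R) (z : C) : ~ eisenstein z -> off_lattice f z = f z.
Proof. intros H. unfold off_lattice. destruct (excluded_middle_informative (eisenstein z)); tauto. Qed.

Lemma off_lattice_usc (f u : C -> R) :
  (forall z eps, (0 < eps)%R -> near z (fun w => (u w < u z + eps)%R)) ->
  (forall z eps, (0 < eps)%R -> ~ eisenstein z -> near z (fun w => (f w < f z + eps)%R)) ->
  (forall l eps, (0 < eps)%R -> eisenstein l -> near l (fun w => ~ eisenstein w -> (f w < eps)%R)) ->
  upper_semicontinuous (fun w => (off_lattice f w + u w)%R).
Proof.
intros Hu Hf Hl z eps He.
destruct (classic (eisenstein z)) as [Ez|Ez].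
- rewrite (off_lattice_in f z Ez).
  generalize (near_and _ _ _ (Hu z (eps / 2)%R ltac:(lra)) (Hl z (eps / 2)%R ltac:(lra) Ez)).
  apply near_imp. intros w (H1 & H2). destruct (classic (eisenstein w)) as [Ew|Ew].
  + rewrite off_lattice_in by auto. lra.
  + rewrite off_lattice_out by auto. specialize (H2 Ew). lra.
- rewrite (off_lattice_out f z Ez).
  generalize (near_and _ _ _ (near_and _ _ _ (Hu z (eps / 2)%R ltac:(lra)) (Hf z (eps / 2)%R ltac:(lra) Ez)) (not_eisenstein_near z Ez)).
  apply near_imp. intros w ((H1 & H2) & H3). rewrite off_lattice_out by auto. lra.
Qed.

Lemma Cmod_near (f : C -> C) (z : C) (eps : R) : (0 < eps)%R -> taylor2_at f z ->
  near z (fun w => (Cmod (f w) < Cmod (f z) + eps)%R).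
Proof.
intros He Hf. generalize (taylor2_near f z eps He Hf). apply near_imp. intros w Hw.
pose proof (Cmod_triangle_rev (f w) (f z)). lra.
Qed.

Lemma Cmod_sqr_near (f : C -> C) (z : C) (eps : R) : (0 < eps)%R -> taylor2_at f z ->
  near z (fun w => (Cmod (f w) ^ 2 < Cmod (f z) ^ 2 + eps)%R).
Proof.
intros He Hf. pose proof (Cmod_ge_0 (f z)) as P.
assert (Q : (0 < Rmin 1 (eps / (2 + 2 * Cmod (f z))))%R) by (apply Rmin_pos; [lra|apply Rdiv_lt_0_compat; lra]).
generalize (Cmod_near f z _ Q Hf). apply near_imp. intros w Hw.
pose proof (Rmin_l 1 (eps / (2 + 2 * Cmod (f z)))) as L1.
pose proof (Rmin_r 1 (eps / (2 + 2 * Cmod (f z)))) as L2.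
set (q := Rmin 1 (eps / (2 + 2 * Cmod (f z)))) in *.
assert (E : ((2 + 2 * Cmod (f z)) * (eps / (2 + 2 * Cmod (f z))) = eps)%R) by (field; lra).
assert (q * (2 + 2 * Cmod (f z)) <= eps)%R by (rewrite <- E, Rmult_comm; apply Rmult_le_compat_l; lra).
pose proof (Cmod_ge_0 (f w)).
assert (Cmod (f w) ^ 2 < (Cmod (f z) + q) ^ 2)%R by nra. nra.
Qed.

(* [H ^ 2 / z] tends to [0] both at infinity and at the lattice points, so its modulus
   would have a maximum off the lattice. *)
Lemma periodic_liouville (H : C -> C) :
  (forall z, ~ eisenstein z -> taylor2_at H z) ->
  (forall z l, eisenstein l -> ~ eisenstein z -> H (z + l) = H z) ->
  (exists M, near 0 (fun k => k <> 0 -> (Cmod (H k) <= M * Cmod k)%R)) ->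
  forall z, ~ eisenstein z -> H z = 0.
Proof.
intros HT HP (M0 & HM0).
set (M := (1 + Rabs M0)%R). assert (PM : (0 < M)%R) by (unfold M; pose proof (Rabs_pos M0); lra).
assert (HM : near 0 (fun k => k <> 0 -> (Cmod (H k) <= M * Cmod k)%R)).
{ revert HM0. apply near_imp. intros k Hk Nk. eapply Rle_trans; [apply Hk, Nk|].
  apply Rmult_le_compat_r; [apply Cmod_ge_0|]. unfold M. pose proof (Rle_abs M0). lra. }
clearbody M. clear M0 HM0.
assert (HL : forall l, eisenstein l -> near l (fun w => ~ eisenstein w -> (Cmod (H w) <= M * Cmod (w - l))%R)).
{ intros l El. destruct HM as (d & Hd & HM). exists d. split; auto. intros w Hw Ew.
  rewrite <- (HP w (- l)); [|apply eisenstein_opp; auto|auto].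
  apply (HM (w - l)).
  - replace (w - l - 0) with (w - l) by ring. exact Hw.
  - intros E. apply Ew. replace w with (w - l + l) by ring. rewrite E. replace (0 + l) with l by ring. exact El. }
assert (U0 : forall z eps, (0 < eps)%R -> near z (fun w => ((fun _ : C => 0%R) w < (fun _ : C => 0%R) z + eps)%R)).
{ intros z eps He. exists 1%R. split; [lra|]. intros; lra. }
(* [H] is bounded, because the square contains a representative of every class modulo the
   lattice. *)
destruct (square_max (fun w => (off_lattice (fun w => Cmod (H w)) w + 0)%R) 1) as (zb & _ & Hb); [lra| |].
{ apply (off_lattice_usc (fun w => Cmod (H w)) (fun _ => 0%R) U0).
  - intros z eps He Ez. apply Cmod_near; auto.
  - intros l eps He El. generalize (near_and _ _ _ (HL l El) (near_ball l (eps / M) ltac:(apply Rdiv_lt_0_compat; lra))).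
    apply near_imp. intros w (H1 & H2) Ew. eapply Rle_lt_trans; [apply H1, Ew|].
    apply Rlt_le_trans with (M * (eps / M))%R; [apply Rmult_lt_compat_l; lra|right; field; lra]. }
set (B := (off_lattice (fun w => Cmod (H w)) zb + 0)%R) in Hb.
assert (HB : forall z, ~ eisenstein z -> (Cmod (H z) <= B)%R).
{ intros z Ez. destruct (eisenstein_close z) as (l & El & Hl).
  rewrite <- (HP z (- l)); [|apply eisenstein_opp; auto|auto].
  specialize (Hb (z + - l) (in_square_Cmod 1 (z - l) ltac:(lra))). cbv beta in Hb.
  rewrite off_lattice_out in Hb; [cbv beta in Hb; lra|]. apply not_eisenstein_plus; auto. apply eisenstein_opp; auto. }
clearbody B. clear Hb zb.
intros z1 E1. apply NNPP. intros N1.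
assert (Z1 : z1 <> 0) by (intros ->; apply E1, eisenstein_0).
pose (g := fun w : C => H w * H w * / w).
assert (Eg : forall w : C, w <> 0 -> Cmod (g w) = (Cmod (H w) * Cmod (H w) * / Cmod w)%R).
{ intros w Hw. unfold g. rewrite !Cmod_mult, Cmod_inv by auto. reflexivity. }
assert (Ne : forall w : C, ~ eisenstein w -> w <> 0) by (intros w Hw ->; apply Hw, eisenstein_0).
assert (Tg : forall z, ~ eisenstein z -> taylor2_at g z).
{ intros z Ez. unfold g. apply (taylor2_mult (fun w => H w * H w) (fun w => / w)).
  - apply taylor2_mult; auto.
  - apply (taylor2_inv (fun w => w)); [auto|apply taylor2_id]. }
set (s := Cmod (g z1)).
assert (Hs : (0 < s)%R).
{ unfold s. rewrite Eg by auto. pose proof (proj1 (Cmod_gt_0 _) N1). pose proof (proj1 (Cmod_gt_0 _) Z1).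
  apply Rmult_lt_0_compat; [nra|apply Rinv_0_lt_compat; lra]. }
assert (PB : (0 <= B)%R) by (eapply Rle_trans; [apply Cmod_ge_0|apply (HB z1 E1)]).
pose proof (Cmod_ge_0 z1) as Pz1.
assert (PBs : (0 <= 2 * (B * B) / s)%R) by (apply Rmult_le_pos; [nra|left; apply Rinv_0_lt_compat; lra]).
(* For [|w| >= r] off the lattice, [|g w| <= B^2 / r <= s / 2], so the maximum is not attained that
   far out. *)
set (r := (1 + Cmod z1 + 2 * (B * B) / s)%R).
assert (Hr : (1 <= r)%R) by (unfold r; lra).
(* On the square [|w|^2 <= 2 r^2], so the perturbation [eps |w|^2] stays below [s^2 / 4], or equals
   it. *)
set (eps := (s ^ 2 / (8 * r ^ 2))%R).
assert (Pr2 : (0 < r ^ 2)%R) by (apply pow_lt; lra).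
assert (He : (0 < eps)%R) by (unfold eps; apply Rdiv_lt_0_compat; [apply pow_lt; auto|lra]).
destruct (square_max (fun w => (off_lattice (fun w => Cmod (g w) ^ 2) w + eps * Cmod w ^ 2)%R) r) as (z0 & S0 & Hz0); [lra| |].
{ apply (off_lattice_usc (fun w => Cmod (g w) ^ 2)%R (fun w => eps * Cmod w ^ 2)%R).
  - intros z e Pe. generalize (Cmod_sqr_near (fun w => w) z (e / eps) ltac:(apply Rdiv_lt_0_compat; lra) (taylor2_id z)).
    apply near_imp. intros w Hw. apply Rlt_le_trans with (eps * (Cmod z ^ 2 + e / eps))%R; [apply Rmult_lt_compat_l; auto|].
    right. field. lra.
  - intros z e Pe Ez. apply Cmod_sqr_near; auto.
  - intros l e Pe El.
    assert (Hq : (0 < Rmin (1 / 2) (Rmin 1 e / (M * M)))%R).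
    { apply Rmin_pos; [lra|]. apply Rdiv_lt_0_compat; [apply Rmin_pos; lra|nra]. }
    generalize (near_and _ _ _ (HL l El) (near_ball l _ Hq)).
    apply near_imp. intros w (H1 & H2) Ew. specialize (H1 Ew).
    pose proof (Rmin_l (1 / 2) (Rmin 1 e / (M * M))) as L1. pose proof (Rmin_r (1 / 2) (Rmin 1 e / (M * M))) as L2.
    pose proof (Rmin_l 1 e) as L3. pose proof (Rmin_r 1 e) as L4.
    assert (Nw := Ne w Ew). assert (Pw := proj1 (Cmod_gt_0 _) Nw).
    set (k := Cmod (w - l)) in *.
    assert (Pk : (0 <= k)%R) by apply Cmod_ge_0.
    (* Within [1 / 2] of a lattice point [l], no point is closer to [0] than to [l]. Hence
       [|g w| <= M^2 k^2 / |w| <= M^2 k] near every lattice point. *)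
    assert (Hwk : (k <= Cmod w)%R).
    { destruct (Ceq_dec l 0) as [El0|Nl].
      - unfold k. rewrite El0. replace (w - 0) with w by ring. lra.
      - pose proof (eisenstein_ge_1 l El Nl). pose proof (Cmod_triangle_rev l (l - w)) as T.
        replace (l - (l - w)) with w in T by ring. rewrite (Cmod_minus_sym l w) in T. fold k in T. lra. }
    assert (Bg : (Cmod (g w) <= M * M * k)%R).
    { rewrite Eg by auto. apply Rmult_le_reg_r with (Cmod w); auto.
      rewrite Rmult_assoc, Rinv_l, Rmult_1_r by lra.
      pose proof (Cmod_ge_0 (H w)).
      apply Rle_trans with ((M * k) * (M * k))%R; [apply Rmult_le_compat; lra|].
      replace (M * k * (M * k))%R with (M * M * k * k)%R by ring.
      apply Rmult_le_compat_l; auto. apply Rmult_le_pos; nra. }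
    assert (Bg2 : (M * M * k < Rmin 1 e)%R).
    { apply Rlt_le_trans with (M * M * (Rmin 1 e / (M * M)))%R; [apply Rmult_lt_compat_l; [nra|lra]|].
      right. field. lra. }
    pose proof (Cmod_ge_0 (g w)). nra. }
cbv beta in Hz0.
assert (V1 : (s ^ 2 <= off_lattice (fun w => Cmod (g w) ^ 2) z0 + eps * Cmod z0 ^ 2)%R).
{ eapply Rle_trans; [|apply (Hz0 z1), in_square_Cmod; unfold r; lra].
  rewrite off_lattice_out by auto. cbv beta. fold s. assert (0 <= eps * Cmod z1 ^ 2)%R by (apply Rmult_le_pos; [lra|apply pow2_ge_0]). lra. }
assert (Hz2 : (eps * Cmod z0 ^ 2 <= s ^ 2 / 4)%R).
{ assert (Cmod z0 ^ 2 <= 2 * r ^ 2)%R.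
  { rewrite Cmod_sqr, <- (pow2_abs (fst z0)), <- (pow2_abs (snd z0)). destruct S0 as (S1 & S2).
    pose proof (Rabs_pos (fst z0)). pose proof (Rabs_pos (snd z0)). nra. }
  apply Rle_trans with (eps * (2 * r ^ 2))%R; [apply Rmult_le_compat_l; lra|].
  right. unfold eps. field. lra. }
assert (Ps2 : (0 < s ^ 2)%R) by (apply pow_lt; auto).
(* At a lattice point only the perturbation is left, at most [s^2 / 4], whereas the value at [z1] is
   at least [s^2]. *)
destruct (classic (eisenstein z0)) as [Ez|Ez].
{ rewrite off_lattice_in in V1 by auto. lra. }
assert (Hin : (Rabs (fst z0) < r /\ Rabs (snd z0) < r)%R).
{ assert (Cmod z0 < r)%R; [|pose proof (Rmax_Cmod z0); pose proof (Rmax_l (Rabs (fst z0)) (Rabs (snd z0))); pose proof (Rmax_r (Rabs (fst z0)) (Rabs (snd z0))); lra].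
  apply Rnot_le_lt. intros Hle.
  rewrite off_lattice_out in V1 by auto. cbv beta in V1.
  assert (Cmod (g z0) <= s / 2)%R.
  { rewrite Eg by auto. specialize (HB z0 Ez). pose proof (Cmod_ge_0 (H z0)).
    apply Rmult_le_reg_r with (Cmod z0); [lra|].
    rewrite Rmult_assoc, Rinv_l, Rmult_1_r by lra.
    apply Rle_trans with (B * B)%R; [apply Rmult_le_compat; auto|].
    apply Rle_trans with (s / 2 * (2 * (B * B) / s))%R; [right; field; lra|].
    apply Rmult_le_compat_l; [lra|]. unfold r in Hle. lra. }
  pose proof (Cmod_ge_0 (g z0)). nra. }
apply (no_local_max g z0 eps He (Tg z0 Ez)).
assert (Hsq : near z0 (in_square r)).
{ exists (Rmin (r - Rabs (fst z0)) (r - Rabs (snd z0))). split; [apply Rmin_pos; lra|].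
  intros w Hw. pose proof (Rmin_l (r - Rabs (fst z0)) (r - Rabs (snd z0))). pose proof (Rmin_r (r - Rabs (fst z0)) (r - Rabs (snd z0))).
  pose proof (Rmax_Cmod (w - z0)). pose proof (Rmax_l (Rabs (fst (w - z0))) (Rabs (snd (w - z0)))).
  pose proof (Rmax_r (Rabs (fst (w - z0))) (Rabs (snd (w - z0)))).
  change (fst (w - z0)) with (fst w - fst z0)%R in *. change (snd (w - z0)) with (snd w - snd z0)%R in *.
  pose proof (Rabs_triang (fst w - fst z0) (fst z0)). pose proof (Rabs_triang (snd w - snd z0) (snd z0)).
  replace (fst w - fst z0 + fst z0)%R with (fst w) in * by ring. replace (snd w - snd z0 + snd z0)%R with (snd w) in * by ring.
  split; lra. }
generalize (near_and _ _ _ Hsq (not_eisenstein_near z0 Ez)). apply near_imp. intros w (W1 & W2).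
specialize (Hz0 w W1). rewrite !off_lattice_out in Hz0 by auto. exact Hz0.
Qed.

(** * The differential equation of the Weierstrass function *)

(** Multiplication by [zeta] permutes the nonzero lattice points. Consequently [G_n] can survive
    only when [6] divides [n]. *)
Lemma psum_zeta_0 (n : nat) : (3 <= n)%nat ->
  psum eisenstein' n 0 = / zeta ^ n * psum eisenstein' n 0.
Proof.
intros Hn. assert (Z0 := zeta_neq_0).
assert (S := psum_correct eisenstein' n 0 _ eisenstein'_sub Hn eisenstein'_separated).
apply (is_sum_over_unique eisenstein' (fun l => / (0 - zeta * l) ^ n)).
- apply (is_sum_over_reindex eisenstein' eisenstein' (fun x => zeta * x) (fun x => x / zeta) (fun l => / (0 - l) ^ n)).
  + intros x (Hx & Nx). split; [apply eisenstein_mult_zeta; auto|apply Cmult_neq_0; auto].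
  + intros x (Hx & Nx). split; [apply eisenstein_div_zeta; auto|].
    intros E. apply Nx. replace x with (x / zeta * zeta) by (field; auto). rewrite E. ring.
  + intros. field. auto.
  + intros. field. auto.
  + exact S.
- apply is_sum_over_ext with (fun l => / zeta ^ n * / (0 - l) ^ n); [|apply is_sum_over_scal, S].
  intros l (Hl & Nl).
  replace (0 - zeta * l) with (zeta * (0 - l)) by ring.
  rewrite Cpow_mult_l. assert (N : 0 - l <> 0).
  { intros E. apply Nl. replace l with (- (0 - l)) by ring. rewrite E. ring. }
  pose proof (Cpow_neq_0 _ n Z0). pose proof (Cpow_neq_0 _ n N). field. auto.
Qed.

Lemma psum_zero (n : nat) : (3 <= n)%nat -> zeta ^ n <> 1 -> psum eisenstein' n 0 = 0.
Proof.
intros Hn Hz. pose proof (psum_zeta_0 n Hn) as E. set (s := psum eisenstein' n 0) in *.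
pose proof (Cpow_neq_0 zeta n zeta_neq_0) as Nz.
assert (E2 : (zeta ^ n - 1) * s = 0).
{ replace ((zeta ^ n - 1) * s) with (zeta ^ n * s - s) by ring. rewrite E at 1. field. auto. }
destruct (Ceq_dec s 0) as [|Ns]; auto. exfalso.
apply (Cmult_neq_0 (zeta ^ n - 1) s); auto.
intros E3. apply Hz. replace (zeta ^ n) with (zeta ^ n - 1 + 1) by ring. rewrite E3. ring.
Qed.

Lemma psum_3_zero : psum eisenstein' 3 0 = 0.
Proof.
apply psum_zero; [lia|]. rewrite zeta_cube. intros E. apply (f_equal fst) in E. cbn in E. lra.
Qed.

Lemma psum_4_zero : psum eisenstein' 4 0 = 0.
Proof.
apply psum_zero; [lia|]. replace (zeta ^ 4) with (zeta ^ 3 * zeta) by ring. rewrite zeta_cube, zeta_coords.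
intros E. apply (f_equal fst) in E. cbn in E. lra.
Qed.

Lemma wp_reg_0 : wp_reg 0 = 0.
Proof.
apply (is_sum_over_unique eisenstein' (fun l => / (0 - l) ^ 2 - / l ^ 2)).
- apply (wp_sum_exists _ _ _ eisenstein'_sub eisenstein'_separated).
- apply is_sum_over_ext with (fun _ => 0).
  + intros l _. replace ((0 - l) ^ 2) with (l ^ 2) by ring. ring.
  + apply is_sum_over_Cmod. intros eps He. exists []. split; [split; [constructor|easy]|].
    intros l _ _. replace (sum_list (fun _ => 0) l - 0) with (RtoC 0); [rewrite Cmod_0; lra|].
    induction l as [|x l IH]; simpl; [ring|]. rewrite IH at 1. ring.
Qed.

(* The coefficients of [z] and [z^2] are multiples of [G_3] and [G_4]; both vanish by hexagonal symmetry. *)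
Lemma wp_reg_small : exists M, (0 <= M)%R /\ near 0 (fun k => (Cmod (wp_reg k) <= M * Cmod k ^ 3)%R).
Proof.
destruct (lattice_sum_taylor2 eisenstein' 2 (fun l => / l ^ 2) wp_reg 0 (1 / 2) eisenstein'_sub (le_n 2) eisenstein'_separated)
  as (M & HM & T).
- exists (1 / 4)%R. split; [lra|]. intros w Hw.
  apply (wp_sum_exists _ w (1 / 2 / 2) eisenstein'_sub).
  apply (separated_near _ 0); [apply eisenstein'_separated|lra].
- exists M. split; auto. revert T. apply near_imp. intros k Hk.
  cbn [Nat.add] in Hk. rewrite psum_3_zero, psum_4_zero, wp_reg_0 in Hk.
  replace (0 + k) with k in Hk by ring.
  match type of Hk with (Cmod ?x <= _)%R => replace x with (wp_reg k) in Hk by ring end. exact Hk.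
Qed.

(** The constant term of the regular part of [wp'' / 6] is [G_4 = 0]. *)
Lemma psum_reg_small : exists M, (0 <= M)%R /\
  near 0 (fun k => (Cmod (psum eisenstein' 4 k) <= M * Cmod k)%R).
Proof.
destruct (psum_taylor2 eisenstein' 4 0 (1 / 2) eisenstein'_sub ltac:(lia) eisenstein'_separated)
  as (M & HM & T).
set (b := - INR 4 * psum eisenstein' (4 + 1) 0) in *. set (c := INR 4 * (INR 4 + 1) / 2 * psum eisenstein' (4 + 2) 0) in *.
exists (Cmod b + Cmod c + M)%R.
pose proof (Cmod_ge_0 b). pose proof (Cmod_ge_0 c). split; [lra|].
generalize (near_and _ _ _ T (near_0_ball 1 Rlt_0_1)). apply near_imp. intros k (Hk & Hk1).
rewrite psum_4_zero in Hk. replace (0 + k) with k in Hk by ring.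
pose proof (Cmod_ge_0 k).
replace (psum eisenstein' 4 k) with ((psum eisenstein' 4 k - 0 - b * k - c * k ^ 2) + b * k + c * k ^ 2) by ring.
eapply Rle_trans; [apply Cmod_triangle|].
eapply Rle_trans; [apply Rplus_le_compat_r, Cmod_triangle|].
rewrite !Cmod_mult, Cmod_pow.
assert (Cmod k ^ 2 <= Cmod k)%R by nra. assert (Cmod k ^ 3 <= Cmod k)%R by (simpl; nra).
simpl pow in *. nra.
Qed.

Lemma not_eisenstein_small (k : C) : k <> 0 -> (Cmod k < 1)%R -> ~ eisenstein k.
Proof. intros Nk Hk H. pose proof (eisenstein_ge_1 k H Nk). lra. Qed.

Lemma psum_4_split (k : C) : k <> 0 -> (Cmod k < 1)%R ->
  psum eisenstein 4 k = / k ^ 4 + psum eisenstein' 4 k.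
Proof.
intros Nk Hk. assert (Ek := not_eisenstein_small k Nk Hk).
apply (is_sum_over_unique _ _ _ _ (psum_is_sum 4 k ltac:(lia) Ek)).
replace (/ k ^ 4) with (/ (k - 0) ^ 4) by (do 2 f_equal; ring).
apply (is_sum_over_insert eisenstein 0 (fun l => / (k - l) ^ 4) _ eisenstein_0).
destruct (eisenstein_separated k Ek) as (c & Hs).
apply (psum_correct eisenstein' 4 k c eisenstein'_sub ltac:(lia)).
apply (separated_sub _ eisenstein); auto. apply eisenstein'_sub.
Qed.

(** At [0] the poles [6 / k^4] cancel and leave [6 q - 12 p / k^2 - 6 p^2] with [p = O(k^3)] and
    [q = O(k)], which is the [O(k)] that [periodic_liouville] asks for. *)
Lemma wp_ode (z : C) : ~ eisenstein z -> wp'' z = 6 * wp z ^ 2.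
Proof.
intros Hz.
assert (E : wp'' z - 6 * (wp z * wp z) = 0).
2: { replace (wp'' z) with (wp'' z - 6 * (wp z * wp z) + 6 * wp z ^ 2) by ring. rewrite E. ring. }
revert z Hz. apply (periodic_liouville (fun z => wp'' z - 6 * (wp z * wp z))).
- intros z Hz. apply taylor2_minus; [apply wp''_taylor2; auto|].
  apply (taylor2_mult (fun _ => 6)); [apply taylor2_const|].
  apply taylor2_mult; do 2 eexists; apply wp_taylor2; auto.
- intros z l Hl Hz. rewrite wp''_periodic, wp_periodic; auto.
- destruct wp_reg_small as (M1 & HM1 & B1). destruct psum_reg_small as (M2 & HM2 & B2).
  exists (6 * M2 + 12 * M1 + 6 * M1 ^ 2)%R.
  generalize (near_and _ _ _ (near_and _ _ _ B1 B2) (near_0_ball 1 Rlt_0_1)). apply near_imp.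
  intros k ((H1 & H2) & Hk) Nk.
  unfold wp'', wp. rewrite psum_4_split by auto.
  set (p := wp_reg k) in *. set (q := psum eisenstein' 4 k) in *.
  replace (6 * (/ k ^ 4 + q) - 6 * ((/ k ^ 2 + p) * (/ k ^ 2 + p))) with (6 * q - (12 * (p * / k ^ 2) + 6 * (p * p))) by (field; auto).
  assert (Pk := proj1 (Cmod_gt_0 _) Nk).
  assert (H3 : (Cmod (p * / k ^ 2) <= M1 * Cmod k)%R).
  { rewrite Cmod_mult, Cmod_inv_pow by auto. apply Rmult_le_reg_r with (Cmod k ^ 2)%R; [apply pow_lt; auto|].
    rewrite Rmult_assoc, Rinv_l, Rmult_1_r by (apply pow_nonzero; lra).
    eapply Rle_trans; [exact H1|]. right. ring. }
  assert (H4 : (Cmod (p * p) <= M1 ^ 2 * Cmod k)%R).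
  { rewrite Cmod_mult. pose proof (Cmod_ge_0 p).
    assert (Cmod k ^ 3 <= Cmod k)%R by (simpl; nra). assert (Cmod k ^ 3 <= 1)%R by (simpl; nra).
    assert (0 <= Cmod k ^ 3)%R by (apply pow_le; lra).
    apply Rle_trans with ((M1 * Cmod k ^ 3) * (M1 * Cmod k ^ 3))%R; [apply Rmult_le_compat; auto|].
    replace (M1 * Cmod k ^ 3 * (M1 * Cmod k ^ 3))%R with (M1 ^ 2 * (Cmod k ^ 3 * Cmod k ^ 3))%R by ring.
    apply Rmult_le_compat_l; [apply pow2_ge_0|]. nra. }
  eapply Rle_trans; [apply Cmod_triangle_minus|].
  eapply Rle_trans; [apply Rplus_le_compat_l, Cmod_triangle|].
  rewrite (Cmod_mult 6 q), (Cmod_mult 12), (Cmod_mult 6), !Cmod_R, !Rabs_pos_eq by lra. lra.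
Qed.

(** [(wp k - a) k^2] tends to [1]. General [a] serves surjectivity; [a = 0] serves the poles of the
    rescaled functions. *)
Lemma wp_pole_0 (a : C) : near 0 (fun k => k <> 0 -> (1 / 2 <= Cmod (wp k - a) * Cmod k ^ 2)%R).
Proof.
destruct wp_reg_small as (M & HM & B). pose proof (Cmod_ge_0 a) as Pa.
assert (Q : (0 < 1 / (2 * (1 + M + Cmod a)))%R) by (apply Rdiv_lt_0_compat; lra).
generalize (near_and _ _ _ (near_and _ _ _ B (near_0_ball _ Q)) (near_0_ball 1 Rlt_0_1)). apply near_imp.
intros k ((H1 & H2) & Hk) Nk.
rewrite <- Cmod_pow, <- Cmod_mult.
replace ((wp k - a) * k ^ 2) with (1 - k ^ 2 * (a - wp_reg k)) by (unfold wp; field; auto).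
pose proof (Cmod_ge_0 k) as Pk.
pose proof (Cmod_triangle_rev 1 (k ^ 2 * (a - wp_reg k))) as T. rewrite Cmod_1, Cmod_mult, Cmod_pow in T.
pose proof (Cmod_triangle_minus a (wp_reg k)) as T2.
assert (Cmod (wp_reg k) <= M)%R.
{ eapply Rle_trans; [exact H1|]. rewrite <- (Rmult_1_r M) at 2. apply Rmult_le_compat_l; auto.
  rewrite <- (pow1 3). apply pow_incr. lra. }
pose proof (Cmod_ge_0 (a - wp_reg k)).
assert (Cmod k ^ 2 * Cmod (a - wp_reg k) <= 1 / 2)%R; [|lra].
apply Rle_trans with (Cmod k * (1 + M + Cmod a))%R.
- apply Rmult_le_compat; try lra; [apply pow2_ge_0|]. simpl. nra.
- replace (1 / 2)%R with (1 / (2 * (1 + M + Cmod a)) * (1 + M + Cmod a))%R by (field; lra).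
  apply Rmult_le_compat_r; lra.
Qed.

(** * Values and first integral of the Weierstrass function *)

Lemma half_not_eisenstein : ~ eisenstein (/ 2).
Proof.
assert (N : RtoC 2 <> 0) by (intros E; apply RtoC_inj in E; lra).
apply not_eisenstein_small.
- intros E. apply N. replace (RtoC 2) with (2 * (/ 2 * 2)) by (field; auto). rewrite E. ring.
- rewrite Cmod_inv, Cmod_R, Rabs_pos_eq by (auto; lra). lra.
Qed.

Lemma wp_surjective (a : C) : exists z, ~ eisenstein z /\ wp z = a.
Proof.
apply NNPP. intros N.
assert (Na : forall z, ~ eisenstein z -> wp z - a <> 0).
{ intros z Hz E. apply N. exists z. split; auto. replace (wp z) with (wp z - a + a) by ring. rewrite E. ring. }
assert (Hh := half_not_eisenstein).
apply (Cmult_neq_0 (/ (wp (/ 2) - a)) (wp (/ 2) - a)).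
- intros E. apply C1_nz. rewrite <- (Cinv_l _ (Na _ Hh)), E. ring.
- apply Na, Hh.
- rewrite (periodic_liouville (fun z => / (wp z - a))); auto; [ring| | |].
  + intros z Hz. apply (taylor2_inv (fun z => wp z - a)); [apply Na, Hz|].
    apply (taylor2_minus wp (fun _ => a)); [|apply taylor2_const].
    do 2 eexists; apply wp_taylor2; auto.
  + intros z l Hl Hz. rewrite wp_periodic; auto.
  (* Near the pole, [1 / |wp k - a| <= 2 |k|^2 <= 2 |k|]. *)
  + exists 2%R. generalize (near_and _ _ _ (wp_pole_0 a) (near_0_ball 1 Rlt_0_1)). apply near_imp.
    intros k (H1 & Hk) Nk. specialize (H1 Nk).
    assert (Nw := Na k (not_eisenstein_small k Nk Hk)). assert (Pw := proj1 (Cmod_gt_0 _) Nw).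
    rewrite Cmod_inv by auto. assert (Pk := proj1 (Cmod_gt_0 _) Nk).
    apply Rmult_le_reg_r with (Cmod (wp k - a)); auto. rewrite Rinv_l by lra. simpl in H1. nra.
Qed.

(** The first integral of [wp'' = 6 wp^2]; its constant value is [- g_3]. *)
Definition wp_invariant (z : C) : C := wp' z ^ 2 - 4 * wp z ^ 3.

Lemma wp_Cder (z : C) : ~ eisenstein z -> Cder wp z (wp' z).
Proof. intros Hz. apply (taylor2_Cder _ _ _ _ (wp_taylor2 z Hz)). Qed.

Lemma wp'_Cder (z : C) : ~ eisenstein z -> Cder wp' z (wp'' z).
Proof. intros Hz. destruct (wp'_taylor2 z Hz) as (c & H). apply (taylor2_Cder _ _ _ _ H). Qed.

Lemma wp_invariant_Cder (z : C) : ~ eisenstein z -> Cder wp_invariant z 0.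
Proof.
intros Hz. assert (D := wp_Cder z Hz). assert (D' := wp'_Cder z Hz).
assert (H : Cder (fun w => wp' w * wp' w - 4 * (wp w * (wp w * wp w))) z
  ((wp'' z * wp' z + wp' z * wp'' z) - 4 * (wp' z * (wp z * wp z) + wp z * (wp' z * wp z + wp z * wp' z)))).
{ apply (Cder_minus (fun w => wp' w * wp' w)).
  - apply Cder_mult; auto.
  - apply (Cder_scal (fun w => wp w * (wp w * wp w))). apply (Cder_mult wp (fun w => wp w * wp w)); auto. apply Cder_mult; auto. }
rewrite wp_ode in H by auto.
match type of H with Cder _ _ ?l => replace l with (RtoC 0) in H by ring end.
apply (Cder_ext_loc _ _ _ _ 1 Rlt_0_1) with (2 := H).
intros w _. unfold wp_invariant. ring.
Qed.

(** The punctured disc misses the lattice and meets every other class modulo it. A vanishing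
    derivative gives local constancy through [linear_ode_zero] with [v = phi = 0], and annuli about
    [0] connect the points. *)
Lemma wp_invariant_disc (a b : C) : a <> 0 -> b <> 0 -> (Cmod a <= 3 / 4)%R -> (Cmod b <= 3 / 4)%R ->
  wp_invariant b = wp_invariant a.
Proof.
intros Na Nb Ha Hb.
apply (annulus_continuation (fun w => wp_invariant w = wp_invariant a) 0 a b Na Nb); [|reflexivity].
replace (a - 0) with a by ring. replace (b - 0) with b by ring.
intros w Hw. replace (w - 0) with w in Hw by ring.
assert (Ew : ~ eisenstein w).
{ apply not_eisenstein_small.
  - apply Cmod_gt_0. eapply Rlt_le_trans; [|apply Hw]. apply Rmin_pos; apply Cmod_gt_0; auto.
  - eapply Rle_lt_trans; [apply Hw|]. apply Rmax_lub_lt; lra. }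
split.
- intros E. destruct (not_eisenstein_near w Ew) as (d & Hd & H). exists d. split; auto.
  intros w' Hw'.
  destruct (linear_ode_zero (fun x => wp_invariant x - wp_invariant w) (fun _ => 0) (fun _ => 0) w d 0) with (w := w') as (H0 & _); auto.
  + intros x Hx. split; [|split].
    * replace (RtoC 0) with (0 - 0) by ring. apply (Cder_minus wp_invariant (fun _ => wp_invariant w)); [apply wp_invariant_Cder; auto|apply Cder_const].
    * replace (0 * (wp_invariant x - wp_invariant w)) with (RtoC 0) by ring. apply Cder_const.
    * rewrite Cmod_0. lra.
  + ring.
  + rewrite <- E. replace (wp_invariant w') with (wp_invariant w' - wp_invariant w + wp_invariant w) by ring.
    rewrite H0. ring.
- intros Had. apply (adherent_eq (fun w => wp_invariant w = wp_invariant a) wp_invariant (fun _ => wp_invariant a) w 0 0); auto.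
  + apply wp_invariant_Cder; auto.
  + apply Cder_const.
Qed.

Definition wp_g3 : C := - wp_invariant (/ 2).

Lemma wp_first_order (z : C) : ~ eisenstein z -> wp' z ^ 2 = 4 * wp z ^ 3 - wp_g3.
Proof.
intros Hz. destruct (eisenstein_close z) as (l & El & Hl).
assert (El' := eisenstein_opp l El).
assert (E : wp_invariant z = wp_invariant (/ 2)).
{ transitivity (wp_invariant (z + - l)).
  - unfold wp_invariant. rewrite wp'_periodic, wp_periodic; auto.
  - assert (N2 : RtoC 2 <> 0) by (intros E; apply RtoC_inj in E; lra).
    apply wp_invariant_disc.
    + intros E. apply half_not_eisenstein. rewrite E. apply eisenstein_0.
    + intros E. apply Hz. replace z with (z + - l + l) by ring. rewrite E. replace (0 + l) with l by ring. exact El.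
    + rewrite Cmod_inv, Cmod_R, Rabs_pos_eq by (auto; lra). lra.
    + exact Hl. }
unfold wp_g3. rewrite <- E. unfold wp_invariant. ring.
Qed.

(** * Model solutions *)

Lemma near_affine (a b z : C) (P : C -> Prop) :
  near (a * z + b) P -> near z (fun w => P (a * w + b)).
Proof.
intros (d & Hd & H). pose proof (Cmod_ge_0 a).
exists (d / (1 + Cmod a))%R. split; [apply Rdiv_lt_0_compat; lra|]. intros w Hw. apply H.
replace (a * w + b - (a * z + b)) with (a * (w - z)) by ring. rewrite Cmod_mult.
pose proof (Cmod_ge_0 (w - z)).
apply Rle_lt_trans with ((1 + Cmod a) * Cmod (w - z))%R; [apply Rmult_le_compat_r; lra|].
replace d with ((1 + Cmod a) * (d / (1 + Cmod a)))%R by (field; lra).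
apply Rmult_lt_compat_l; lra.
Qed.

Lemma near_near' (z : C) (P : C -> Prop) : near z (fun w => w <> z -> P w) -> near' z P.
Proof. intros (d & Hd & H). exists d. auto. Qed.

Lemma ode_solution_zero (D : C -> Prop) : ode_solution D (fun _ => Some (RtoC 0)) (fun _ => 0).
Proof.
intros z _. split; [|discriminate]. intros _. exists 1%R. split; [lra|]. intros w _.
split; [discriminate|]. split.
- apply Cder_const.
- replace (6 * finval (fun _ => Some (RtoC 0)) w ^ 2) with (RtoC 0) by (unfold finval; ring). apply Cder_const.
Qed.

Lemma inv_pow_Cder (n : nat) (z : C) : z <> 0 -> Cder (fun w => / w ^ n) z (- INR n * / z ^ (n + 1)).
Proof.
intros Hz. destruct (inv_pow_taylor n) as (K & HK & T).
assert (Pz := proj1 (Cmod_gt_0 _) Hz).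
apply (taylor2_Cder _ _ _ (INR n * (INR n + 1) / 2 * / z ^ (n + 2))).
exists (K * / Cmod z ^ (n + 3))%R. split.
{ apply Rmult_le_pos; auto. left. apply Rinv_0_lt_compat, pow_lt, Pz. }
generalize (near_0_ball (Cmod z / 2) ltac:(lra)). apply near_imp. intros k Hk.
specialize (T z k Hz ltac:(lra)).
match goal with |- (Cmod ?X <= _)%R => match type of T with (Cmod ?Y <= _)%R => replace X with Y by ring end end.
eapply Rle_trans; [exact T|]. right. ring.
Qed.

Lemma Cmod_inv_sqr_large (M : R) : near 0 (fun k => k <> 0 -> (M < Cmod (/ k ^ 2))%R).
Proof.
pose proof (Rabs_pos M) as PM. pose proof (Rle_abs M).
assert (Q : (0 < / (1 + Rabs M))%R) by (apply Rinv_0_lt_compat; lra).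
generalize (near_and _ _ _ (near_0_ball 1 Rlt_0_1) (near_0_ball _ Q)). apply near_imp.
intros k (H1 & H2) Nk. rewrite Cmod_inv_pow by auto.
assert (Pk := proj1 (Cmod_gt_0 _) Nk).
apply Rlt_le_trans with (1 + Rabs M)%R; [lra|].
rewrite <- (Rinv_inv (1 + Rabs M)). apply Rinv_le_contravar; [apply pow_lt; auto|]. simpl. nra.
Qed.

Lemma ode_solution_inv_square (D : C -> Prop) (g : C) :
  ode_solution D (fun z => inv_square (z + g)) (fun z => - (2) * / (z + g) ^ 3).
Proof.
assert (R : forall w, w + g <> 0 -> inv_square (w + g) = Some (/ (w + g) ^ 2)).
{ intros w Hw. unfold inv_square. destruct (Ceq_dec (w + g) 0); tauto. }
assert (S : forall z, z + g <> 0 -> near z (fun w => w + g <> 0)).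
{ intros z Hz. exists (Cmod (z + g)). split; [apply Cmod_gt_0; auto|]. intros w Hw E.
  replace (w - z) with (- (z + g)) in Hw by (replace w with (w + g - g) by ring; rewrite E; ring).
  rewrite Cmod_opp in Hw. lra. }
assert (A : forall z, z + g <> 0 -> ode_at (fun z => inv_square (z + g)) (fun z => - (2) * / (z + g) ^ 3) z).
{ intros z Hz.
  assert (Ez : forall w, 1 * w + g = w + g) by (intros; ring).
  assert (D2 := inv_pow_Cder 2 (1 * z + g) ltac:(rewrite Ez; exact Hz)). apply Cder_affine in D2.
  assert (D3 := inv_pow_Cder 3 (1 * z + g) ltac:(rewrite Ez; exact Hz)). apply Cder_affine in D3.
  split; [rewrite R by auto; discriminate|]. split.
  - destruct (S z Hz) as (d & Hd & K).
    apply Cder_ext_loc with (fun w => / (1 * w + g) ^ 2) d; auto.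
    + intros w Hw. unfold finval. rewrite R by auto. rewrite Ez. reflexivity.
    + match type of D2 with Cder _ _ ?l => replace (- (2) * / (z + g) ^ 3) with l; [exact D2|] end.
      rewrite Ez. simpl. rewrite RtoC_plus. ring.
  - apply (Cder_scal _ (- (2))) in D3.
    apply Cder_ext_loc with (fun w => - (2) * / (1 * w + g) ^ 3) 1%R; [lra| |].
    + intros w _. rewrite Ez. reflexivity.
    + match type of D3 with Cder _ _ ?l => replace (6 * finval (fun z => inv_square (z + g)) z ^ 2) with l; [exact D3|] end.
      unfold finval. rewrite R, Ez by auto. simpl. rewrite !RtoC_plus. field. auto. }
intros z _. split.
- intros Hz. assert (Nz : z + g <> 0).
  { intros E. apply Hz. unfold inv_square. destruct (Ceq_dec (z + g) 0); tauto. }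
  generalize (S z Nz). apply near_imp. exact A.
- intros Hz. assert (Zz : z + g = 0).
  { destruct (Ceq_dec (z + g) 0) as [|N]; auto. rewrite R in Hz by auto. discriminate. }
  assert (Nw : forall w, w <> z -> w + g <> 0).
  { intros w Hw E. apply Hw. replace w with (w + g - g) by ring. rewrite E, <- Zz. ring. }
  split.
  + exists 1%R. split; [lra|]. intros w Hw _. apply A, Nw, Hw.
  + intros M. apply near_near'.
    assert (L : near (1 * z + g) (fun k => k <> 0 -> (M < Cmod (/ k ^ 2))%R)).
    { replace (1 * z + g) with (RtoC 0) by (rewrite <- Zz; ring). apply Cmod_inv_sqr_large. }
    apply near_affine in L. revert L. apply near_imp. intros w Hw Nz.
    replace (1 * w + g) with (w + g) in Hw by ring. unfold finval. rewrite R by auto. auto.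
Qed.

Definition scaled_lattice (c z : C) : Prop := eisenstein (z / c).

Lemma scaled_lattice_hexagonal (c : C) : c <> 0 -> hexagonal_lattice (scaled_lattice c).
Proof.
intros Hc. exists c. split; auto. intros z. unfold scaled_lattice. split.
- intros (m & n & E). exists m, n. fold zeta. rewrite <- E. field. auto.
- intros (m & n & ->). exists m, n. fold zeta. field. auto.
Qed.

(** Homogeneity of degree [-2], by reindexing the sum with [l -> l / c]. *)
Lemma weierstrass_p_scaled (c z : C) : c <> 0 -> ~ eisenstein (z / c) ->
  weierstrass_p z (scaled_lattice c) = Some (/ c ^ 2 * wp (z / c)).
Proof.
intros Hc Hz. unfold weierstrass_p.
destruct (excluded_middle_informative (scaled_lattice c z)) as [H|_]; [contradiction|]. f_equal.
destruct (eisenstein_separated _ Hz) as (e & He).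
assert (Hs : separated eisenstein' (z / c) e) by (apply (separated_sub _ eisenstein); auto; apply eisenstein'_sub).
assert (Sum := wp_sum_exists eisenstein' (z / c) e eisenstein'_sub Hs). fold (wp_reg (z / c)) in Sum.
assert (Nz : z <> 0).
{ intros ->. apply Hz. replace (0 / c) with (RtoC 0) by (field; auto). apply eisenstein_0. }
rewrite (sum_over_unique _ _ (/ c ^ 2 * wp_reg (z / c))).
{ unfold wp. field. auto. }
apply is_sum_over_ext with (fun l => / c ^ 2 * (/ (z / c - l / c) ^ 2 - / (l / c) ^ 2)).
- intros l (Hl & Nl).
  assert (N : z - l <> 0).
  { intros E. apply Hz. replace z with (z - l + l) by ring. rewrite E. replace (0 + l) with l by ring. exact Hl. }
  field. repeat split; auto.
- apply (is_sum_over_reindex (fun l => scaled_lattice c l /\ l <> 0) eisenstein' (fun l => l / c) (fun l => c * l)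
    (fun l => / c ^ 2 * (/ (z / c - l) ^ 2 - / l ^ 2))).
  + intros l (Hl & Nl). split; auto. intros E. apply Nl. replace l with (l / c * c) by (field; auto). rewrite E. ring.
  + intros l (Hl & Nl). split; [|apply Cmult_neq_0; auto].
    unfold scaled_lattice. replace (c * l / c) with l by (field; auto). exact Hl.
  + intros. field. auto.
  + intros. field. auto.
  + apply is_sum_over_scal, Sum.
Qed.

Lemma weierstrass_p_pole (c z : C) : eisenstein (z / c) -> weierstrass_p z (scaled_lattice c) = None.
Proof.
intros H. unfold weierstrass_p.
destruct (excluded_middle_informative (scaled_lattice c z)) as [_|N]; [reflexivity|contradiction].
Qed.

(** The equation survives the rescaling because [F''] and [F^2] both acquire [c^(-4)]. At a pole,
    periodicity moves the lattice point to [0], where [wp_pole_0] gives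
    [|wp k| >= 1 / (2 |k|^2)]. *)
Lemma ode_solution_weierstrass (D : C -> Prop) (c g : C) : c <> 0 ->
  ode_solution D (fun z => weierstrass_p (z + g) (scaled_lattice c))
    (fun z => / c ^ 3 * wp' ((z + g) / c)).
Proof.
intros Hc.
assert (Ez : forall w, / c * w + g / c = (w + g) / c) by (intros; field; auto).
assert (S : forall z, ~ eisenstein ((z + g) / c) -> near z (fun w => ~ eisenstein ((w + g) / c))).
{ intros z Hz. rewrite <- Ez in Hz. apply not_eisenstein_near, near_affine in Hz.
  revert Hz. apply near_imp. intros w. rewrite Ez. auto. }
assert (A : forall z, ~ eisenstein ((z + g) / c) ->
  ode_at (fun z => weierstrass_p (z + g) (scaled_lattice c)) (fun z => / c ^ 3 * wp' ((z + g) / c)) z).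
{ intros z Hz.
  split; [rewrite weierstrass_p_scaled by auto; discriminate|].
  assert (D0 := wp_Cder _ Hz). assert (D1 := wp'_Cder _ Hz).
  rewrite <- Ez in D0, D1. apply Cder_affine in D0, D1.
  apply (Cder_scal _ (/ c ^ 2)) in D0. apply (Cder_scal _ (/ c ^ 3)) in D1.
  rewrite Ez in D0, D1.
  split.
  - destruct (S z Hz) as (d & Hd & K).
    apply Cder_ext_loc with (fun w => / c ^ 2 * wp (/ c * w + g / c)) d; auto.
    + intros w Hw. unfold finval. rewrite weierstrass_p_scaled by auto. rewrite Ez. reflexivity.
    + match type of D0 with Cder _ _ ?l => replace (/ c ^ 3 * wp' ((z + g) / c)) with l by (field; auto) end. exact D0.
  - apply Cder_ext_loc with (fun w => / c ^ 3 * wp' (/ c * w + g / c)) 1%R; [lra| |].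
    + intros w _. rewrite Ez. reflexivity.
    + match type of D1 with Cder _ _ ?l => replace (6 * finval (fun z => weierstrass_p (z + g) (scaled_lattice c)) z ^ 2) with l; [exact D1|] end.
      unfold finval. rewrite weierstrass_p_scaled by auto. rewrite wp_ode by auto. field. auto. }
intros z _. split.
- intros Hz. assert (Nz : ~ eisenstein ((z + g) / c)).
  { intros E. apply Hz. apply weierstrass_p_pole, E. }
  generalize (S z Nz). apply near_imp. exact A.
- intros Hz. assert (El : eisenstein ((z + g) / c)).
  { apply NNPP. intros N. rewrite weierstrass_p_scaled in Hz by auto. discriminate. }
  set (l := (z + g) / c) in *.
  assert (Nr : near z (fun w => (Cmod ((w + g) / c - l) < 1)%R)).
  { assert (N1 : near (/ c * z + g / c) (fun w => (Cmod (w - l) < 1)%R)).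
    { exists 1%R. split; [lra|]. intros w. rewrite Ez. auto. }
    apply near_affine in N1. revert N1. apply near_imp. intros w. rewrite Ez. auto. }
  assert (Nl : forall w, w <> z -> (w + g) / c - l <> 0).
  { intros w Hw E. apply Hw. replace w with (c * ((w + g) / c - l) + z) by (unfold l; field; auto). rewrite E. ring. }
  assert (Ne : forall w, w <> z -> (Cmod ((w + g) / c - l) < 1)%R -> ~ eisenstein ((w + g) / c)).
  { intros w Hw H1 E. apply (not_eisenstein_small _ (Nl w Hw) H1). apply eisenstein_minus; auto. }
  split.
  + apply near_near'. revert Nr. apply near_imp. intros w H1 Hw. apply A, Ne; auto.
  + intros M. apply near_near'.
    (* In the threshold, [2] makes up for the bound [1 / 2] and [Cmod (c ^ 2)] for the scaling
       factor [/ c ^ 2]. *)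
    assert (L : near z (fun w => (w + g) / c - l <> 0 -> (1 / 2 <= Cmod (wp ((w + g) / c - l)%C - 0) * Cmod ((w + g) / c - l) ^ 2)%R
       /\ (2 * Cmod (c ^ 2) * M < Cmod (/ ((w + g) / c - l) ^ 2))%R)).
    { assert (W : near (/ c * z + (g / c - l)) (fun k => k <> 0 -> (1 / 2 <= Cmod (wp k - 0) * Cmod k ^ 2)%R /\ (2 * Cmod (c ^ 2) * M < Cmod (/ k ^ 2))%R)).
      { replace (/ c * z + (g / c - l)) with (RtoC 0) by (unfold l; field; auto).
        generalize (near_and _ _ _ (wp_pole_0 0) (Cmod_inv_sqr_large (2 * Cmod (c ^ 2) * M))). apply near_imp.
        intros k (H1 & H2) Nk. auto. }
      apply near_affine in W. revert W. apply near_imp. intros w.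
      replace (/ c * w + (g / c - l)) with ((w + g) / c - l) by (field; auto). auto. }
    generalize (near_and _ _ _ Nr L). apply near_imp. intros w (H1 & H2) Hw.
    assert (Nw := Nl w Hw). destruct (H2 Nw) as (H3 & H4).
    unfold finval. rewrite weierstrass_p_scaled by auto.
    rewrite <- (wp_periodic _ (- l)) by (auto; apply eisenstein_opp; auto).
    change ((w + g) / c + - l) with ((w + g) / c - l). set (k := (w + g) / c - l) in *.
    replace (wp k - 0) with (wp k) in H3 by ring.
    assert (Pk := proj1 (Cmod_gt_0 _) Nw). assert (Pc := proj1 (Cmod_gt_0 _) (Cpow_neq_0 c 2 Hc)).
    rewrite Cmod_inv_pow in H4 by auto.
    assert (Pk2 : (0 < Cmod k ^ 2)%R) by (apply pow_lt; auto).
    rewrite Cmod_mult, Cmod_inv by (apply Cpow_neq_0; auto).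
    apply Rmult_lt_reg_l with (Cmod (c ^ 2)); auto.
    rewrite <- Rmult_assoc, Rinv_r, Rmult_1_l by lra.
    apply Rlt_le_trans with (/ 2 * / Cmod k ^ 2)%R; [lra|].
    apply Rmult_le_reg_r with (Cmod k ^ 2)%R; auto.
    rewrite Rmult_assoc, Rinv_l by lra. lra.
Qed.

(** If it vanished, [wp'] would vanish at a zero of [wp]; then [wp] would coincide with the zero
    solution, even at its pole [0]. *)
Lemma wp_g3_neq_0 : wp_g3 <> 0.
Proof.
intros E0. destruct (wp_surjective 0) as (w0 & H0 & E).
assert (E1 : wp' w0 = 0).
{ pose proof (wp_first_order w0 H0) as F. rewrite E, E0 in F.
  destruct (Ceq_dec (wp' w0) 0) as [|N]; auto. exfalso.
  apply (Cpow_neq_0 _ 2 N). rewrite F. ring. }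
assert (C1 := C1_nz).
assert (D1 : forall w : C, w / 1 = w) by (intros; field).
assert (H : weierstrass_p (0 + 0) (scaled_lattice 1) = Some (RtoC 0)).
2: { rewrite weierstrass_p_pole in H; [discriminate|]. rewrite D1. replace (0 + 0) with (RtoC 0) by ring. apply eisenstein_0. }
assert (W : weierstrass_p (w0 + 0) (scaled_lattice 1) = Some (RtoC 0)).
{ replace (w0 + 0) with w0 by ring. rewrite weierstrass_p_scaled by (rewrite ?D1; auto). rewrite D1, E. f_equal. ring. }
(* The centre [w0 + 1] only has to differ from [w0] and from [0]. *)
apply (ode_continuation (fun _ => True) (fun z => weierstrass_p (z + 0) (scaled_lattice 1)) (fun _ => Some (RtoC 0))
  (fun z => / 1 ^ 3 * wp' ((z + 0) / 1)) (fun _ => 0) w0 0 (w0 + 1)).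
- apply ode_solution_weierstrass, C1.
- apply ode_solution_zero.
- intros Ew. apply C1. replace (RtoC 1) with (w0 + 1 - w0) by ring. rewrite <- Ew. ring.
- intros Ew. apply H0. replace w0 with (- (1)) by (replace w0 with (w0 + 1 - 1) by ring; rewrite <- Ew; ring).
  apply eisenstein_opp, eisenstein_1.
- auto.
- rewrite W. discriminate.
- discriminate.
- unfold finval. rewrite W. reflexivity.
- replace (w0 + 0) with w0 by ring. rewrite D1, E1. ring.
Qed.

(** * Classification on the exterior of the unit disc *)

Lemma meromorphic_ode_solution (F : C -> sphere) :
  meromorphic_on De F -> solves_ode De F -> ode_solution De F (C_derive (finval F)).
Proof.
intros Hm Ho.
assert (A : forall w, De w -> finite_diff F w -> ode_at F (C_derive (finval F)) w).
{ intros w Dw (H1 & H2). split; [exact H1|]. split.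
  - apply (C_derive_correct _ _ 0). exact H2.
  - apply Ho; auto. }
assert (N : forall z, De z -> near z De).
{ intros z Dz. exists (Cmod z - 1)%R. unfold De in *. split; [lra|]. intros w Hw.
  pose proof (Cmod_triangle_rev z w). rewrite Cmod_minus_sym in Hw. lra. }
intros z Dz. specialize (Hm z Dz). unfold meromorphic_at in Hm. destruct (F z) as [fz|] eqn:E.
- split; [|discriminate]. intros _. apply locally_Cmod in Hm.
  generalize (near_and _ _ _ (N z Dz) Hm). apply near_imp. intros w (H1 & H2). apply A; auto.
- split; [tauto|]. intros _. destruct Hm as (H1 & H2). split.
  + apply locally'_Cmod in H1. apply near_near'. destruct H1 as (d & Hd & H1).
    destruct (N z Dz) as (e & He & K). exists (Rmin d e). split; [apply Rmin_pos; auto|].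
    intros w Hw Nw. pose proof (Rmin_l d e). pose proof (Rmin_r d e). apply A; [apply K|apply H1]; auto; lra.
  + intros M. specialize (H2 (fun x => (M < x)%R)). unfold filtermap in H2. apply locally'_Cmod.
    apply H2. exists M. auto.
Qed.

(** If [2] is a pole, it is isolated, and a point slightly to its right is regular. *)
Lemma regular_point (F : C -> sphere) : meromorphic_on De F -> exists a, De a /\ F a <> None.
Proof.
intros Hm. assert (D2 : De 2) by (unfold De; rewrite Cmod_R, Rabs_pos_eq; lra).
destruct (F 2) as [w|] eqn:E; [exists 2; rewrite E; split; [auto|discriminate]|].
specialize (Hm 2 D2). unfold meromorphic_at in Hm. rewrite E in Hm. destruct Hm as (H1 & _).
apply locally'_Cmod in H1. destruct H1 as (d & Hd & H1).
exists (2 + d / 2)%R. split.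
- unfold De. rewrite Cmod_R, Rabs_pos_eq; lra.
- apply H1.
  + intros Eq. apply RtoC_inj in Eq. lra.
  + rewrite <- RtoC_minus, Cmod_R, Rabs_pos_eq; lra.
Qed.

Lemma ode_continuation_De (F G : C -> sphere) (f1 g1 : C -> C) (a : C) :
  ode_solution De F f1 -> ode_solution De G g1 -> De a ->
  F a <> None -> G a <> None -> finval F a = finval G a -> f1 a = g1 a ->
  forall z, De z -> F z = G z.
Proof.
intros SF SG Da Fa Ga E E1 z Dz. unfold De in *.
apply (ode_continuation De F G f1 g1 a z 0); auto.
- intros ->. rewrite Cmod_0 in Da. lra.
- intros ->. rewrite Cmod_0 in Dz. lra.
- intros w Hw. unfold De. replace (w - 0) with w in Hw by ring.
  replace (a - 0) with a in Hw by ring. replace (z - 0) with z in Hw by ring.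
  apply Rlt_gt. eapply Rlt_le_trans; [|exact Hw]. apply Rmin_glb_lt; lra.
Qed.

Theorem theorem4p19 (F : C -> sphere)
  (hmero : meromorphic_on De F) (hode : solves_ode De F) :
  (forall z, De z -> F z = Some (RtoC 0)) \/
  (exists gamma0 : C, forall z, De z -> F z = inv_square (z + gamma0)%C) \/
  (exists (gamma0 : C) (L : C -> Prop), hexagonal_lattice L /\
     forall z, De z -> F z = weierstrass_p (z + gamma0)%C L).
Proof.
assert (SF := meromorphic_ode_solution F hmero hode). set (f1 := C_derive (finval F)) in *.
destruct (regular_point F hmero) as (a & Da & Fa).
set (x := finval F a). set (y := f1 a).
destruct (Ceq_dec (4 * x ^ 3 - y ^ 2) 0) as [E|N].
- destruct (Ceq_dec x 0) as [Ex|Nx].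
  + left. assert (Ey : y = 0).
    { destruct (Ceq_dec y 0) as [|Ny]; auto. exfalso. apply (Cpow_neq_0 y 2 Ny).
      replace (y ^ 2) with (4 * x ^ 3 - (4 * x ^ 3 - y ^ 2)) by ring. rewrite E, Ex. ring. }
    apply (ode_continuation_De F (fun _ => Some (RtoC 0)) f1 (fun _ => 0) a); auto using ode_solution_zero.
    discriminate.
  + right; left.
    assert (E' : y ^ 2 = 4 * x ^ 3) by (replace (y ^ 2) with (4 * x ^ 3 - (4 * x ^ 3 - y ^ 2)) by ring; rewrite E; ring).
    assert (N4 : RtoC 4 <> 0) by (intros H; apply RtoC_inj in H; lra).
    assert (N2 : RtoC 2 <> 0) by (intros H; apply RtoC_inj in H; lra).
    assert (Ny : y <> 0).
    { intros Ey. apply (Cmult_neq_0 4 (x ^ 3)); auto using Cpow_neq_0. rewrite <- E', Ey. ring. }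
    (* Solving [t^(-2) = x] and [-2 t^(-3) = y] for [t = a + gamma0] gives [t = -2 x / y]. *)
    assert (Eg : a + (- (2) * x / y - a) = - (2) * x / y) by ring.
    assert (Nt : - (2) * x / y <> 0).
    { intros H. apply Nx. replace x with (- (2) * x / y * y * (- / 2)) by (field; auto). rewrite H. ring. }
    exists (- (2) * x / y - a).
    assert (Gv : inv_square (a + (- (2) * x / y - a)) = Some x).
    { rewrite Eg. unfold inv_square. destruct (Ceq_dec (- (2) * x / y) 0) as [H|_]; [contradiction|]. f_equal.
      transitivity (y ^ 2 / (4 * x ^ 2)); [field; auto|rewrite E'; field; auto]. }
    apply (ode_continuation_De F _ f1 (fun z => - (2) * / (z + (- (2) * x / y - a)) ^ 3) a); auto.
    * apply ode_solution_inv_square.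
    * cbv beta. rewrite Gv. discriminate.
    * unfold finval at 2. rewrite Gv. reflexivity.
    * rewrite Eg. change (f1 a) with y. transitivity (y * y ^ 2 / (4 * x ^ 3)); [rewrite E'; field; auto|field; auto].
- right; right.
  assert (G0 := wp_g3_neq_0).
  assert (Nq : wp_g3 / (4 * x ^ 3 - y ^ 2) <> 0).
  { intros H. apply G0. replace wp_g3 with (wp_g3 / (4 * x ^ 3 - y ^ 2) * (4 * x ^ 3 - y ^ 2)) by (field; auto). rewrite H. ring. }
  (* [c^6 (4 x^3 - y^2) = wp_g3] makes the invariant of [c^(-2) wp (z / c)] equal to that of [F] at
     [a]. *)
  destruct (sixth_root _ Nq) as (c & Hc & Ec).
  destruct (wp_surjective (c ^ 2 * x)) as (w & Hw & Ew).
  assert (E6 : c ^ 6 * (4 * x ^ 3 - y ^ 2) = wp_g3) by (rewrite Ec; field; auto).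
  (* By [wp_first_order] the squares agree, so [wp' w] is [c^3 y] or its opposite. *)
  assert (Es : (c ^ 3 * y - wp' w) * (c ^ 3 * y + wp' w) = 0).
  { replace ((c ^ 3 * y - wp' w) * (c ^ 3 * y + wp' w)) with (c ^ 6 * y ^ 2 - wp' w ^ 2) by ring.
    rewrite (wp_first_order w Hw), Ew, <- E6. ring. }
  (* Replacing [c] by [- c] keeps [c^2 x] and reverses [c^3 y], at the same point [w]. *)
  assert (Hcase : exists c' : C, c' <> 0 /\ wp w = c' ^ 2 * x /\ wp' w = c' ^ 3 * y).
  { destruct (Ceq_dec (c ^ 3 * y - wp' w) 0) as [E1|N1].
    - exists c. repeat split; auto. replace (wp' w) with (c ^ 3 * y - (c ^ 3 * y - wp' w)) by ring. rewrite E1. ring.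
    - exists (- c). split; [|split].
      + intros H. apply Hc. replace c with (- - c) by ring. rewrite H. ring.
      + rewrite Ew. ring.
      + assert (E1 : c ^ 3 * y + wp' w = 0).
        { destruct (Ceq_dec (c ^ 3 * y + wp' w) 0) as [|N2]; auto. exfalso. apply (Cmult_neq_0 _ _ N1 N2 Es). }
        replace (wp' w) with (c ^ 3 * y + wp' w - c ^ 3 * y) by ring. rewrite E1. ring. }
  clear c Hc Ec Ew E6 Es. destruct Hcase as (c & Hc & Ew & Ew1).
  (* This shift carries [a] to [c w], so that [wp] is evaluated at [w]. *)
  exists (c * w - a), (scaled_lattice c). split; [apply scaled_lattice_hexagonal; auto|].
  assert (Eg : (a + (c * w - a)) / c = w) by (field; auto).
  assert (Gv : weierstrass_p (a + (c * w - a)) (scaled_lattice c) = Some x).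
  { rewrite weierstrass_p_scaled by (rewrite ?Eg; auto). rewrite Eg, Ew. f_equal. field. auto. }
  apply (ode_continuation_De F _ f1 (fun z => / c ^ 3 * wp' ((z + (c * w - a)) / c)) a); auto.
  + apply ode_solution_weierstrass. auto.
  + cbv beta. rewrite Gv. discriminate.
  + unfold finval at 2. rewrite Gv. reflexivity.
  + rewrite Eg, Ew1. change (f1 a) with y. field. auto.
Qed.
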